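(* Let $\pi_2$ be a generator of $\mathrm{LT}[\pi^2]$, let $\alpha\in\mathbf{C}$ satisfy $\alpha^{q(q+1)}=\pi_2$, let $\alpha_1$ be an element such that $\alpha_1^q=\alpha$, and let $\sigma\in I_F$ be an element fixing $\pi_2$. Write $\sigma(\alpha_1)=\zeta\alpha_1$ with $\zeta\in\mu_{q^2(q+1)}$. Then $\sigma$ acts on the reduction $\overline{\mathbf{Y}}^{\pi_2}_{2,2}$, given by $x^qy-xy^q=1$, $Z^q=x^{q^3}y-xy^{q^3}$, as $$\sigma:\overline{\mathbf{Y}}^{\pi_2}_{2,2}\longrightarrow\overline{\mathbf{Y}}^{\pi_2}_{2,2};\quad (x,y,Z)\mapsto(\zeta^{-q}x,\zeta^{-q}y,Z).$$
   Context: $F$ is a non-archimedean local field of equal characteristic $p>0$ with residue field $\mathbb{F}_q$ and uniformizer $\pi$; $\mathbf{C}$ is the completion of an algebraic closure of $F$, $v$ the valuation on $\mathbf{C}$ with $v(\pi)=1$. All spaces are rigid analytic curves considered over $\mathbf{C}$. $\mu_n$ denotes the group of $n$-th roots of unity. For $u\in\mathbf{C}$ with $v(u)>0$ put $[\pi]_u(X)=X^{q^2}+uX^q+\pi X$ and $[\pi^2]_u=[\pi]_u\circ[\pi]_u$. Put $[\pi]_{\mathrm{LT}}(X)=\pi X-X^q$; a generator of $\mathrm{LT}[\pi^2]$ is an element $\pi_2\in\mathbf{C}$ with $[\pi]_{\mathrm{LT}}([\pi]_{\mathrm{LT}}(\pi_2))=0$ and $[\pi]_{\mathrm{LT}}(\pi_2)\neq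 0$; then $v(\pi_2)=\frac{1}{q(q-1)}$. For $X_2,Y_2$ with $[\pi^2]_u(X_2)=[\pi^2]_u(Y_2)=0$ write $X_1=[\pi]_u(X_2)$, $Y_1=[\pi]_u(Y_2)$ and $$\mu_2(X_2,Y_2)=X_1Y_2^q-X_1^qY_2-X_2^qY_1+X_2Y_1^q .$$ $\mathcal{X}^{\pi_2}(\pi^2)$ is the rigid analytic curve with $\mathbf{C}$-points $\{(u,X_2,Y_2): v(u)>0,\ [\pi^2]_u(X_2)=[\pi^2]_u(Y_2)=0,\ \mu_2(X_2,Y_2)=\pi_2\}$, and $\mathbf{Y}^{\pi_2}_{2,2}$ is its subspace defined by $v(u)\ge\frac{q}{q+1}$. The reduction of a reduced affinoid over $\mathbf{C}$ is $\mathrm{Spec}$ of the ring of power-bounded functions modulo the topologically nilpotent functions. Coordinates on $\overline{\mathbf{Y}}^{\pi_2}_{2,2}$: $x=X_2/\alpha$, $y=Y_2/\alpha$, and $Z$ is defined by $x^qy-xy^q=1+\gamma_1Z$, where $\gamma_1^q=\alpha^{(q-1)(q^2-1)}$. Inertia action: $I_F=\mathrm{Aut}_{\rm cont}(\mathbf{C}/F^{\rm ur})$ acts on the reduction by $\overline{P}\mapsto\overline{P^{\sigma}}$ for points $P$ of the affinoid. Convention: in terms of coordinates, $\sigma$ acts on functions by acting on coefficients, so $u,X_i,Y_i$ are fixed and e.g. $(X_2/\alpha)^\sigma=X_2/\sigma(\alpha)$ (equivalently $P^\sigma=\sigma^{-1}(P)$). Roots of unity are identified with their images in the residue field. *)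

(* Defs.v *)
From HB Require Import structures.
From mathcomp Require Import all_boot all_order all_algebra.
From mathcomp Require Import generic_quotient ring_quotient mxpoly.
(* mpoly has to be imported before mathcomp-classical: in the other order the
   notation levels clash. *)
From mathcomp Require Import mpoly.
From mathcomp Require Import boolp functions reals constructive_ereal.
From mathcomp Require Import zify ring.

Set Implicit Arguments.
Unset Strict Implicit.
Unset Printing Implicit Defensive.

Import Order.TTheory GRing.Theory Num.Theory.
Local Open Scope ring_scope.

Record valuation (R : realType) (K : fieldType) := Valuation {
  valuation_fun :> K -> \bar R;
  valuation_eqy : forall x, (valuation_fun x == +oo%E) = (x == 0);
  valuation_neqNy : forall x, valuation_fun x != -oo%E;
  valuationM : forall x y,
    valuation_fun (x * y) = (valuation_fun x + valuation_fun y)%E;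
  valuationD : forall x y,
    (Order.min (valuation_fun x) (valuation_fun y) <= valuation_fun (x + y))%E
}.

Section ValuationTheory.
Variables (R : realType) (K : fieldType) (v : valuation R K).
Implicit Types x y : K.

Lemma valuation0 : v 0 = +oo%E.
Proof. by apply/eqP; rewrite valuation_eqy. Qed.

Lemma valuation_fin x : x != 0 -> exists r : R, v x = r%:E.
Proof.
move: (valuation_eqy v x) (valuation_neqNy v x); case: (v x) => [r _ _ _||//].
  by exists r.
by rewrite eqxx => <-.
Qed.

Lemma valuation1 : v 1 = 0%E.
Proof.
have [r vE] := valuation_fin (oner_neq0 K).
move: (valuationM v 1 1); rewrite mulr1 vE -EFinD => -[] /eqP.
by rewrite -subr_eq0 opprD addrA subrr add0r oppr_eq0 => /eqP ->.
Qed.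

Lemma valuationN x : v (- x) = v x.
Proof.
have vN1 : v (-1) = 0%E.
  have [r vE] : exists r : R, v (-1) = r%:E.
    by apply: valuation_fin; rewrite oppr_eq0 oner_neq0.
  move: (valuationM v (-1) (-1)); rewrite mulrNN mulr1 valuation1 vE -EFinD.
  move=> -[] /esym /eqP; rewrite -mulr2n mulrn_eq0 /= => /eqP ->.
  by [].
by rewrite -mulN1r valuationM vN1 add0e.
Qed.

Lemma valuation_leD (m : \bar R) x y :
  (m <= v x -> m <= v y -> m <= v (x + y)%R)%E.
Proof.
by move=> mx my; apply: le_trans (valuationD v x y); rewrite le_min mx.
Qed.

Lemma valuation_ltD (m : \bar R) x y :
  (m < v x -> m < v y -> m < v (x + y)%R)%E.
Proof.
by move=> mx my; apply: lt_le_trans (valuationD v x y); rewrite lt_min mx.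
Qed.

Lemma valuation_sum (I : Type) (r : seq I) (P : pred I) (f : I -> K)
    (m : \bar R) :
  (forall i, P i -> m <= v (f i))%E -> (m <= v (\sum_(i <- r | P i) f i)%R)%E.
Proof.
move=> mf; elim/big_ind: _ => //; first by rewrite valuation0 leey.
exact: valuation_leD.
Qed.

Lemma valuationX x (r : R) n : v x = r%:E -> v (x ^+ n) = (r *+ n)%:E.
Proof.
move=> vx; elim: n => [|n IHn]; first by rewrite expr0 valuation1.
by rewrite exprS valuationM vx IHn mulrS EFinD.
Qed.

Lemma valuation_le0X x n : (0 <= v x -> 0 <= v (x ^+ n)%R)%E.
Proof.
by move=> vx; elim: n => [|n IHn];
  rewrite ?expr0 ?valuation1 // exprS valuationM adde_ge0.
Qed.

Definition valuation_cauchy (s : nat -> K) :=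
  forall M : R, exists N, forall m n, (N <= m)%N -> (N <= n)%N ->
    (M%:E <= v (s m - s n)%R)%E.

Definition valuation_cvg (s : nat -> K) (l : K) :=
  forall M : R, exists N, forall n, (N <= n)%N -> (M%:E <= v (s n - l)%R)%E.

Definition valuation_complete :=
  forall s, valuation_cauchy s -> exists l, valuation_cvg s l.

Definition valuation_continuous (f : K -> K) :=
  forall x (M : R), exists N : R, forall y,
    (N%:E <= v (y - x)%R)%E -> (M%:E <= v (f y - f x)%R)%E.

Definition vring : {pred K} := fun x => (0 <= v x)%E.

Lemma vringE x : (x \in vring) = (0 <= v x)%E.
Proof. by []. Qed.

Lemma vring_closed : subring_closed vring.
Proof.
split=> [|x y|x y]; rewrite !vringE ?valuation1 //.
  by move=> vx vy; rewrite valuation_leD // valuationN.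
by move=> vx vy; rewrite valuationM adde_ge0.
Qed.

HB.instance Definition _ := GRing.isSubringClosed.Build K vring vring_closed.

Record vint := VInt { vint_val :> K; vint_valP : vint_val \in vring }.

HB.instance Definition _ := [isSub for vint_val].
HB.instance Definition _ := [Choice of vint by <:].
HB.instance Definition _ := [SubChoice_isSubComNzRing of vint by <:].

Definition vmax : {pred vint} := fun x : vint => (0 < v (val x))%E.

Lemma vmaxE (x : vint) : (x \in vmax) = (0 < v (val x))%E.
Proof. by []. Qed.

Lemma vmax_closed : idealr_closed vmax.
Proof.
split; first by rewrite vmaxE valuation0 ltry.
  by rewrite vmaxE valuation1 ltxx.
move=> a x y; rewrite !vmaxE rmorphD rmorphM => vx vy.
apply: valuation_ltD => //; rewrite valuationM.
have : (0 <= v (val a))%E by rewrite -vringE (valP a).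
move: vx; case: (v _) => [r||//]; case: (v _) => [s||] //=.
rewrite -EFinD !lte_fin lee_fin => r0 s0; exact: ltr_wpDl.
Qed.

HB.instance Definition _ := isIdealr.Build vint vmax vmax_closed.

Definition residue := {ideal_quot vmax}.
HB.instance Definition _ := GRing.ComNzRing.on residue.

(* vres x is 0 when x is not integral. *)
Definition vres (x : K) : residue := \pi_(residue)%qT (insubd (0 : vint) x).

Definition residue_inv (t : residue) : residue := vres (val (repr t))^-1.

Lemma vres_valE (x : vint) : vres (val x) = \pi_({ideal_quot vmax})%qT x.
Proof. by rewrite /vres valKd. Qed.

Lemma vresP (t : residue) : exists2 x : K, (0 <= v x)%E & t = vres x.
Proof.
exists (val (repr t)); first by rewrite -vringE; apply: valP.
by rewrite vres_valE reprK.
Qed.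

Lemma vresD x y : (0 <= v x)%E -> (0 <= v y)%E -> vres (x + y) = vres x + vres y.
Proof.
move=> vx vy; rewrite -[x](@SubK _ _ vint _ vx) -[y](@SubK _ _ vint _ vy).
by rewrite -rmorphD !vres_valE rmorphD.
Qed.

Lemma vresM x y : (0 <= v x)%E -> (0 <= v y)%E -> vres (x * y) = vres x * vres y.
Proof.
move=> vx vy; rewrite -[x](@SubK _ _ vint _ vx) -[y](@SubK _ _ vint _ vy).
by rewrite -rmorphM !vres_valE rmorphM.
Qed.

Lemma vres1 : vres 1 = 1.
Proof. by have := vres_valE 1; rewrite !rmorph1. Qed.

Lemma vres_eq0 x : (0 <= v x)%E -> (vres x == 0) = (0 < v x)%E.
Proof.
move=> vx; rewrite -[x](@SubK _ _ vint _ vx) vres_valE.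
rewrite -(rmorph0 (\pi_({ideal_quot vmax})%qT)) -Quotient.idealrBE subr0.
by rewrite vmaxE.
Qed.

Lemma residue_mulVf t : t != 0 -> residue_inv t * t = 1.
Proof.
have tE : t = vres (val (repr t)) by rewrite vres_valE reprK.
have vt : (0 <= v (val (repr t)))%E by rewrite -vringE; apply: valP.
rewrite [X in X != 0]tE /residue_inv [X in _ * X = _]tE.
move: (val (repr t)) vt => x vx.
rewrite vres_eq0 // lt_neqAle vx andbT negbK eq_sym => /eqP vx0.
have x_neq0 : x != 0 by rewrite -(valuation_eqy v) vx0.
have vV : v x^-1 = 0%E.
  by rewrite -(valuation1) -(mulVf x_neq0) valuationM vx0 adde0.
by rewrite -vresM ?vV // mulVf // vres1.
Qed.

Lemma residue_inv0 : residue_inv 0 = 0.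
Proof.
rewrite /residue_inv; have := reprK (0 : residue).
rewrite -vres_valE => /eqP; rewrite vres_eq0 => [|]; last first.
  by rewrite -vringE; apply: valP.
move: (val _) => x vx; have [->|x_neq0] := eqVneq x 0.
  by have := vres_valE 0; rewrite !rmorph0 invr0.
rewrite /vres /insubd insubF ?rmorph0 //; apply/negP; rewrite vringE.
apply/negP; rewrite -ltNge.
have [r rE] := valuation_fin x_neq0.
have xV : v x + v x^-1 = 0%E by rewrite -valuationM mulfV // valuation1.
have [s sE] := valuation_fin (invr_neq0 x_neq0).
move: vx xV; rewrite rE sE -EFinD !lte_fin => r0 [] /eqP.
by rewrite addrC addr_eq0 => /eqP ->; rewrite oppr_lt0.
Qed.

HB.instance Definition _ :=
  GRing.ComNzRing_isField.Build residue residue_mulVf residue_inv0.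

End ValuationTheory.

Definition valuation_pull (R : realType) (K L : fieldType)
  (f : {rmorphism K -> L}) (v : valuation R L) : valuation R K.
Proof.
exists (fun x => v (f x)) => [x|x|x y|x y].
- by rewrite valuation_eqy fmorph_eq0.
- exact: valuation_neqNy.
- by rewrite rmorphM valuationM.
- by rewrite rmorphD valuationD.
Defined.

Section Affinoid.
Variables (R : realType) (K : fieldType) (v : valuation R K).
Variables (n : nat) (r : 'I_n -> R) (Y : ('I_n -> K) -> Prop).

(* The C-points of the affinoid cut out by Y, a Zariski-closed condition, in the
   closed polydisc v(x_i) >= r_i *)
Record affinoid_point := AffinoidPoint {
  affinoid_coord :> 'I_n -> K;
  affinoid_pointP : Y affinoid_coord;
  affinoid_pointD : forall i, ((r i)%:E <= v (affinoid_coord i))%E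
}.

Definition mweight (m : 'X_{1..n}) : R := \sum_i r i *+ m i.

Definition strictly_convergent (a : 'X_{1..n} -> K) :=
  forall M : R, exists N, forall m : 'X_{1..n}, (N <= mdeg m)%N ->
    (M%:E <= v (a m) + (mweight m)%:E)%E.

Definition partial_sum (a : 'X_{1..n} -> K) (N : nat) : {mpoly K[n]} :=
  \sum_(m : 'X_{1..n < N}) a m *: 'X_[m].

(* The affinoid algebra of the reduced closed subspace Y: the Tate algebra of
   the polydisc modulo the functions vanishing on Y *)
Definition rigid (f : affinoid_point -> K) :=
  exists2 a, strictly_convergent a &
    forall P : affinoid_point,
      valuation_cvg v (fun N => (partial_sum a N).@[P]) (f P).

(* On a reduced affinoid the Banach topology is that of the supremum norm. *)
Definition power_bounded (f : affinoid_point -> K) :=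
  exists M : R, forall k P, (M%:E <= v (f P ^+ k)%R)%E.

Definition topologically_nilpotent (f : affinoid_point -> K) :=
  forall M : R, exists N, forall k, (N <= k)%N ->
    forall P, (M%:E <= v (f P ^+ k)%R)%E.


Lemma strictly_convergent_bounded (a : 'X_{1..n} -> K) : strictly_convergent a ->
  exists A : R, forall m, (A%:E <= v (a m) + (mweight m)%:E)%E.
Proof.
move=> /(_ 0) [N aN].
have lb (m : 'X_{1..n}) : exists A : R, (A%:E <= v (a m) + (mweight m)%:E)%E.
  have [->|am] := eqVneq (a m) 0; first by exists 0; rewrite valuation0 leey.
  by have [s ->] := valuation_fin v am; exists (s + mweight m).
suff [A Abnd] : exists A : R, forall m : 'X_{1..n < N},
    (A%:E <= v (a m) + (mweight m)%:E)%E.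
  exists (Num.min A 0) => m; have [Nm|mN] := leqP N (mdeg m).
    by apply: le_trans (aN m Nm); rewrite lee_fin ge_min lexx orbT.
  apply: le_trans (Abnd (BMultinom mN)).
  by rewrite lee_fin ge_min lexx.
suff [A Abnd] : exists A : R, forall m : 'X_{1..n < N},
    m \in enum {: 'X_{1..n < N}} -> (A%:E <= v (a m) + (mweight m)%:E)%E.
  by exists A => m; apply: Abnd; rewrite mem_enum.
elim: (enum _) => [|m s [A IHs]]; first by exists 0.
have [B mB] := lb m; exists (Num.min A B) => m'; rewrite inE => /predU1P[->|ms].
  by apply: le_trans mB; rewrite lee_fin ge_min lexx orbT.
by apply: le_trans (IHs _ ms); rewrite lee_fin ge_min lexx.
Qed.

Lemma mcoeff_partial_sum (a : 'X_{1..n} -> K) N m :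
  (partial_sum a N)@_m = if (mdeg m < N)%N then a m else 0.
Proof.
rewrite /partial_sum raddf_sum /=; case: ifP => mN.
  rewrite (bigD1 (BMultinom mN)) //= mcoeffZ mcoeffX eqxx mulr1.
  rewrite big1 ?addr0 // => m' m'm; rewrite mcoeffZ mcoeffX.
  by rewrite (negbTE (_ : bmnm m' != m)) ?mulr0.
apply: big1 => m' _; rewrite mcoeffZ mcoeffX.
case: eqP => [m'm|_]; last by rewrite mulr0.
by rewrite -m'm bmdeg in mN.
Qed.

Lemma meval_ge (p : {mpoly K[n]}) (M : R) (P : affinoid_point) :
  (forall m, M%:E <= v p@_m + (mweight m)%:E)%E -> (M%:E <= v p.@[P])%E.
Proof.
move=> pM; rewrite mevalE; apply: valuation_sum => m _.
rewrite valuationM; apply: le_trans (pM m) _; apply: leeD => //.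
rewrite /mweight; elim/big_rec2: _ => [|i x y _ xy]; first by rewrite valuation1.
rewrite valuationM EFinD; apply: leeD => //.
have rP := affinoid_pointD P i.
elim: (m i) => [|k IHk]; first by rewrite expr0 mulr0n valuation1.
by rewrite exprS valuationM mulrS EFinD leeD.
Qed.

Lemma mweightD m1 m2 : mweight (m1 + m2) = mweight m1 + mweight m2.
Proof. by rewrite -big_split; apply: eq_bigr => i _; rewrite mnmDE mulrnDr. Qed.

Lemma partial_sum_prod_ge (a b : 'X_{1..n} -> K) :
  strictly_convergent a -> strictly_convergent b ->
  forall M : R, exists N, forall N' m, (N <= mdeg m)%N ->
    (M%:E <= v (partial_sum a N' * partial_sum b N')@_m + (mweight m)%:E)%E.
Proof.
move=> sa sb M; have [A aA] := strictly_convergent_bounded sa; have [B bB] := strictly_convergent_bounded sb.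
have [Na aN] := sa (M - B); have [Nb bN] := sb (M - A).
exists (Na + Nb)%N => N' m Nm; rewrite mcoeffM.
have -> (x : \bar R) : (M%:E <= x + (mweight m)%:E)%E =
    ((M - mweight m)%:E <= x)%E.
  by rewrite EFinB leeBlDr.
apply: valuation_sum => -[[m1 ?] [m2 ?]] /= /eqP mE.
rewrite EFinB leeBlDr // valuationM !mcoeff_partial_sum.
case: ifP => _; last by rewrite valuation0 addye // ?leey // valuation_neqNy.
case: ifP => _; last by rewrite valuation0 addey // ?leey // valuation_neqNy.
rewrite mE mweightD EFinD.
have -> : (v (a m1) + v (b m2) + ((mweight m1)%:E + (mweight m2)%:E) =
    (v (a m1) + (mweight m1)%:E) + (v (b m2) + (mweight m2)%:E))%E.
  by rewrite addeACA.
have [N1|N1] := leqP Na (mdeg m1).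
  by rewrite -[M](subrK B) EFinD leeD // aN.
rewrite -[M](subrK A) addrC EFinD leeD // bN //.
by move: Nm; rewrite mE mdegD; lia.
Qed.

Lemma valuation_lb x : exists A : R, (A%:E <= v x)%E.
Proof.
have [->|x0] := eqVneq x 0; first by exists 0; rewrite valuation0 leey.
by have [s ->] := valuation_fin v x0; exists s.
Qed.

Lemma valuation_cvgM (s t : nat -> K) x y : valuation_cvg v s x ->
  valuation_cvg v t y -> valuation_cvg v (fun k => s k * t k) (x * y).
Proof.
move=> sx ty M; have [A xA] := valuation_lb x; have [B yB] := valuation_lb y.
have [N1 sN1] := sx (M - B); have [N2 sN2] := sx M.
have [N3 tN3] := ty (M - A); have [N4 tN4] := ty 0.
exists (N1 + N2 + N3 + N4)%N => k kN.
have -> : s k * t k - x * y =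
    (s k - x) * (t k - y) + x * (t k - y) + (s k - x) * y by ring.
rewrite !valuation_leD // valuationM.
- by rewrite -[M]addr0 EFinD leeD ?sN2 ?tN4 //; lia.
- by rewrite -[M](subrK A) addrC EFinD leeD ?tN3 //; lia.
- by rewrite -[M](subrK B) EFinD leeD ?sN1 //; lia.
Qed.

Lemma valuation_cvgB (s t : nat -> K) x y : valuation_cvg v s x ->
  valuation_cvg v t y -> valuation_cvg v (fun k => s k - t k) (x - y).
Proof.
move=> sx ty M; have [N1 sN1] := sx M; have [N2 tN2] := ty M.
exists (N1 + N2)%N => k kN.
have -> : s k - t k - (x - y) = (s k - x) - (t k - y) by ring.
by rewrite valuation_leD ?valuationN ?sN1 ?tN2 //; lia.
Qed.

Lemma rigid1 : rigid 1.
Proof.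
exists (fun m => (m == 0%MM)%:R) => [M|P M].
  exists 1%N => m m0; case: eqP m0 => [->|_ _]; first by rewrite mdeg0.
  by rewrite valuation0 leey.
exists 1%N => -[//|k] _.
suff -> : partial_sum (fun m => (m == 0%MM)%:R) k.+1 = 1.
  by rewrite meval1 subrr valuation0 leey.
apply/mpolyP => m; rewrite mcoeff_partial_sum mcoeff1.
by case: ltnP => // km; case: eqP km => // ->; rewrite mdeg0.
Qed.

Lemma rigidB f g : rigid f -> rigid g -> rigid (f - g).
Proof.
move=> [a sa fa] [b sb gb]; exists (fun m => a m - b m) => [M|P].
  have [N1 aN1] := sa M; have [N2 bN2] := sb M; exists (N1 + N2)%N => m Nm.
  have := aN1 m ltac:(lia); have := bN2 m ltac:(lia).
  rewrite -!leeBlDr // => ? ?.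
  by apply: valuation_leD; rewrite ?valuationN.
have -> : (fun N => (partial_sum (fun m => a m - b m) N).@[P]) =
    (fun N => (partial_sum a N).@[P] - (partial_sum b N).@[P]).
  apply/funext => N; rewrite -mevalB; congr (_.@[P]); apply/mpolyP => m.
  by rewrite mcoeffB !mcoeff_partial_sum; case: ifP => // _; rewrite subr0.
exact: valuation_cvgB.
Qed.

Lemma rigidM f g : rigid f -> rigid g -> rigid (f * g).
Proof.
move=> [a sa fa] [b sb gb].
pose c m := (partial_sum a (mdeg m).+1 * partial_sum b (mdeg m).+1)@_m.
have cE N m : (mdeg m < N)%N -> (partial_sum a N * partial_sum b N)@_m = c m.
  move=> mN; rewrite /c !mcoeffM; apply: eq_bigr => -[[m1 ?] [m2 ?]] /= /eqP mE.
  have : mdeg m = (mdeg m1 + mdeg m2)%N by rewrite mE mdegD.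
  move=> mdE; rewrite !mcoeff_partial_sum.
  by do 4 (rewrite ifT; last by lia).
have cM := partial_sum_prod_ge sa sb; exists c => [M|P M].
  by have [N cN] := cM M; exists N => m; apply: cN.
have [N1 cN1] := cM M.
have [N2 fgN2] := valuation_cvgM (fa P) (gb P) M.
exists (N1 + N2)%N => k kN.
rewrite -[_ - _](subrKA ((partial_sum a k).@[P] * (partial_sum b k).@[P])).
apply: valuation_leD; last by apply: fgN2; lia.
rewrite -mevalM -mevalB; apply: meval_ge => m; rewrite mcoeffB.
rewrite mcoeff_partial_sum; case: ltnP => [mk|km].
  by rewrite cE // subrr valuation0 leey.
by rewrite sub0r valuationN; apply: cN1; lia.
Qed.

Lemma power_boundedP f :
  power_bounded f <-> forall P, (0 <= v (f P))%E.
Proof.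
split=> [[M fM] P|f0]; last by exists 0 => k P; apply: valuation_le0X.
rewrite leNgt; apply/negP => fP0.
have /(valuation_fin v) [s sE] : f P != 0.
  by apply: contraTneq fP0 => ->; rewrite valuation0 -leNgt leey.
move: fP0; rewrite sE lte_fin => s0.
pose k := (Num.truncn (M / s)).+1.
have := fM k P; rewrite (valuationX _ sE) lee_fin leNgt => /negP; apply.
have : M / s < k%:R by rewrite truncnS_gt.
by rewrite ltr_ndivrMr // mulr_natl.
Qed.

Lemma topologically_nilpotentP f :
  topologically_nilpotent f <->
  exists2 e : R, 0 < e & forall P, (e%:E <= v (f P))%E.
Proof.
split=> [/(_ 1)[N fN]|[e e0 fe] M].
  exists (N.+1%:R^-1); rewrite ?invr_gt0 ?ltr0n // => P.
  have := fN N.+1 (leqnSn N) P; have [->|fP] := eqVneq (f P) 0.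
    by rewrite valuation0 leey.
  have [s sE] := valuation_fin v fP; rewrite (valuationX _ sE) sE !lee_fin.
  by rewrite -[s *+ _]mulr_natr -ler_pdivrMr ?ltr0n // div1r.
pose N := (Num.truncn (M / e)).+1; exists N => k Nk P.
have [->|fP] := eqVneq (f P) 0.
  by rewrite expr0n (_ : k == 0%N = false) ?valuation0 ?leey //; lia.
have [s sE] := valuation_fin v fP; have := fe P.
rewrite (valuationX _ sE) sE !lee_fin => es.
apply: (@le_trans _ _ (e *+ k)); last by rewrite lerMn2r es orbT.
rewrite -[e *+ _]mulr_natl -ler_pdivrMr //; apply/ltW.
have : M / e < N%:R by rewrite truncnS_gt.
by move=> /lt_le_trans; apply; rewrite ler_nat.
Qed.

Definition integral_fun : {pred affinoid_point -> K} :=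
  fun f => `[< rigid f /\ power_bounded f >].

Lemma integral_fun_closed : subring_closed integral_fun.
Proof.
split=> [|f g|f g].
- apply/asboolP; split; first exact: rigid1.
  by apply/power_boundedP => P; rewrite valuation1.
- move=> /asboolP[rf /power_boundedP bf] /asboolP[rg /power_boundedP bg].
  apply/asboolP; split; first exact: rigidB.
  by apply/power_boundedP => P; rewrite valuation_leD ?valuationN.
- move=> /asboolP[rf /power_boundedP bf] /asboolP[rg /power_boundedP bg].
  apply/asboolP; split; first exact: rigidM.
  by apply/power_boundedP => P; rewrite valuationM adde_ge0.
Qed.

HB.instance Definition _ :=
  GRing.isSubringClosed.Build (affinoid_point -> K) integral_fun
    integral_fun_closed.

Record integral_ring := IntegralFun {
  integral_val :> affinoid_point -> K;
  integral_valP : integral_val \in integral_fun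
}.

HB.instance Definition _ := [isSub for integral_val].
HB.instance Definition _ := [Choice of integral_ring by <:].
HB.instance Definition _ := GRing.SubChoice_isSubComPzRing.Build
  (affinoid_point -> K) integral_fun integral_ring (subringClosedP integral_fun).

Definition nilpotent_fun : {pred integral_ring} :=
  fun f : integral_ring => `[< topologically_nilpotent (val f) >].

Lemma nilpotent_fun_closed : zmod_closed nilpotent_fun.
Proof.
split=> [|f g].
  by apply/asboolP/topologically_nilpotentP; exists 1 => // P; rewrite valuation0 leey.
move=> /asboolP/topologically_nilpotentP[e e0 fe].
move=> /asboolP/topologically_nilpotentP[d d0 gd].
apply/asboolP/topologically_nilpotentP; exists (Num.min e d) => [|P].
  by rewrite lt_min e0.
rewrite rmorphB valuation_leD ?valuationN //.
  by apply: le_trans (fe P); rewrite lee_fin ge_min lexx.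
by apply: le_trans (gd P); rewrite lee_fin ge_min lexx orbT.
Qed.

HB.instance Definition _ :=
  GRing.isZmodClosed.Build integral_ring nilpotent_fun nilpotent_fun_closed.

Lemma nilpotent_funM f g : g \in nilpotent_fun -> f * g \in nilpotent_fun.
Proof.
move=> /asboolP/topologically_nilpotentP[e e0 g_ge].
apply/asboolP/topologically_nilpotentP; exists e => // P.
rewrite rmorphM valuationM -[e]add0r EFinD; apply: leeD; last exact: g_ge.
by have /asboolP[_ /power_boundedP f0] := valP f; apply: f0.
Qed.


(* The coordinate ring of the reduction.  The library only has quotients of
   nonzero rings by proper ideals, which would require a point of Y. *)
Definition reduction_ring := Quotient.quot nilpotent_fun.
HB.instance Definition _ := GRing.Zmodule.on reduction_ring.

Local Notation pi := (\pi_reduction_ring)%qT.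

Definition reduction_one : reduction_ring := pi 1.
Definition reduction_mul (s t : reduction_ring) : reduction_ring :=
  pi (repr s * repr t).

Lemma reduction_piP (f g : integral_ring) :
  reflect (pi f = pi g) (f - g \in nilpotent_fun).
Proof. by rewrite Quotient.idealrBE; apply: eqP. Qed.

Lemma reduction_mulE (f g : integral_ring) :
  reduction_mul (pi f) (pi g) = pi (f * g).
Proof.
have rE (h : integral_ring) : repr (pi h) - h \in nilpotent_fun.
  by apply/reduction_piP; rewrite reprK.
apply/reduction_piP.
rewrite -(subrKA (f * repr (pi g))) -mulrBr -mulrBl.
apply: rpredD; last exact/nilpotent_funM.
by rewrite mulrC; apply/nilpotent_funM.
Qed.

Lemma reduction_surj (s : reduction_ring) : exists f, s = pi f.
Proof. by exists (repr s); rewrite reprK. Qed.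

Lemma reduction_mulA : associative reduction_mul.
Proof.
move=> s t u; have [[f ->] [g ->] [h ->]] :=
  And3 (reduction_surj s) (reduction_surj t) (reduction_surj u).
by rewrite (reduction_mulE g h) (reduction_mulE f g) !reduction_mulE mulrA.
Qed.

Lemma reduction_mulC : commutative reduction_mul.
Proof. by move=> s t; rewrite /reduction_mul mulrC. Qed.

Lemma reduction_mul1 : left_id reduction_one reduction_mul.
Proof. by move=> s; have [f ->] := reduction_surj s; rewrite reduction_mulE mul1r. Qed.

Lemma reduction_mulD : left_distributive reduction_mul +%R.
Proof.
move=> s t u; have [[f ->] [g ->] [h ->]] :=
  And3 (reduction_surj s) (reduction_surj t) (reduction_surj u).
rewrite (reduction_mulE f h) (reduction_mulE g h) -!raddfD.
by rewrite (reduction_mulE (f + g) h) mulrDl.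
Qed.

HB.instance Definition _ := GRing.Zmodule_isComPzRing.Build reduction_ring
  reduction_mulA reduction_mulC reduction_mul1 reduction_mulD.

(* reduction f is 0 when f is not a power-bounded rigid function. *)
Definition reduction (f : affinoid_point -> K) : reduction_ring :=
  pi (insubd (0 : integral_ring) f).

Definition reduction_const (c : residue v) : reduction_ring :=
  reduction (fun=> val (repr c)).

(* The value of a function on the reduction at the reduction of P *)
Definition reduction_ev (P : affinoid_point) (f : reduction_ring) : residue v :=
  vres v (val (repr f) P).

(* p(g_1, .., g_d), written out because mmap requires a nonzero target ring *)
Definition reduction_horner (d : nat) (g : 'I_d -> reduction_ring)
    (p : {mpoly (residue v)[d]}) : reduction_ring :=
  \sum_(m <- msupp p) reduction_const p@_m * \prod_i g i ^+ m i.

End Affinoid.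

Section ReductionMaps.
Variables (R : realType) (K : fieldType) (v : valuation R K).
Variables (n : nat) (r : 'I_n -> R) (Y : ('I_n -> K) -> Prop).

(* The reduction is Spec k[T_1, .., T_d] / (rels), with T_i mapped to g i. *)
Definition reduction_presented (d : nat) (g : 'I_d -> reduction_ring v r Y)
    (rels : seq {mpoly (residue v)[d]}) :=
  (forall f, exists p, f = reduction_horner g p) /\
  (forall p, reduction_horner g p = 0 <->
     exists c : 'I_(size rels) -> {mpoly (residue v)[d]},
       p = \sum_i c i * rels`_i).

(* phi is the comorphism of the map sending the reduction of P to the
   reduction of P' = sigma^-1 (P), as a morphism of k-varieties. *)
Definition reduction_action (sigma : K -> K)
    (phi : {rmorphism reduction_ring v r Y -> reduction_ring v r Y}) :=
  (forall c, phi (reduction_const r Y c) = reduction_const r Y c) /\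
  (forall P : affinoid_point v r Y, exists2 P' : affinoid_point v r Y,
     forall i, sigma (P' i) = P i &
     forall f, reduction_ev P (phi f) = reduction_ev P' f).

End ReductionMaps.

(* The residue field has exactly q elements, and v is normalised by v pi = 1. *)
Definition local_field (R : realType) (F : fieldType) (p q : nat)
    (v : valuation R F) (pi : F) :=
  [/\ p \in [pchar F], v pi = 1%:E,
      forall x, x != 0 -> exists n : int, v x = (n%:~R)%:E,
      valuation_complete v &
      exists f : 'I_q -> residue v, bijective f].

Section CompletedClosure.
Variables (R : realType) (F : fieldType) (Fbar : closedFieldType).
Variables (C : fieldType) (v : valuation R C).
Variables (iota : {rmorphism F -> Fbar}) (jota : {rmorphism Fbar -> C}).

(* Fbar is an algebraic closure of F and C is its completion for v. *)
Definition completed_closure :=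
  [/\ forall x, algebraicOver iota x,
      forall x (M : R), exists y, (M%:E <= v (x - jota y)%R)%E &
      valuation_complete v].

(* F(x) / F is unramified: F(x) = F[x] has the same value group as F (the
   residue field of F being finite, hence perfect). *)
Definition unramified (x : Fbar) :=
  forall g : {poly F}, let y := (map_poly iota g).[x] in
    y != 0 -> exists2 a : F, a != 0 & v (jota y) = v (jota (iota a)).

(* F^ur consists of the unramified elements. *)
Definition inertia (sigma : {rmorphism C -> C}) :=
  [/\ bijective sigma, valuation_continuous v sigma &
      forall x, unramified x -> sigma (jota x) = jota x].

End CompletedClosure.

Section Curve.
Variables (R : realType) (K : fieldType) (v : valuation R K).
Variables (q : nat) (pi : K).

Definition pi_mult (u X : K) : K := X ^+ (q ^ 2) + u * X ^+ q + pi * X.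

Definition pi_mult_LT (X : K) : K := pi * X - X ^+ q.

Definition LT_generator2 (pi2 : K) :=
  pi_mult_LT (pi_mult_LT pi2) = 0 /\ pi_mult_LT pi2 <> 0.

Definition mu2 (u X2 Y2 : K) : K :=
  let X1 := pi_mult u X2 in
  let Y1 := pi_mult u Y2 in
  X1 * Y2 ^+ q - X1 ^+ q * Y2 - X2 ^+ q * Y1 + X2 * Y1 ^+ q.

(* Points are triples (u, X2, Y2). *)
Definition LT_curve2 (pi2 : K) (P : 'I_3 -> K) :=
  [/\ (0 < v (P 0%R))%E,
      pi_mult (P 0) (pi_mult (P 0) (P 1)) = 0,
      pi_mult (P 0) (pi_mult (P 0) (P 2)) = 0 &
      mu2 (P 0) (P 1) (P 2) = pi2].

Definition Y22_set (pi2 : K) (P : 'I_3 -> K) :=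
  LT_curve2 pi2 P /\ ((q%:R / q.+1%:R)%:E <= v (P 0%R))%E.

(* Y_{2,2} is Zariski closed in the closed polydisc v(u) >= q / (q + 1),
   v(X2) >= 0, v(Y2) >= 0; see Y22_polydisc. *)
Definition Y22_radius (i : 'I_3) : R := if i == 0 then q%:R / q.+1%:R else 0.

Lemma pi_mult_integral (u X : K) : (1 < q)%N ->
  (0 <= v pi)%E -> (0 <= v u)%E -> (0 <= v (pi_mult u X))%E -> (0 <= v X)%E.
Proof.
move=> q1 vpi vu vX; rewrite leNgt; apply/negP => X0.
have /(valuation_fin v)[s sE] : X != 0.
  by apply: contraTneq X0 => ->; rewrite valuation0 -leNgt leey.
move: X0; rewrite sE lte_fin => s0.
have XE : X ^+ (q ^ 2) = pi_mult u X + (- (u * X ^+ q) - pi * X).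
  by rewrite /pi_mult; ring.
have sq k : (0 < k)%N -> s *+ q <= s *+ k -> (k <= q)%N.
  move=> k0; rewrite -[s *+ q]mulr_natr -[s *+ k]mulr_natr.
  by rewrite ler_nM2l // ler_nat.
suff : ((s *+ q)%:E <= v (X ^+ (q ^ 2))%R)%E.
  rewrite (valuationX _ sE) lee_fin => /sq; rewrite expn_gt0 (ltnW q1) => /(_ isT).
  by rewrite leqNgt ltn_Pmull //; lia.
have sq0 : s *+ q <= 0 by rewrite mulrn_wle0 // ltW.
rewrite XE; apply: valuation_leD; first by apply: le_trans vX; rewrite lee_fin.
apply: valuation_leD; rewrite valuationN valuationM.
  by rewrite (valuationX _ sE) -[X in (X%:E <= _)%E]add0r EFinD leeD.
rewrite sE -[X in (X%:E <= _)%E]add0r EFinD leeD // lee_fin.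
by rewrite -[q]prednK 1?ltnW // mulrS gerDl mulrn_wle0 // ltW.
Qed.

Lemma Y22_polydisc (pi2 : K) (P : 'I_3 -> K) : (1 < q)%N -> (0 <= v pi)%E ->
  Y22_set pi2 P -> forall i, ((Y22_radius i)%:E <= v (P i))%E.
Proof.
move=> q1 vpi [[/ltW vu X2 Y2 _] vuq] i; rewrite /Y22_radius.
have [->//|] := eqVneq i 0.
have v0 : (0 <= v 0%R)%E by rewrite valuation0 leey.
have vX : (0 <= v (P 1%R))%E.
  by do 2 (apply: (pi_mult_integral q1 vpi vu)); rewrite X2.
have vY : (0 <= v (P 2%R))%E.
  by do 2 (apply: (pi_mult_integral q1 vpi vu)); rewrite Y2.
case: i => -[//|[|[|//]]] i3 _.
  by rewrite (_ : Ordinal i3 = 1) //; apply/val_inj.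
by rewrite (_ : Ordinal i3 = 2) //; apply/val_inj.
Qed.

Definition Y22_point (pi2 : K) := affinoid_point v Y22_radius (Y22_set pi2).

Definition Y22_x (pi2 alpha : K) (P : Y22_point pi2) : K := P 1 / alpha.

Definition Y22_y (pi2 alpha : K) (P : Y22_point pi2) : K := P 2 / alpha.

Definition Y22_Z (pi2 alpha gamma1 : K) (P : Y22_point pi2) : K :=
  (Y22_x alpha P ^+ q * Y22_y alpha P - Y22_x alpha P * Y22_y alpha P ^+ q - 1)
    / gamma1.

End Curve.

(* Main.v *)
Require Import Defs.
From HB Require Import structures.
From mathcomp Require Import all_boot all_order all_algebra all_field.
From mathcomp Require Import mpoly.
From mathcomp Require Import boolp functions reals constructive_ereal.
From mathcomp Require Import ring zify lra.

(** Why the theorem holds. Put a = alpha1, so that alpha = a^q, pi2 = a^(q^2(q+1)),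
    gamma1 = a^((q-1)(q^2-1)) by injectivity of Frobenius, and pi is a unit
    congruent to 1 times a^(q^3(q^2-1)). For x = X_2/alpha, y = Y_2/alpha and
    U = u/a^(q^4(q-1)), all equations of the affinoid become integral equations
    whose only parameter is gamma1 (lemma Y22_scaled). Write d, s, t for
    x^n y - x y^n with n = q, q^2, q^3. The scaled equations say that
    d = 1 + gamma1 Z, that Z^q = t modulo gamma1, and that U = - s^(q^2) modulo
    gamma1. This gives the equations of the reduction.

    There are no other relations. If d = 1, then t + 1 = s^(q+1), and the
    coordinate ring of the reduced curve is free over the polynomials in s, with
    basis x^j y^l (Z+1)^i for j < q^2 - 1 and l, i < q: the equations of x and y
    over s are monic and separable, and Z + 1 is a q-th root of s^(q+1)
    (normal_form, normal_form_indep). So a polynomial vanishing at all points of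
    the reduced curve is in the ideal of the relations (curve_nullstellensatz).
    Moreover every point of the reduced curve lifts to a point of the affinoid
    (lift_point). The torsion points are lifted one after the other, and mu2
    is adjusted by a torsion point. Since pi2 and a are algebraic over F, this
    takes place in the algebraically closed field Fbar. Hence a polynomial in
    x, y, Z vanishes on the reduction if and only if it is in the ideal.

    The functions x, y, Z generate the reduction. An integral rigid function is
    close to a polynomial in u, X_2, Y_2; after multiplication by a power of
    gamma1, the latter can be approximated modulo any power of gamma1 by integral
    combinations of the basis above (approx_normal_form_iter). By independence and
    lifting, the supremum norm of such a combination is the maximum of the norms of
    its coefficients (normal_form_orthonormal), and the denominators cancel
    (reduction_generated).

    For the action, a continuous automorphism sigma preserves the valuation. It acts
    trivially on the residue field because residue classes have Teichmueller
    representatives in Fbar, which are unramified (inertia_residue). So the comorphism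
    of the reduction of the point map given by sigma^-1 is induced by
    f |-> sigma o f o sigma^-1 (conj_reduction_action), and this is computed on x, y, Z
    from sigma(alpha) = zeta^q alpha and sigma(gamma1) = gamma1. *)

Set Implicit Arguments.
Unset Strict Implicit.
Unset Printing Implicit Defensive.

Import Order.TTheory GRing.Theory Num.Theory.
Local Open Scope ring_scope.

(** * The Deligne-Lusztig curve and its Moore determinants *)

Section Moore.
Variable (T : comNzRingType).
Implicit Types x y : T.

(** With n = q this is x^q y - x y^q, the function cutting out the Deligne-Lusztig
    curve of SL_2; below, d, s and t stand for moore with n = q, q^2 and q^3. *)
Definition moore n x y : T := x ^+ n * y - x * y ^+ n.

Variable (q : nat).
Hypothesis (q_char : [pchar T].-nat q).

Lemma exprDq x y : (x + y) ^+ q = x ^+ q + y ^+ q.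
Proof. exact: exprDn_pchar. Qed.

Lemma exprNq x : (- x) ^+ q = - x ^+ q.
Proof. exact: exprNn_pchar. Qed.

Lemma exprBq x y : (x - y) ^+ q = x ^+ q - y ^+ q.
Proof. by rewrite exprDq exprNq. Qed.

Lemma exprq_sum (I : Type) (r : seq I) (P : pred I) (f : I -> T) :
  (\sum_(i <- r | P i) f i) ^+ q = \sum_(i <- r | P i) f i ^+ q.
Proof.
have q0 : (0 < q)%N by case/andP: q_char.
elim/big_rec2: _ => [|i _ x _ <-]; last exact: exprDq.
by rewrite expr0n gtn_eqF.
Qed.

Lemma mooreXq n x y : moore n x y ^+ q = moore n (x ^+ q) (y ^+ q).
Proof. by rewrite /moore exprBq !exprMn -!exprM [(n * q)%N]mulnC. Qed.

(** If d = 1 this reads x^(q^2) = s x^q - x: over the function s, the coordinate x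
    of the curve d = 1 satisfies a separable equation with constant term. The
    same equation holds for y. *)
Lemma moore_elim x y : x ^+ (q ^ 2) * moore q x y =
  moore (q ^ 2) x y * x ^+ q - x * moore q x y ^+ q.
Proof. by rewrite mooreXq /moore -!exprM -mulnn; ring. Qed.

Lemma moore_elimr x y : y ^+ (q ^ 2) * moore q x y =
  moore (q ^ 2) x y * y ^+ q - y * moore q x y ^+ q.
Proof. by rewrite mooreXq /moore -!exprM -mulnn; ring. Qed.

(** If d = 1 this reads t = s^(q+1) - 1. The covering Z^q = t of the curve d = 1 is
    thus (Z + 1)^q = s^(q+1), which is what makes the normal form below work. *)
Lemma moore3_elim x y : moore (q ^ 3) x y * moore q x y ^+ q =
  moore (q ^ 2) x y ^+ q.+1 - moore q x y * moore q x y ^+ (q ^ 2).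
Proof.
have E z : z ^+ (q ^ 3) = (z ^+ (q ^ 2)) ^+ q by rewrite -exprM -expnSr.
have xE : x ^+ (q ^ 3) * moore q x y ^+ q =
    moore (q ^ 2) x y ^+ q * x ^+ (q ^ 2) - x ^+ q * moore q x y ^+ (q ^ 2).
  by rewrite E -exprMn moore_elim exprBq !exprMn -!exprM -mulnn.
have yE : y ^+ (q ^ 3) * moore q x y ^+ q =
    moore (q ^ 2) x y ^+ q * y ^+ (q ^ 2) - y ^+ q * moore q x y ^+ (q ^ 2).
  by rewrite E -exprMn moore_elimr exprBq !exprMn -!exprM -mulnn.
rewrite -[moore (q ^ 3) x y]/(x ^+ (q ^ 3) * y - x * y ^+ (q ^ 3)) mulrBl.
rewrite -!mulrA [y * _]mulrC yE mulrA xE exprSr.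
move: (moore q x y ^+ (q ^ 2)) (moore (q ^ 2) x y ^+ q) => D Q.
by rewrite /moore; ring.
Qed.

End Moore.

(** * Normal forms modulo the relations of the reduction *)

Section NormalForm.
Variables (S T : comNzRingType) (phi : {rmorphism S -> T}) (q : nat).
Hypotheses (q_char : [pchar T].-nat q) (q_gt1 : (1 < q)%N).
Variables (J : T -> Prop) (x y Z : T).
Hypotheses (JD : forall a b, J a -> J b -> J (a + b)).
Hypotheses (JM : forall a b, J b -> J (a * b)).
Hypotheses (J_xy : J (moore q x y - 1)).
Hypotheses (J_Z : J (Z ^+ q - moore (q ^ 3) x y)).

(** The exponents (j, l, i) of the monomials x^j y^l (Z + 1)^i which form a basis of
    the coordinate ring over the polynomials in s. *)
Definition nf_index : finType := ('I_(q ^ 2).-1 * 'I_q * 'I_q)%type.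

Let s := moore (q ^ 2) x y.

Let mono (h : {poly S}) j l i : T :=
  (map_poly phi h).[s] * x ^+ j * y ^+ l * (Z + 1) ^+ i.

Definition nf_eval (s x y W : T) (c : nf_index -> {poly S}) : T :=
  \sum_t (map_poly phi (c t)).[s] * x ^+ t.1.1 * y ^+ t.1.2 * W ^+ t.2.

Let M a := exists c, J (a - nf_eval s x y (Z + 1) c).

Let JB a b : J a -> J b -> J (a - b).
Proof. by move=> Ja Jb; apply: JD => //; rewrite -mulN1r; apply: JM. Qed.

Let MD a b : M a -> M b -> M (a + b).
Proof.
move=> [c ca] [d db]; exists (fun t => c t + d t).
have -> : nf_eval s x y (Z + 1) (fun t => c t + d t) =
    nf_eval s x y (Z + 1) c + nf_eval s x y (Z + 1) d.
  rewrite /nf_eval -big_split; apply: eq_bigr => t _.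
  by rewrite rmorphD hornerD !mulrDl.
by rewrite opprD addrACA; apply: JD.
Qed.

Let MJ a b : J (a - b) -> M b -> M a.
Proof.
by move=> Jab [c cb]; exists c; rewrite -[a](subrK b) -addrA; apply: JD.
Qed.

Let M_sum (I : Type) (r : seq I) (P : pred I) (F : I -> T) : M 0 ->
  (forall i, P i -> M (F i)) -> M (\sum_(i <- r | P i) F i).
Proof. by move=> M0 MF; elim/big_ind: _ => //; apply: MD. Qed.

Let M_mono h j l i : (j < (q ^ 2).-1)%N -> (l < q)%N -> (i < q)%N ->
  M (mono h j l i).
Proof.
move=> jq lq iq; pose t0 : nf_index := (Ordinal jq, Ordinal lq, Ordinal iq).
exists (fun t => if t == t0 then h else 0).
rewrite /nf_eval (bigD1 t0) //= eqxx big1 ?addr0 ?subrr => [|t /negPf->].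
  by rewrite -[0](mul0r (moore q x y - 1)); apply: JM.
by rewrite rmorph0 horner0 !mul0r.
Qed.

Let q2_gt : (q <= (q ^ 2).-1)%N.
Proof. by rewrite -mulnn; nia. Qed.

Let M0 : M 0.
Proof.
have := @M_mono 0 0 0 0; rewrite /mono rmorph0 horner0 !mul0r; apply; lia.
Qed.

Let M1 : M 1.
Proof.
have := @M_mono 1 0 0 0; rewrite /mono rmorph1 hornerC !mul1r; apply; lia.
Qed.

Let M_mulP z : (forall h j l i, (j < (q ^ 2).-1)%N -> (l < q)%N ->
    (i < q)%N -> M (z * mono h j l i)) ->
  forall a, M a -> M (z * a).
Proof.
move=> zM a [c ca]; apply: (@MJ _ (z * nf_eval s x y (Z + 1) c)).
  by rewrite -mulrBr; apply: JM.
rewrite mulr_sumr; apply: M_sum => // t _.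
by apply: zM; apply: ltn_ord.
Qed.

Let J_equiv a b : J (a - 1) -> J (a * b - b).
Proof. by move=> a1; rewrite -[X in _ - X]mul1r -mulrBl mulrC; apply: JM. Qed.

Let J_1X a n : J (a - 1) -> J (a ^+ n - 1).
Proof.
move=> a1; elim: n => [|n IHn].
  by rewrite subrr -[0](mul0r (a - 1)); apply: JM.
rewrite exprS (_ : _ - 1 = a * (a ^+ n - 1) + (a - 1)); last by ring.
by apply: JD => //; apply: JM.
Qed.

Let J_x2 : J (x ^+ (q ^ 2) - (s * x ^+ q - x)).
Proof.
have -> : x ^+ (q ^ 2) - (s * x ^+ q - x) =
    - 1 * (moore q x y * x ^+ (q ^ 2) - x ^+ (q ^ 2)) -
    (moore q x y ^+ q * x - x).
  have -> : s * x ^+ q = x ^+ (q ^ 2) * moore q x y + x * moore q x y ^+ q.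
    by rewrite moore_elim // subrK.
  by ring.
by apply: JB; [apply/JM/J_equiv | apply/J_equiv/J_1X].
Qed.

(* The inverse of x modulo J, since x * w = moore q x y. *)
Let w := x ^+ q.-1 * y - y ^+ q.

Let xw : x * w = moore q x y.
Proof. by rewrite mulrBr mulrA -exprS prednK // ltnW. Qed.

(** The equation for x divided by x, and the resulting formula for 1 / x. *)
Let J_x2' : J (x ^+ (q ^ 2).-1 - (s * x ^+ q.-1 - 1)).
Proof.
have E n : (0 < n)%N -> J (x ^+ n.-1 - w * x ^+ n).
  move=> n0; rewrite -{2}(prednK n0) exprS mulrA [w * x]mulrC xw.
  by rewrite -opprB -mulN1r; apply/JM/J_equiv.
have -> : x ^+ (q ^ 2).-1 - (s * x ^+ q.-1 - 1) =
  (x ^+ (q ^ 2).-1 - w * x ^+ (q ^ 2)) - s * (x ^+ q.-1 - w * x ^+ q) +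
  (w * (x ^+ (q ^ 2) - (s * x ^+ q - x)) - (x * w - 1)) by ring.
apply: JD; last by apply: JB; [apply: JM|rewrite xw].
by apply: JB; [apply: E; rewrite expn_gt0; lia | apply/JM/E; lia].
Qed.

Let J_w : J (w - (s * x ^+ q.-2 - x ^+ (q ^ 2).-2)).
Proof.
have E n : J (x ^+ n - w * x ^+ n.+1).
  rewrite exprS mulrA [w * x]mulrC xw.
  by rewrite -opprB -mulN1r; apply/JM/J_equiv.
have -> : w - (s * x ^+ q.-2 - x ^+ (q ^ 2).-2) =
  (x ^+ (q ^ 2).-2 - w * x ^+ (q ^ 2).-2.+1) - s * (x ^+ q.-2 - w * x ^+ q.-2.+1) +
  w * (x ^+ (q ^ 2).-2.+1 - (s * x ^+ q.-2.+1 - 1)) by ring.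
apply: JD; first by apply: JB => //; apply: JM.
rewrite (_ : (q ^ 2).-2.+1 = (q ^ 2).-1); last by lia.
by rewrite (_ : q.-2.+1 = q.-1); [apply: JM|lia].
Qed.

Let J_y : J (y ^+ q - (x ^+ q.-1 * y - (s * x ^+ q.-2 - x ^+ (q ^ 2).-2))).
Proof.
by rewrite [y ^+ q](_ : _ = x ^+ q.-1 * y - w); [rewrite (_ : _ - _ =
  - (w - (s * x ^+ q.-2 - x ^+ (q ^ 2).-2))); [rewrite -mulN1r; apply: JM|ring]
  | rewrite /w; ring].
Qed.

Let J_W : J ((Z + 1) ^+ q - s ^+ q.+1).
Proof.
have dX n := J_1X n J_xy.
have -> : (Z + 1) ^+ q - s ^+ q.+1 = (Z ^+ q - moore (q ^ 3) x y) +
  ((1 - moore q x y * moore q x y ^+ (q ^ 2)) -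
     (moore (q ^ 3) x y * moore q x y ^+ q - moore (q ^ 3) x y)).
  by rewrite exprDq // moore3_elim // -/s expr1n; ring.
apply: JD => //; apply: JB; last by rewrite mulrC; apply/J_equiv.
by rewrite -opprB -mulN1r -exprS; apply/JM.
Qed.

Let M_s a : M a -> M (s * a).
Proof.
apply: M_mulP => h j l i jq lq iq; rewrite (_ : s * _ = mono (h * 'X) j l i).
  exact: M_mono.
by rewrite /mono rmorphM /= map_polyX hornerMX; ring.
Qed.

Let M_const c a : M a -> M (phi c * a).
Proof.
apply: M_mulP => h j l i jq lq iq; rewrite (_ : _ * _ = mono (c *: h) j l i).
  exact: M_mono.
by rewrite /mono map_polyZ hornerZ !mulrA.
Qed.

Let MB a b : M a -> M b -> M (a - b).
Proof.
move=> Ma Mb; apply: MD => //.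
by rewrite -mulN1r -[-1](rmorphN1 phi); apply: M_const.
Qed.

Let M_x a : M a -> M (x * a).
Proof.
apply: M_mulP => h j l i jq lq iq; have [jq1|] := ltnP j.+1 (q ^ 2).-1.
  rewrite (_ : _ * _ = mono h j.+1 l i); first exact: M_mono.
  by rewrite /mono exprS; ring.
move=> jq1; have {jq1 jq}jE : j.+1 = (q ^ 2).-1 by lia.
apply: (@MJ _ (mono (h * 'X) q.-1 l i - mono h 0 l i)); last first.
  by apply: MB; apply: M_mono => //; lia.
rewrite (_ : _ - _ = (map_poly phi h).[s] * y ^+ l * (Z + 1) ^+ i *
  (x ^+ j.+1 - (s * x ^+ q.-1 - 1))); first by rewrite jE; apply: JM.
by rewrite /mono rmorphM /= map_polyX hornerMX exprS; ring.
Qed.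

Let M_xX n a : M a -> M (x ^+ n * a).
Proof.
by move=> Ma; elim: n => [|n IHn]; rewrite ?mul1r // exprS -mulrA; apply: M_x.
Qed.

Let M_y a : M a -> M (y * a).
Proof.
apply: M_mulP => h j l i jq lq iq; have [lq1|] := ltnP l.+1 q.
  rewrite (_ : _ * _ = mono h j l.+1 i); first exact: M_mono.
  by rewrite /mono exprS; ring.
move=> lq1; have {lq1 lq}lE : l.+1 = q by lia.
apply: (@MJ _ (x ^+ q.-1 * mono h j 1 i -
    (s * (x ^+ q.-2 * mono h j 0 i) - x ^+ (q ^ 2).-2 * mono h j 0 i))).
  rewrite (_ : _ - _ = (map_poly phi h).[s] * x ^+ j * (Z + 1) ^+ i *
    (y ^+ l.+1 - (x ^+ q.-1 * y - (s * x ^+ q.-2 - x ^+ (q ^ 2).-2)))).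
    by rewrite lE; apply: JM.
  by rewrite /mono [y ^+ l.+1]exprS; move: ((Z + 1) ^+ i) => W; ring.
by apply: MB; [|apply: MB; first apply: M_s]; apply: M_xX; apply: M_mono => //; lia.
Qed.

Let M_Z a : M a -> M (Z * a).
Proof.
suff M_W : M a -> M ((Z + 1) * a).
  move=> Ma; rewrite (_ : Z * a = (Z + 1) * a - a); last by ring.
  by apply: MB => //; apply: M_W.
apply: M_mulP => h j l i jq lq iq; have [iq1|] := ltnP i.+1 q.
  rewrite (_ : _ * _ = mono h j l i.+1); first exact: M_mono.
  by rewrite /mono exprS mulrCA.
move=> iq1; have {iq1 iq}iE : i.+1 = q by lia.
apply: (@MJ _ (mono (h * 'X^(q.+1)) j l 0)).
  rewrite (_ : _ - _ = (map_poly phi h).[s] * x ^+ j * y ^+ l *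
    ((Z + 1) ^+ i.+1 - s ^+ q.+1)); first by rewrite iE; apply: JM.
  rewrite /mono rmorphM /= map_polyXn hornerM hornerXn [(Z + 1) ^+ i.+1]exprS.
  by move: (Z + 1) => W; ring.
by apply: M_mono => //; lia.
Qed.

(** Modulo d = 1 and Z^q = t there are monic equations for x over s (degree
    q^2 - 1), for y over s and x (degree q, as y^q = x^(q-1) y - 1/x), and for
    Z + 1 over s (degree q). Hence the span of the monomials with smaller
    exponents is stable under multiplication by x, by y and by Z. An abstract
    ideal J stands for the relations. *)
Lemma normal_form (p : {mpoly S[3]}) :
  exists c, J (mmap phi (tnth [tuple x; y; Z]) p - nf_eval s x y (Z + 1) c).
Proof.
change (M (mmap phi (tnth [tuple x; y; Z]) p)).
rewrite {1}[p]mpolyE raddf_sum; apply: M_sum => // m _; rewrite /= mmapZ mmapX.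
apply: M_const; rewrite /mmap1 !big_ord_recl big_ord0 mulr1 -[_ * (_ * _)]mulr1 -!mulrA.
rewrite !(tnth_nth 0) /=; apply: M_xX.
have MX z n b : (forall b, M b -> M (z * b)) -> M b -> M (z ^+ n * b).
  by move=> Mz Mb; elim: n => [|n IHn]; rewrite ?mul1r // exprS -mulrA; apply: Mz.
by apply: (MX) => //; apply: (MX).
Qed.

End NormalForm.

(** * Independence of the normal forms over an algebraically closed field *)

Section ClosedFieldInterpolation.
Variables (k : fieldType) (k_closed : GRing.closed_field_axiom k).
Implicit Types f g : {poly k}.

Lemma closed_field_split f : f \is monic ->
  exists rs, f = \prod_(z <- rs) ('X - z%:P).
Proof.
have [n] := ubnP (size f); elim: n f => // n IHn f fn f1.
have [/eqP/size_poly1P[c c0 fE]|f_neq1] := eqVneq (size f) 1.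
  exists [::]; rewrite big_nil fE; congr _%:P.
  by have := monicP f1; rewrite fE lead_coefC.
have [z /factor_theorem[g fE]] := PreClosedField.closed_rootP k_closed f f_neq1.
have g1 : g \is monic by rewrite -(monicMr _ (monicXsubC z)) -fE.
have [|//|rs gE] := IHn g.
  by move: fn; rewrite fE size_Mmonic ?monicXsubC ?monic_neq0 // size_XsubC addn2.
by exists (z :: rs); rewrite big_cons -gE fE mulrC.
Qed.

(** A separable monic polynomial has as many roots as its degree. *)
Lemma separable_vanish f g : f \is monic -> separable_poly f ->
  (size g < size f)%N -> (forall x, root f x -> root g x) -> g = 0.
Proof.
move=> f1 f_sep fg g0; have [rs fE] := closed_field_split f1.
apply: (@roots_geq_poly_eq0 _ g rs).
- by apply/allP => z zrs; apply: g0; rewrite fE root_prod_XsubC.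
- by rewrite -separable_prod_XsubC -fE.
- by move: fg; rewrite fE size_prod_XsubC.
Qed.

Lemma separable_unit_deriv f c : c != 0 -> f^`() = c%:P -> separable_poly f.
Proof.
move=> c0 fE; rewrite unlock fE -[c%:P]mulr1 mul_polyC.
by rewrite coprimepZr // coprimep1.
Qed.

Variable (q : nat).
Hypotheses (q_char : [pchar k].-nat q) (q_gt1 : (1 < q)%N).

Lemma natq_eq0 : q%:R = 0 :> k.
Proof.
have pk : pdiv q \in [pchar k] by apply: (pnatPpi q_char); rewrite pi_pdiv.
by apply/eqP; rewrite -(dvdn_pcharf pk) pdiv_dvd.
Qed.

Lemma exprq_inj : injective (fun z : k => z ^+ q).
Proof.
move=> a b /eqP; rewrite -subr_eq0 -exprBq // expf_eq0 subr_eq0.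
by case/andP => _ /eqP.
Qed.

(** An algebraically closed field of characteristic p is infinite: 'X^(q^n) - 'X is
    separable for every n > 0. *)
Lemma closed_vanish g : (forall x, g.[x] = 0) -> g = 0.
Proof.
move=> g0; pose N := (q ^ (size g).+1)%N.
have gN : (size g < N)%N by apply: ltn_trans (ltn_expl _ q_gt1); rewrite ltnS.
have N1 : (1 < N)%N by apply: leq_ltn_trans (ltn_expl (size g).+1 q_gt1).
have sN : size ('X^N - 'X : {poly k}) = N.+1.
  by rewrite size_polyDl size_polyXn // size_polyN size_polyX ltnS.
apply: (@separable_vanish ('X^N - 'X)) => [|||x _]; last by apply/rootP.
- by rewrite monicE lead_coefDl ?lead_coefXn // size_polyXn size_polyN size_polyX.
- apply: (@separable_unit_deriv _ (- 1)); first by rewrite oppr_eq0 oner_eq0.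
  rewrite derivB derivXn derivX -scaler_nat natrX natq_eq0 expr0n /= scale0r sub0r.
  by rewrite polyCN.
- by rewrite sN ltnS ltnW // ltnW.
Qed.

(** The values of x at the points of the curve d = 1 over a given s are the roots of
    this polynomial; its product with 'X has derivative 1. *)
Lemma fiber_x_separable (s : k) :
  let f := 'X^((q ^ 2).-1) - s *: 'X^(q.-1) + 1 in
  [/\ f \is monic, separable_poly f & size f = (q ^ 2)%N].
Proof.
move=> f; have q2 : (q.-1 < (q ^ 2).-1)%N by rewrite -mulnn; nia.
have sz : (size (- (s *: 'X^(q.-1)) + 1 : {poly k})%R < (q ^ 2))%N.
  apply: leq_ltn_trans (size_polyD _ _) _; rewrite gtn_max size_polyN size_poly1.
  apply/andP; split; last by lia.
  by apply: leq_ltn_trans (size_scale_leq _ _) _; rewrite size_polyXn; lia.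
have szX : size ('X^((q ^ 2).-1) : {poly k}) = (q ^ 2)%N.
  by rewrite size_polyXn prednK // expn_gt0 ltnW.
split; rewrite /f -addrA.
- by rewrite monicE lead_coefDl ?lead_coefXn // szX.
- apply: (@dvdp_separable _ (('X^((q ^ 2).-1) + (- (s *: 'X^(q.-1)) + 1)) * 'X)).
    exact: dvdp_mulIl.
  apply: (@separable_unit_deriv _ 1); first exact: oner_neq0.
  rewrite !mulrDl mulNr -scalerAl -!exprSr mul1r !prednK ?expn_gt0; try lia.
  rewrite !derivD derivN derivZ !derivXn derivX -!scaler_nat natrX natq_eq0.
  by rewrite expr0n !scale0r scaler0 oppr0 !add0r.
- by rewrite size_polyDl szX.
Qed.

(** The values of y over a given s and x are the roots of this polynomial. *)
Lemma fiber_y_separable (x : k) : x != 0 ->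
  let f := 'X^q - x ^+ q.-1 *: 'X + x^-1%:P in
  [/\ f \is monic, separable_poly f & size f = q.+1].
Proof.
move=> x0 f; have sz : (size (- (x ^+ q.-1 *: 'X) + x^-1%:P : {poly k})%R < q.+1)%N.
  apply: leq_ltn_trans (size_polyD _ _) _; rewrite gtn_max size_polyN.
  apply/andP; split; last by apply: leq_ltn_trans (size_polyC_leq1 _) _; lia.
  by apply: leq_ltn_trans (size_scale_leq _ _) _; rewrite size_polyX; lia.
split; rewrite /f -addrA.
- by rewrite monicE lead_coefDl ?lead_coefXn // size_polyXn.
- apply: (@separable_unit_deriv _ (- x ^+ q.-1)).
    by rewrite oppr_eq0 expf_neq0.
  rewrite !derivD derivN derivZ derivXn derivX derivC -scaler_nat natq_eq0.
  by rewrite scale0r add0r addr0 alg_polyC polyCN.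
- by rewrite size_polyDl size_polyXn.
Qed.

(** The exponents in the i-th term are congruent to i modulo q, so that no two
    terms share a monomial. *)
Lemma frobenius_digits (c : 'I_q -> {poly k}) :
  \sum_i (c i \Po 'X^q) * 'X^i = 0 -> forall i, c i = 0.
Proof.
have q_gt0 : (0 < q)%N by apply: ltnW.
move=> c0 i; apply/polyP => n; rewrite coef0.
have := congr1 (fun g : {poly k} => g`_(n * q + i)) c0.
rewrite /= coef0 coef_sum (bigD1 i) //= coefMXn ltnNge leq_addl /= addnK.
rewrite coef_comp_poly_Xn ?dvdn_mull ?mulnK //.
rewrite big1 ?addr0 // => j ji; rewrite coefMXn; case: ltnP => // jn.
rewrite coef_comp_poly_Xn //.
case: dvdnP => // -[m mE]; case/negP: ji; apply/eqP/val_inj => /=.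
have /(congr1 (modn^~ q)) : (n * q + i = m * q + j)%N by rewrite -mE subnK.
by rewrite !modnMDl !modn_small ?ltn_ord // => ->.
Qed.

Lemma sum_vanish n f (b : 'I_n -> k) : f \is monic -> separable_poly f ->
  (n < size f)%N -> (forall z, root f z -> \sum_i b i * z ^+ i = 0) ->
  forall i, b i = 0.
Proof.
move=> f1 f_sep nf b0 i.
suff /polyP/(_ i) : \poly_(i < n) (if insub i is Some i then b i else 0) = 0.
  by rewrite coef0 coef_poly ltn_ord valK.
apply: separable_vanish f1 f_sep _ _ => [|z /b0 bz].
  exact: leq_ltn_trans (size_poly _ _) nf.
rewrite rootE horner_poly -[X in _ == X]bz; apply/eqP/eq_bigr => j _.
by rewrite valK.
Qed.

(** Over a point s = w^q, the fibre of the covering is given by two separable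
    equations, whose degrees exceed the exponents of x and y: a normal form that
    vanishes on the fibre has, for each (j, l), coefficient sum equal to 0. As
    W = w^(q+1) there, these sums are polynomials in w whose i-th term only has
    exponents congruent to i modulo q, and so every coefficient is 0. *)
Lemma normal_form_indep (c : nf_index q -> {poly k}) :
  (forall x y W, moore q x y = 1 -> W ^+ q = moore (q ^ 2) x y ^+ q.+1 ->
     nf_eval idfun (moore (q ^ 2) x y) x y W c = 0) ->
  forall t, c t = 0.
Proof.
move=> c0 [[j l] i].
pose e w j l := \sum_i (c (j, l, i)).[w ^+ q] * (w ^+ q.+1) ^+ i.
have e0 w : e w j l = 0.
  set s := w ^+ q.
  have [f1 f_sep f_size] := fiber_x_separable s.
  apply: (sum_vanish f1 f_sep (b := fun j => e w j l)); first by rewrite f_size; lia.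
  move=> x; rewrite rootE !hornerE => /eqP fx.
  have x0 : x != 0.
    apply: contra_eq_neq fx => ->; rewrite !expr0n.
    rewrite (_ : (_.-1 == 0)%N = false); last by rewrite -mulnn; nia.
    by rewrite (_ : (_.-1 == 0)%N = false); [rewrite mulr0 subr0 add0r oner_eq0|lia].
  have [g1 g_sep g_size] := fiber_y_separable x0.
  apply: (sum_vanish g1 g_sep (b := fun l => \sum_j e w j l * x ^+ j)).
    by rewrite g_size.
  move=> y; rewrite rootE !hornerE => /eqP gy.
  have d1 : moore q x y = 1.
    rewrite -[RHS](mulfV x0) -[RHS]subr0 -[X in _ - X](mulr0 x) -gy /moore.
    by rewrite -{1}(prednK (ltnW q_gt1)) exprS; ring.
  have sE : moore (q ^ 2) x y = s.
    apply: (mulIf (expf_neq0 q x0)); move: (moore_elim q_char x y).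
    rewrite d1 expr1n !mulr1 => /eqP; rewrite eq_sym subr_eq => /eqP ->.
    have xX n : (0 < n)%N -> x ^+ n = x * x ^+ n.-1.
      by move=> n0; rewrite -exprS prednK.
    rewrite (xX (q ^ 2)%N) ?expn_gt0 ?(ltnW q_gt1) // (xX q) ?(ltnW q_gt1) //.
    rewrite -[RHS]addr0 -(mulr0 x) -fx.
    by ring.
  have := c0 x y (w ^+ q.+1) d1.
  rewrite sE -exprM mulnC exprM => /(_ erefl) nf0; rewrite -[RHS]nf0.
  rewrite /nf_eval.
  transitivity (\sum_l \sum_j \sum_i (c (j, l, i)).[s] * x ^+ j * y ^+ l * (w ^+ q.+1) ^+ i).
    apply: eq_bigr => l' _; rewrite mulr_suml; apply: eq_bigr => j' _.
    by rewrite -mulrA !mulr_suml; apply: eq_bigr => i' _; rewrite -/s; ring.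
  rewrite exchange_big !pair_big; apply: eq_bigr => -[[j' l'] i'] _ /=.
  by rewrite map_poly_id.
suff c_eq0 : \sum_(i < q) (c (j, l, i) * 'X^i \Po 'X^q) * 'X^i = 0.
  have /eqP := @frobenius_digits (fun i => c (j, l, i) * 'X^i) c_eq0 i.
  by rewrite mulf_eq0 expf_eq0 polyX_eq0 andbF orbF => /eqP.
apply: closed_vanish => w; rewrite -[RHS](e0 w) horner_sum.
apply: eq_bigr => i' _; rewrite hornerM horner_comp hornerM !hornerXn.
by rewrite -mulrA -exprMn -exprSr.
Qed.

End ClosedFieldInterpolation.

(** * The ideal of the reduced curve *)

Section NormalFormMorphism.
Variables (S T T' : comNzRingType) (q : nat).

Lemma nf_eval_morph (phi : {rmorphism S -> T}) (f : {rmorphism T -> T'})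
    s x y W (c : nf_index q -> {poly S}) :
  f (nf_eval phi s x y W c) = nf_eval (f \o phi) (f s) (f x) (f y) (f W) c.
Proof.
rewrite rmorph_sum; apply: eq_bigr => t _.
by rewrite !rmorphM !rmorphXn -horner_map -map_poly_comp.
Qed.

Lemma nf_eval_map (f : {rmorphism S -> T}) s x y W (c : nf_index q -> {poly S}) :
  nf_eval f s x y W c = nf_eval idfun s x y W (fun t => map_poly f (c t)).
Proof. by apply: eq_bigr => t _; rewrite [in RHS]map_poly_id. Qed.

Lemma moore_morph (f : {rmorphism S -> T}) n x y :
  f (moore n x y) = moore n (f x) (f y).
Proof. by rewrite rmorphB !rmorphM !rmorphXn. Qed.

End NormalFormMorphism.

Definition drinfeld_rel1 (S : comNzRingType) q : {mpoly S[3]} :=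
  'X_0 ^+ q * 'X_1 - 'X_0 * 'X_1 ^+ q - 1.

Definition drinfeld_rel2 (S : comNzRingType) q : {mpoly S[3]} :=
  'X_2 ^+ q - ('X_0 ^+ (q ^ 3) * 'X_1 - 'X_0 * 'X_1 ^+ (q ^ 3)).

Section Evaluation.
Variable (S : comNzRingType).
Implicit Types (p : {mpoly S[3]}) (x y z : S).

Definition point3 x y z : 'I_3 -> S := tnth [tuple x; y; z].

Lemma mevalX0 x y z : ('X_0 : {mpoly S[3]}).@[point3 x y z] = x.
Proof. by rewrite mevalXU. Qed.

Lemma mevalX1 x y z : ('X_1 : {mpoly S[3]}).@[point3 x y z] = y.
Proof. by rewrite mevalXU. Qed.

Lemma mevalX2 x y z : ('X_2 : {mpoly S[3]}).@[point3 x y z] = z.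
Proof. by rewrite mevalXU. Qed.

Lemma meval_rel1 q x y z :
  (drinfeld_rel1 S q).@[point3 x y z] = moore q x y - 1.
Proof.
by rewrite !(mevalB, mevalM) meval1 !rmorphXn /= mevalX0 mevalX1.
Qed.

Lemma meval_rel2 q x y z :
  (drinfeld_rel2 S q).@[point3 x y z] = z ^+ q - moore (q ^ 3) x y.
Proof.
by rewrite !(mevalB, mevalM) !rmorphXn /= mevalX0 mevalX1 mevalX2.
Qed.

End Evaluation.

Section RelationsMorphism.
Variables (S T : comNzRingType) (f : {rmorphism S -> T}) (q : nat).

Lemma map_drinfeld_rel1 : map_mpoly f (drinfeld_rel1 S q) = drinfeld_rel1 T q.
Proof.
have fX i : map_mpoly f ('X_i : {mpoly S[3]}) = 'X_i := map_mpolyX _ _.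
rewrite /drinfeld_rel1 rmorphB rmorph1 rmorphB; congr (_ - _ - _).
  by rewrite rmorphM rmorphXn /= !fX.
by rewrite rmorphM rmorphXn /= !fX.
Qed.

Lemma map_drinfeld_rel2 : map_mpoly f (drinfeld_rel2 S q) = drinfeld_rel2 T q.
Proof.
have fX i : map_mpoly f ('X_i : {mpoly S[3]}) = 'X_i := map_mpolyX _ _.
rewrite /drinfeld_rel2 rmorphB rmorphB; congr (_ - (_ - _)).
- by rewrite rmorphXn /= fX.
- by rewrite rmorphM rmorphXn /= !fX.
- by rewrite rmorphM rmorphXn /= !fX.
Qed.

Lemma map_drinfeld_rels A B :
  map_mpoly f (A * drinfeld_rel1 S q + B * drinfeld_rel2 S q) =
  map_mpoly f A * drinfeld_rel1 T q + map_mpoly f B * drinfeld_rel2 T q.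
Proof. by rewrite rmorphD 2!rmorphM /= map_drinfeld_rel1 map_drinfeld_rel2. Qed.

End RelationsMorphism.

Section PolynomialNormalForm.
Variables (S : comNzRingType) (q : nat).
Hypotheses (q_char : [pchar S].-nat q) (q_gt1 : (1 < q)%N).

(** The normal form in the polynomial ring itself, with J the ideal of the two
    relations and explicit cofactors, so that it can be evaluated at points where
    the relations hold only approximately. *)
Lemma mpoly_normal_form (p : {mpoly S[3]}) :
  exists (c : nf_index q -> {poly S}) A B,
  p = nf_eval (@mpolyC 3 S) (moore (q ^ 2) 'X_0 'X_1) 'X_0 'X_1 ('X_2 + 1) c +
    A * drinfeld_rel1 S q + B * drinfeld_rel2 S q.
Proof.
have q_charM : [pchar {mpoly S[3]}].-nat q.
  by apply: sub_in_pnat q_char => r _; apply: (rmorph_pchar (@mpolyC 3 S)).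
pose J (a : {mpoly S[3]}) := exists A B,
  a = A * drinfeld_rel1 S q + B * drinfeld_rel2 S q.
have [||||c [A [B pE]]] := @normal_form _ _ (@mpolyC 3 S) q q_charM q_gt1 J
    'X_0 'X_1 'X_2 _ _ _ _ p.
- by move=> a b [A [B ->]] [A' [B' ->]]; exists (A + A'), (B + B'); ring.
- by move=> a b [A [B ->]]; exists (a * A), (a * B); ring.
- by exists 1, 0; rewrite mul1r mul0r addr0.
- by exists 0, 1; rewrite mul1r mul0r add0r.
exists c, A, B; rewrite -addrA -pE addrCA subrr addr0.
rewrite [LHS]mpolyE /mmap; apply: eq_bigr => m _.
rewrite -mul_mpolyC; congr (_ * _).
rewrite [LHS]mpolyXE_id /mmap1; apply: eq_bigr => i _; congr (_ ^+ _).
by case: i => -[|[|[|//]]] i3; congr 'X__; apply/val_inj.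
Qed.

Lemma meval_normal_form (c : nf_index q -> {poly S}) x y z :
  (nf_eval (@mpolyC 3 S) (moore (q ^ 2) 'X_0 'X_1) 'X_0 'X_1 ('X_2 + 1) c).@[point3 x y z]
  = nf_eval idfun (moore (q ^ 2) x y) x y (z + 1) c.
Proof.
rewrite nf_eval_morph moore_morph rmorphD rmorph1 /= mevalX0 mevalX1 mevalX2.
apply: eq_bigr => t _; congr (_.[_] * _ * _ * _).
by apply: eq_map_poly => a /=; rewrite mevalC.
Qed.

End PolynomialNormalForm.

Section Nullstellensatz.
Variables (k : fieldType) (k_closed : GRing.closed_field_axiom k) (q : nat).
Hypotheses (q_char : [pchar k].-nat q) (q_gt1 : (1 < q)%N).

Lemma moore3_on_curve (x y : k) : moore q x y = 1 ->
  moore (q ^ 3) x y + 1 = moore (q ^ 2) x y ^+ q.+1.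
Proof.
move=> d1; have := moore3_elim q_char x y; rewrite d1 !expr1n !mulr1 => ->.
by rewrite subrK.
Qed.

(** Independence in terms of points of the curve in (x, y, z), with W = z + 1. *)
Lemma normal_form_eq0 (c : nf_index q -> {poly k}) :
  (forall x y z, moore q x y = 1 -> z ^+ q = moore (q ^ 3) x y ->
     nf_eval idfun (moore (q ^ 2) x y) x y (z + 1) c = 0) ->
  forall t, c t = 0.
Proof.
move=> c0; apply: normal_form_indep => // x y W d1 WE.
rewrite -[W](subrK 1); apply: c0 => //.
by rewrite exprBq // WE expr1n -moore3_on_curve // addrK.
Qed.

(** The two relations generate a radical ideal: the normal form of a polynomial
    that vanishes on the curve vanishes on the curve, and so it is 0. *)
Lemma curve_nullstellensatz (p : {mpoly k[3]}) :
  (forall x y z, moore q x y = 1 -> z ^+ q = moore (q ^ 3) x y ->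
     p.@[point3 x y z] = 0) ->
  exists A B, p = A * drinfeld_rel1 k q + B * drinfeld_rel2 k q.
Proof.
move=> p0; have [c [A [B pE]]] := mpoly_normal_form q_char q_gt1 p.
have c0 : forall t, c t = 0.
  apply: normal_form_eq0 => x y z d1 zE; move: (p0 x y z d1 zE).
  rewrite pE 2!mevalD (mevalM _ A) (mevalM _ B) meval_rel1 meval_rel2.
  rewrite meval_normal_form.
  by rewrite d1 zE !subrr !mulr0 !addr0.
exists A, B; rewrite {1}pE [nf_eval _ _ _ _ _ _]big1 ?add0r // => t _.
by rewrite c0 rmorph0 horner0 !mul0r.
Qed.

End Nullstellensatz.

(** * Residues and lifting of roots in valued fields *)

Section ValuedField.
Variables (R : realType) (K : fieldType) (v : valuation R K).
Implicit Types x y : K.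

(** The maximal ideal of the valuation ring, as a subset of the field. *)
Definition vsmall : {pred K} := fun x => (0 < v x)%E.

Lemma vsmallE x : (x \in vsmall) = (0 < v x)%E.
Proof. by []. Qed.

Lemma vsmall_closed : zmod_closed vsmall.
Proof.
split=> [|x y]; first by rewrite vsmallE valuation0 ltry.
by rewrite !vsmallE => vx vy; rewrite valuation_ltD // valuationN.
Qed.

HB.instance Definition _ := GRing.isZmodClosed.Build K vsmall vsmall_closed.

Lemma vsmallW x : x \in vsmall -> x \in vring v.
Proof. by rewrite vsmallE vringE => /ltW. Qed.

Lemma vsmallMl x y : x \in vring v -> y \in vsmall -> x * y \in vsmall.
Proof.
rewrite vringE !vsmallE valuationM; case: (v x) => [r||] //; case: (v y) => [s||] //.
by rewrite -EFinD !lte_fin lee_fin => *; apply: ltr_wpDl.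
Qed.

Lemma vsmallMr x y : x \in vsmall -> y \in vring v -> x * y \in vsmall.
Proof. by rewrite mulrC => ? ?; apply: vsmallMl. Qed.

Lemma vsmallX x n : x \in vsmall -> (0 < n)%N -> x ^+ n \in vsmall.
Proof.
by case: n => // n xs _; rewrite exprS vsmallMr // rpredX // vsmallW.
Qed.

Lemma vsmall1 : 1 \notin vsmall.
Proof. by rewrite vsmallE valuation1 ltxx. Qed.

Lemma valuationV x (r : R) : v x = r%:E -> v x^-1 = (- r)%:E.
Proof.
move=> xr; have x0 : x != 0 by rewrite -(valuation_eqy v) xr.
have [s sE] := valuation_fin v (invr_neq0 x0).
have : v (x * x^-1) = 0%E by rewrite mulfV // valuation1.
by rewrite valuationM xr sE -EFinD => -[/eqP]; rewrite addrC addr_eq0 => /eqP ->.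
Qed.

Lemma vring_or_inv x : x \notin vring v -> x^-1 \in vsmall.
Proof.
have [->|x0] := eqVneq x 0; first by rewrite rpred0.
have [r rE] := valuation_fin v x0.
by rewrite vringE vsmallE rE (valuationV rE) lee_fin lte_fin oppr_gt0 ltNge.
Qed.

Lemma vring_nsmall_inv x : x \in vring v -> x \notin vsmall -> x^-1 \in vring v.
Proof.
have [->|x0] := eqVneq x 0; first by rewrite invr0.
have [r rE] := valuation_fin v x0.
rewrite !vringE vsmallE rE (valuationV rE) !lee_fin lte_fin -leNgt => r0 r0'.
by rewrite oppr_ge0.
Qed.

Lemma vring_rootX x n : (0 < n)%N -> x ^+ n \in vring v -> x \in vring v.
Proof.
move=> n0 xn; apply: contraT => xr; have x0 : x != 0.
  by apply: contraNneq xr => ->; rewrite rpred0.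
have := vsmallMl xn (vsmallX (vring_or_inv xr) n0).
by rewrite -exprMn mulfV // expr1n (negPf vsmall1).
Qed.

Lemma vsmall_rootX x n : x ^+ n \in vsmall -> x \in vsmall.
Proof.
case: n => [|n xn]; first by rewrite expr0 (negPf vsmall1).
have xr : x \in vring v by apply: (@vring_rootX _ n.+1) => //; apply: vsmallW.
apply: contraT => xs; have x0 : x != 0.
  by apply: contraNneq xs => ->; rewrite rpred0.
have := vsmallMr xn (rpredX n.+1 (vring_nsmall_inv xr xs)).
by rewrite -exprMn mulfV // expr1n (negPf vsmall1).
Qed.

(** vres as a ring morphism on the valuation ring. *)
Definition vbar (x : vint v) : residue v := vres v (val x).

Lemma vbarE (x : vint v) : vbar x = \pi_({ideal_quot (vmax (v:=v))})%qT x.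
Proof. exact: vres_valE. Qed.

Lemma vbar_zmod_morphism : zmod_morphism vbar.
Proof. by move=> x y; rewrite !vbarE rmorphB. Qed.

Lemma vbar_monoid_morphism : monoid_morphism vbar.
Proof. by split=> [|x y]; rewrite !vbarE ?rmorph1 ?rmorphM. Qed.

HB.instance Definition _ :=
  GRing.isZmodMorphism.Build (vint v) (residue v) vbar vbar_zmod_morphism.
HB.instance Definition _ :=
  GRing.isMonoidMorphism.Build (vint v) (residue v) vbar vbar_monoid_morphism.

Lemma pchar_vint p : p \in [pchar K] -> p \in [pchar (vint v)].
Proof.
move=> pK; rewrite inE (pcharf_prime pK) /=; apply/eqP/val_inj.
by rewrite rmorph_nat (pcharf0 pK) rmorph0.
Qed.

Lemma vbar_eq0 (x : vint v) : (vbar x == 0) = (val x \in vsmall).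
Proof. by rewrite /vbar vres_eq0 // -vringE; apply: valP. Qed.

Lemma vbar_surj (t : residue v) : exists a : vint v, vbar a = t.
Proof. by have [x xr ->] := vresP t; exists (VInt (xr : x \in vring v)). Qed.

Lemma vres_sub x y : x \in vring v -> y \in vring v ->
  (vres v x == vres v y) = (x - y \in vsmall).
Proof.
move=> xr yr; rewrite -[x]/(val (VInt xr)) -[y]/(val (VInt yr)).
by rewrite -/(vbar _) -subr_eq0 -rmorphB vbar_eq0 rmorphB.
Qed.

Lemma vresX x n : x \in vring v -> vres v (x ^+ n) = vres v x ^+ n.
Proof.
move=> xr; rewrite -[x]/(val (VInt xr)) -rmorphXn.
by rewrite -!/(vbar _) rmorphXn.
Qed.

Lemma vresN x : x \in vring v -> vres v (- x) = - vres v x.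
Proof.
move=> xr; rewrite -[x]/(val (VInt xr)) -rmorphN.
by rewrite -!/(vbar _) rmorphN.
Qed.

Lemma vres_small x : x \in vsmall -> vres v x = 0.
Proof. by move=> xs; apply/eqP; rewrite vres_eq0 // -vringE vsmallW. Qed.

Lemma vres_sum (I : Type) (r : seq I) (P : pred I) (f : I -> K) :
  (forall i, P i -> f i \in vring v) ->
  vres v (\sum_(i <- r | P i) f i) = \sum_(i <- r | P i) vres v (f i).
Proof.
move=> fr; pose Q (a : K) (b : residue v) := a \in vring v /\ vres v a = b.
suff [] : Q (\sum_(i <- r | P i) f i) (\sum_(i <- r | P i) vres v (f i)) by [].
elim/big_rec2: _ => [|i b a Pi [ar <-]].
  by split; [rewrite rpred0|apply/vres_small/rpred0].
by split; [rewrite rpredD ?fr|rewrite vresD // -vringE ?fr].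
Qed.

Lemma vres_moore n x y : x \in vring v -> y \in vring v ->
  vres v (moore n x y) = moore n (vres v x) (vres v y).
Proof.
move=> xr yr; transitivity (vbar (moore n (VInt xr) (VInt yr))).
  by rewrite /vbar moore_morph.
by rewrite moore_morph.
Qed.

End ValuedField.

Section DenseClosed.
Variables (R : realType) (L : closedFieldType) (C : fieldType).
Variables (v : valuation R C) (j : {rmorphism L -> C}).
Hypothesis dense : forall x (M : R), exists y, (M%:E <= v (x - j y)%R)%E.

(** A monic polynomial splits, and a product of elements that are not small is not
    small: an approximate root is close to a root. Every lifting of solutions
    below, separable or not, comes from this remark. *)
Lemma near_root (f : {poly L}) y : f \is monic -> j f.[y] \in vsmall v ->
  exists2 z, root f z & j (y - z) \in vsmall v.
Proof.
move=> f1; have [rs ->] : exists rs, f = \prod_(z <- rs) ('X - z%:P).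
  have [rs ->] := closed_field_poly_normal f; exists rs.
  by rewrite (monicP f1) scale1r.
rewrite horner_prod rmorph_prod => prod_small.
suff [z zrs yz] : exists2 z, z \in rs & j (y - z) \in vsmall v.
  by exists z; rewrite ?root_prod_XsubC.
apply: contrapT => no_root.
suff : (v (\prod_(z <- rs) j ('X - z%:P).[y])%R <= 0)%E.
  by rewrite leNgt => /negP; apply.
have {no_root} : forall z, z \in rs -> (v (j (y - z)%R) <= 0)%E.
  move=> z zrs; rewrite leNgt; apply/negP => yz.
  by apply: no_root; exists z.
elim: rs {prod_small} => [|z rs IHrs] rs0; first by rewrite big_nil valuation1.
rewrite big_cons valuationM hornerXsubC; apply: adde_le0.
  by apply: rs0; rewrite mem_head.
by apply: IHrs => z' z'rs; apply: rs0; rewrite inE z'rs orbT.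
Qed.

Lemma residue_lift (t : residue v) :
  exists2 y, j y \in vring v & vres v (j y) = t.
Proof.
have [x xr ->] := vresP t; have [y xy] := dense x 1.
have xys : x - j y \in vsmall v by rewrite vsmallE (lt_le_trans _ xy) // lte_fin.
have yr : j y \in vring v by rewrite -(subKr x (j y)) rpredB // vsmallW.
by exists y => //; apply/esym/eqP; rewrite vres_sub.
Qed.

(** Lift a monic equation to an algebraically closed dense subfield; its roots are
    integral and reduce to roots. *)
Lemma residue_closed : GRing.closed_field_axiom (residue v).
Proof.
move=> n P n0.
have [b bE] : exists b : nat -> L, forall i, j (b i) \in vring v /\ vres v (j (b i)) = P i.
  have ex i : exists y, j y \in vring v /\ vres v (j y) = P i.
    by have [y yr yE] := residue_lift (P i); exists y.
  by have /choice[b bP] := ex; exists b.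
have [z zE] := solve_monicpoly b n0.
have zE' : j z ^+ n = \sum_(i < n) j (b i) * j z ^+ i.
  rewrite -rmorphXn zE rmorph_sum; apply: eq_bigr => i _.
  by rewrite rmorphM rmorphXn.
have zr : j z \in vring v.
  apply: contraT => zr; have z0 : j z != 0.
    by apply: contraNneq zr => ->; rewrite rpred0.
  suff : 1 \in vsmall v by rewrite (negPf (vsmall1 v)).
  rewrite -(mulfV (expf_neq0 n z0)) {1}zE' mulr_suml rpred_sum // => i _.
  rewrite -mulrA; apply: vsmallMl; first by have [] := bE i.
  have -> : j z ^+ n = j z ^+ i * j z ^+ (n - i).
    by rewrite -exprD subnKC // ltnW.
  rewrite invfM mulVKf ?expf_neq0 //.
  by rewrite -exprVn vsmallX ?subn_gt0 // vring_or_inv.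
exists (vres v (j z)); rewrite -vresX // zE'.
pose B i : vint v := VInt (bE i).1; pose Z : vint v := VInt zr.
transitivity (vbar (\sum_(i < n) B i * Z ^+ i)).
  rewrite /vbar; congr vres; rewrite rmorph_sum; apply: eq_bigr => i _.
  by rewrite rmorphM rmorphXn.
rewrite rmorph_sum; apply: eq_bigr => i _; rewrite rmorphM rmorphXn.
by rewrite -(bE i).2.
Qed.

(** All roots of the reduction of pi_mult lift, also when it is inseparable: lift
    the root arbitrarily and apply near_root. *)
Lemma lift_pi_mult q (b c e : L) (t : residue v) : (1 < q)%N ->
  j b \in vring v -> j c \in vring v -> j e \in vring v ->
  t ^+ (q ^ 2) + vres v (j b) * t ^+ q + vres v (j c) * t = vres v (j e) ->
  exists2 z, pi_mult q (j c) (j b) (j z) = j e &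
             j z \in vring v /\ vres v (j z) = t.
Proof.
move=> q1 br cr er; have [y yr <-] := residue_lift t => tE.
pose f := 'X^(q ^ 2) + (b *: 'X^q + (c *: 'X - e%:P)).
have q2 : (q < q ^ 2)%N by rewrite -mulnn; nia.
have f1 : f \is monic.
  rewrite monicE lead_coefDl ?lead_coefXn // size_polyXn ltnS.
  apply: leq_trans (size_polyD _ _) _; rewrite geq_max; apply/andP; split.
    by apply: leq_trans (size_scale_leq _ _) _; rewrite size_polyXn.
  apply: leq_trans (size_polyD _ _) _; rewrite geq_max size_polyN.
  apply/andP; split; last by apply: leq_trans (size_polyC_leq1 _) _; lia.
  by apply: leq_trans (size_scale_leq _ _) _; rewrite size_polyX; lia.
have fE z : j f.[z] = pi_mult q (j c) (j b) (j z) - j e.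
  by rewrite !hornerE !(rmorphD, rmorphN, rmorphM, rmorphXn) /pi_mult.
have [|z /rootP fz yz] := @near_root f y f1.
  rewrite fE -vres_sub // /pi_mult; last by rewrite !(rpredD, rpredM, rpredX).
  by rewrite !(vresD, vresM, vresX) -?vringE ?(rpredD, rpredM, rpredX) // tE.
have zr : j z \in vring v.
  by rewrite -(subKr y z) rmorphB rpredB // vsmallW.
exists z; first by apply/eqP; rewrite -subr_eq0 -fE fz rmorph0.
by split=> //; apply/eqP; rewrite eq_sym vres_sub // -rmorphB.
Qed.

End DenseClosed.

(** * Finite residue fields and Teichmueller representatives *)

(** A copy of k that carries the finite field structure given by a bijection with
    'I_q. *)
Definition enumerated (k : fieldType) (q : nat) (f : 'I_q -> k) (g : k -> 'I_q)
  (fK : cancel f g) (gK : cancel g f) : Type := k.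

Section Enumerated.
Variables (k : fieldType) (q : nat) (f : 'I_q -> k) (g : k -> 'I_q).
Variables (fK : cancel f g) (gK : cancel g f).

HB.instance Definition _ := GRing.Field.on (enumerated fK gK).
HB.instance Definition _ := Countable.copy (enumerated fK gK) (can_type gK).
HB.instance Definition _ : isFinite (enumerated fK gK) :=
  CanIsFinite (gK : cancel (g : enumerated fK gK -> 'I_q) f).

Lemma card_enumerated : #|{: enumerated fK gK}| = q.
Proof.
by rewrite -[RHS]card_ord; exact: (@bij_eq_card (enumerated fK gK) _ g (Bijective gK fK)).
Qed.

Lemma enumerated_field :
  [/\ (1 < q)%N, [pchar k].-nat q & forall t : k, t ^+ q = t].
Proof.
pose kf : finFieldType := enumerated fK gK.
have qE : #|kf| = q by exact: card_enumerated.
split; rewrite -qE.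
- exact: (finNzRing_gt1 kf).
- have [p _ pk] := finPcharP kf.
  rewrite (card_pprimeChar pk) pnatX; apply/orP; left.
  by rewrite pnatE ?(pcharf_prime pk).
- exact: (@expf_card kf).
Qed.
End Enumerated.

Lemma archi_mulrn (R : realType) (r M : R) : 0 < r ->
  exists N, forall n, (N <= n)%N -> M <= r *+ n.
Proof.
move=> r0; exists (Num.truncn (M / r)).+1 => n Nn.
rewrite -mulr_natl -ler_pdivrMr //; apply/ltW.
by apply: lt_le_trans (truncnS_gt _) _; rewrite ler_nat.
Qed.

Lemma seq_argmin (T : eqType) (d : Order.disp_t) (D : orderType d)
    (f : T -> D) (s : seq T) x : x \in s ->
  exists2 y, y \in s & forall z, z \in s -> (f y <= f z)%O.
Proof.
elim: s x => // a s IHs x _; case: s IHs => [_|b s /(_ b (mem_head _ _))[y ys yP]].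
  by exists a => [|z]; rewrite ?mem_head // inE => /eqP ->.
have [ay|ya] := leP (f a) (f y).
  exists a => [|z]; rewrite ?mem_head // inE => /predU1P[->//|/yP].
  exact: le_trans.
exists y => [|z]; first by rewrite inE ys orbT.
by rewrite inE => /predU1P[->|/yP //]; apply: ltW.
Qed.

Section ValuationPowers.
Variables (R : realType) (K : fieldType) (v : valuation R K).

Lemma valuation_geX x (r : R) n : (r%:E <= v x)%E -> ((r *+ n)%:E <= v (x ^+ n)%R)%E.
Proof.
move=> vx; elim: n => [|n IHn]; first by rewrite expr0 valuation1 mulr0n.
by rewrite exprS valuationM mulrS EFinD leeD.
Qed.

Lemma vsmall_bound x : x \in vsmall v -> exists2 r : R, 0 < r & (r%:E <= v x)%E.
Proof.
have [->|x0] := eqVneq x 0; first by exists 1 => //; rewrite valuation0 leey.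
have [r rE] := valuation_fin v x0; rewrite vsmallE rE lte_fin => r0.
by exists r.
Qed.

Lemma valuation_eq0 x : (forall M : R, (M%:E <= v x)%E) -> x = 0.
Proof.
move=> vx; apply: contraPeq vx => x0 vx; have [r rE] := valuation_fin v x0.
by have := vx (r + 1); rewrite rE lee_fin gerDl ler10.
Qed.

Lemma bounded_vsmall x (r : R) : 0 < r -> (r%:E <= v x)%E -> x \in vsmall v.
Proof. by move=> r0; rewrite vsmallE; apply: lt_le_trans. Qed.

Lemma periodic_vring x n : (1 < n)%N -> x ^+ n = x -> x \in vring v.
Proof.
move=> n1 xn; have [->|x0] := eqVneq x 0; first exact: rpred0.
apply: (@vring_rootX _ _ _ _ n.-1); first by lia.
rewrite (_ : _ ^+ _ = 1) ?rpred1 //; apply: (mulfI x0).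
by rewrite -exprS prednK ?mulr1 // ltnW.
Qed.

Lemma periodic_small x n : (1 < n)%N -> x ^+ n = x -> x \in vsmall v -> x = 0.
Proof.
move=> n1 xn xs; apply: contraNeq (vsmall1 v) => x0.
rewrite (_ : 1 = x ^+ n.-1); first by rewrite vsmallX //; lia.
by apply: (mulfI x0); rewrite -exprS prednK ?mulr1 // ltnW.
Qed.

Lemma vring_div x y : x != 0 -> (v x <= v y)%E -> y / x \in vring v.
Proof.
move=> x0; have [->|y0] := eqVneq y 0; first by rewrite mul0r rpred0.
have [[r rE] [s sE]] := (valuation_fin v x0, valuation_fin v y0).
rewrite rE sE vringE valuationM sE (valuationV rE) -EFinD !lee_fin.
by rewrite subr_ge0.
Qed.

Lemma valuationXz x (r : R) (m : int) : v x = r%:E -> v (x ^ m) = (m%:~R * r)%:E.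
Proof.
move=> xr; case: m => m; first by rewrite -exprnP (valuationX _ xr) mulr_natl.
rewrite NegzE -exprnN (valuationV (valuationX _ xr)) mulrNz mulNr.
by rewrite -mulr_natl.
Qed.

End ValuationPowers.

Section LocalField.
Variables (R : realType) (p q : nat) (F : fieldType) (v : valuation R F) (pi : F).
Hypothesis local_F : local_field p q v pi.

Lemma local_field_residue :
  [/\ (1 < q)%N, p.-nat q & forall t : residue v, t ^+ q = t].
Proof.
have [pF _ _ _ [f [g fK gK]]] := local_F.
have [q1 qk tq] := enumerated_field fK gK; split=> //.
have pk : p \in [pchar (residue v)] := rmorph_pchar (@vbar _ _ v) (pchar_vint v pF).
by rewrite -(eq_pnat _ (pcharf_eq pk)).
Qed.

Lemma pchar_nat_q (S : nzRingType) : p \in [pchar S] -> [pchar S].-nat q.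
Proof.
by move=> pS; rewrite (eq_pnat _ (pcharf_eq pS)); have [] := local_field_residue.
Qed.

Lemma vint_exprq_sub c : c \in vring v -> c ^+ q - c \in vsmall v.
Proof.
move=> cr; rewrite -vres_sub ?rpredX // vresX //.
by have [_ _ ->] := local_field_residue.
Qed.

(** The limit of c^(q^n). Since c^q - c is small, so are its powers by q^n, which
    are the successive differences. *)
Lemma teichmuller c : c \in vring v ->
  exists2 l, l ^+ q = l & l - c \in vsmall v.
Proof.
have [pF _ _ F_complete _] := local_F.
have [q1 _ _] := local_field_residue; have q_char := pchar_nat_q pF.
move=> cr; pose s n := c ^+ (q ^ n).
have [r r0 cq] := vsmall_bound (vint_exprq_sub cr).
have sS n : s n.+1 = s n ^+ q by rewrite /s expnSr exprM.
have cX j : (r%:E <= v (s j - c)%R)%E.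
  elim: j => [|j IHj]; first by rewrite /s expr1 subrr valuation0 leey.
  rewrite sS -(subrKA (c ^+ q)) -exprBq //; apply: valuation_leD => //.
  apply: le_trans (valuation_geX q IHj); rewrite lee_fin.
  by rewrite -{1}[r]mulr1n; apply: ler_wpMn2l; [apply: ltW|apply: ltnW].
have sB m n : (n <= m)%N -> ((r *+ n)%:E <= v (s m - s n)%R)%E.
  move=> nm; have -> : s m - s n = (s (m - n)%N - c) ^+ (q ^ n).
    by rewrite exprBq ?pnatX ?q_char // -exprM -expnD subnK.
  apply: le_trans (valuation_geX (q ^ n) (cX _)); rewrite lee_fin.
  by apply: ler_wpMn2l; [apply: ltW|apply/ltnW/ltn_expl].
have [|l sl] := F_complete s.
  move=> M; have [N NM] := archi_mulrn M r0; exists N => m n Nm Nn.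
  wlog nm : m n Nm Nn / (n <= m)%N.
    by move=> th; have [/th|/ltnW/th] := leqP n m; last rewrite -valuationN opprB; apply.
  by apply: le_trans (sB m n nm); rewrite lee_fin NM.
exists l.
  apply/eqP; rewrite -subr_eq0; apply/eqP/(valuation_eq0 (v := v)) => M.
  have [N sN] := sl (Num.max M 0).
  have le0 : (M%:E <= (Num.max M 0)%:E)%E by rewrite lee_fin le_max lexx.
  rewrite (_ : _ - _ = (s N.+1 - l) - (s N - l) ^+ q).
    apply: valuation_leD; first by apply: le_trans (sN _ _); rewrite ?lee_fin.
    rewrite valuationN; apply: le_trans (valuation_geX q (sN N (leqnn N))).
    rewrite lee_fin -[leLHS]mulr1n; apply: (@le_trans _ _ (Num.max M 0)).
      by rewrite mulr1n le_max lexx.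
    rewrite -[leLHS]mulr1n; apply: ler_wpMn2l; last exact: ltnW.
    by rewrite le_max lexx orbT.
  by rewrite exprBq // sS; ring.
have [N sN] := sl 1; rewrite -(subrKA (s N)) rpredD //.
  by rewrite -opprB rpredN; apply: bounded_vsmall (sN N (leqnn N)).
exact: bounded_vsmall (cX N).
Qed.

End LocalField.

(** * Inertia preserves valuations and residue classes *)

Section Inertia.
Variables (R : realType) (F : fieldType) (Fbar : closedFieldType) (C : fieldType).
Variables (v : valuation R C) (iota : {rmorphism F -> Fbar}).
Variables (jota : {rmorphism Fbar -> C}) (p q : nat) (pi : F).
Let tau := (jota \o iota : {rmorphism F -> C}).
Hypothesis local_F : local_field p q (valuation_pull tau v) pi.
Hypothesis completion_C : completed_closure v iota jota.
Local Notation vF := (valuation_pull tau v).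

Let q_gt1 : (1 < q)%N.
Proof. by have [] := local_field_residue local_F. Qed.

Let vL := valuation_pull jota v.

Let pF : p \in [pchar F].
Proof. by case: local_F. Qed.

Lemma pchar_nat_Fbar : [pchar Fbar].-nat q.
Proof. exact/(pchar_nat_q local_F)/(rmorph_pchar iota). Qed.

Lemma pchar_nat_C : [pchar C].-nat q.
Proof. exact/(pchar_nat_q local_F)/(rmorph_pchar tau). Qed.

Lemma pchar_nat_vint : [pchar (vint v)].-nat q.
Proof. exact/(pchar_nat_q local_F)/pchar_vint/(rmorph_pchar tau). Qed.

Lemma pchar_nat_residue : [pchar residue v].-nat q.
Proof.
apply: (pchar_nat_q local_F); apply: (rmorph_pchar (@vbar _ _ v)).
exact/pchar_vint/(rmorph_pchar tau).
Qed.

Lemma expr_period_sum (I : Type) (r : seq I) (f : I -> Fbar) N :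
  (forall i, f i ^+ (q ^ N) = f i) ->
  (\sum_(i <- r) f i) ^+ (q ^ N) = \sum_(i <- r) f i.
Proof.
have q0 : (0 < q ^ N)%N by rewrite expn_gt0 ltnW.
move=> fN; elim/big_rec: _ => [|i x _ xN]; first by rewrite expr0n gtn_eqF.
by rewrite exprDn_pchar ?pnatX ?pchar_nat_Fbar // xN fN.
Qed.

(** For z = sum of a_i k_i, with the k_i fixed by a power of Frobenius, divide by
    the a_i of least valuation. If the quotient is a unit we are done. Otherwise
    replace each coefficient by its Teichmueller representative: this gives a
    small element fixed by a power of Frobenius, hence 0, and this linear relation
    over F removes one term from the sum. *)
Lemma teichmuller_combination N (s : seq (F * Fbar)%type) :
  (0 < N)%N -> all (fun t => t.2 ^+ (q ^ N) == t.2) s ->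
  let z := \sum_(t <- s) iota t.1 * t.2 in
  z != 0 -> exists2 a : F, a != 0 & v (jota z) = v (jota (iota a)).
Proof.
move=> N0; have qN : (1 < q ^ N)%N by rewrite -(exp1n N) ltn_exp2r.
have [n] := ubnP (size s); elim: n s => // n IHn s sn sN /= z0.
have [t ts] : exists t, t \in s.
  by case: s z0 {sn sN} => [|t s _]; [rewrite big_nil eqxx|exists t; rewrite mem_head].
have [t0 t0s t0P] := seq_argmin (fun t => vF t.1) ts.
have perm_s := perm_to_rem t0s; set s' := rem t0 s in perm_s.
have [a0|a0] := eqVneq t0.1 0.
  case/eqP: z0; rewrite big_seq big1 // => u /t0P.
  by rewrite a0 valuation0 leye_eq valuation_eqy => /eqP ->; rewrite rmorph0 mul0r.
have bP u : u \in s -> u.1 / t0.1 \in vring vF.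
  by move=> /t0P; apply: vring_div.
have kP : forall u, u \in s -> u.2 \in vring vL.
  by move=> u /(allP sN)/eqP; apply: periodic_vring.
pose z' := \sum_(u <- s) iota (u.1 / t0.1) * u.2.
have zE : \sum_(u <- s) iota u.1 * u.2 = iota t0.1 * z'.
  rewrite mulr_sumr; apply: eq_bigr => u _.
  by rewrite mulrA -rmorphM (mulrC t0.1) divfK.
have z'r : z' \in vring vL.
  rewrite /z' big_seq rpred_sum // => u us; rewrite rpredM ?kP //.
  exact: bP.
have [z's|z's] := boolP (z' \in vsmall vL); last first.
  exists t0.1 => //; rewrite zE rmorphM valuationM.
  have -> : v (jota z') = 0%E; last by rewrite adde0.
  by apply/eqP; rewrite eq_le -[(0 <= _)%E]/(z' \in vring vL) z'r andbT leNgt.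
have /choice[c cP] : forall b : F, exists c, b \in vring vF ->
    c ^+ q = c /\ c - b \in vsmall vF.
  move=> b; have [br|] := boolP (b \in vring vF); last by exists 0.
  by have [c cq cb] := teichmuller local_F br; exists c.
have cN b : b \in vring vF -> (iota (c b)) ^+ (q ^ N) = iota (c b).
  move=> /cP[cq _]; rewrite -rmorphXn; congr (iota _).
  by elim: (N) => [|m IHm]; rewrite ?expr1 // expnSr exprM IHm.
pose w := t0.2 + \sum_(u <- s') iota (c (u.1 / t0.1)) * u.2.
have s's u : u \in s' -> u \in s by apply: mem_rem.
have w0 : w = 0.
  apply: (periodic_small (v := vL) qN).
    rewrite exprDn_pchar ?pnatX ?pchar_nat_Fbar //; congr (_ + _).
      exact/eqP/(allP sN).
    rewrite big_seq_cond big_mkcond expr_period_sum // => u.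
    case: ifP => [/andP[/s's us _]|_]; last by rewrite expr0n gtn_eqF // ltnW.
    by rewrite exprMn cN ?bP // (eqP (allP sN _ us)).
  rewrite -(subrK z' w) rpredD //.
  rewrite /z' (perm_big _ perm_s) big_cons mulfV // rmorph1 mul1r.
  rewrite opprD addrACA subrr add0r -sumrB big_seq rpred_sum // => u /s's us.
  by rewrite -mulrBl -rmorphB; apply: vsmallMr; [have [] := cP _ (bP _ us)|apply: kP].
have zE' : \sum_(u <- s) iota u.1 * u.2 =
    \sum_(u <- [seq (u.1 - t0.1 * c (u.1 / t0.1), u.2) | u <- s']) iota u.1 * u.2.
  rewrite big_map (perm_big _ perm_s) /= big_cons.
  have -> : t0.2 = - \sum_(u <- s') iota (c (u.1 / t0.1)) * u.2.
    by apply/eqP; rewrite -addr_eq0 -/w w0.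
  rewrite mulrN mulr_sumr -sumrN -big_split; apply: eq_bigr => u _ /=.
  by rewrite rmorphB rmorphM; ring.
rewrite zE'; apply: IHn; last by rewrite -zE'.
  by rewrite size_map size_rem //; case: (s) t0s sn.
by apply/allP => _ /mapP[u /s's us ->] /=; apply: (allP sN).
Qed.

(** In equal characteristic the Teichmueller representatives generate unramified
    extensions of F. *)
Lemma teichmuller_unramified N z : (0 < N)%N -> z ^+ (q ^ N) = z ->
  unramified v iota jota z.
Proof.
move=> N0 zN g y y0.
have yE : y = \sum_(t <- mkseq (fun i => (g`_i, z ^+ i)) (size g)) iota t.1 * t.2.
  rewrite big_map -[size g]subn0 -/(index_iota 0 _) big_mkord.
  rewrite /y horner_coef size_map_poly.
  by apply: eq_bigr => i _; rewrite coef_map.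
rewrite yE; apply: (teichmuller_combination N0); last by rewrite -yE.
by apply/allP => _ /mapP[i _ ->] /=; rewrite -exprM mulnC exprM zN.
Qed.

(** The residue class of y is a root of a nonzero polynomial with coefficients in
    the field with q elements, and so are all its images under Frobenius: two of
    them agree. *)
Lemma residue_frobenius_periodic y : jota y \in vring v ->
  exists2 N, (0 < N)%N & jota (y ^+ (q ^ N) - y) \in vsmall v.
Proof.
move=> yr; have [Falg _ _] := completion_C; have [f f0 /rootP fy] := Falg y.
have lf0 : lead_coef f \in (f : seq F).
  by rewrite lead_coefE mem_nth // -subn1 ltn_subrL size_poly_gt0 f0.
have [a af aP] := seq_argmin vF lf0.
have a0 : a != 0.
  apply: contraNneq f0 => a0; rewrite -lead_coef_eq0; have := aP _ lf0.
  by rewrite a0 valuation0 leye_eq valuation_eqy.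
pose b i := f`_i / a.
have br i : b i \in vring vF.
  have [fi|fi] := ltnP i (size f); last by rewrite /b nth_default // mul0r rpred0.
  exact/vring_div/aP/mem_nth.
have tbr i : tau (b i) \in vring v := br i.
pose g := \poly_(i < size f) vres v (tau (b i)).
have g0 : g != 0.
  have [i fi ai] := nthP 0 af.
  apply: contraTneq isT => /polyP/(_ i); rewrite coef0 coef_poly fi.
  by rewrite /b ai mulfV // rmorph1 vres1 => /eqP; rewrite oner_eq0.
have bq i : vres v (tau (b i)) ^+ q = vres v (tau (b i)).
  rewrite -vresX //; apply/eqP; rewrite vres_sub ?rpredX // -rmorphXn -rmorphB.
  exact: vint_exprq_sub local_F _ (br i).
have gy : g.[vres v (jota y)] = 0.
  rewrite horner_poly; under eq_bigr do rewrite -vresX // -vresM -?vringE ?rpredX //.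
  rewrite -vres_sum => [|i _]; last by rewrite rpredM ?rpredX.
  rewrite (_ : \sum_(i < _) _ = jota (iota a)^-1 * jota (map_poly iota f).[y]).
    by rewrite fy rmorph0 mulr0 vres_small // rpred0.
  rewrite horner_coef size_map_poly rmorph_sum mulr_sumr; apply: eq_bigr => i _.
  rewrite coef_map [jota (_ * _)]rmorphM [jota (_ ^+ _)]rmorphXn mulrA; congr (_ * _).
  by rewrite /= fmorph_div rmorphM fmorphV mulrC.
have gX n : root g (vres v (jota y) ^+ (q ^ n)).
  elim: n => [|n /rootP IHn]; first exact/rootP.
  apply/rootP; rewrite expnSr exprM.
  transitivity (g.[vres v (jota y) ^+ (q ^ n)] ^+ q); last first.
    by rewrite IHn expr0n gtn_eqF // ltnW.
  rewrite !horner_poly exprq_sum ?pchar_nat_residue //; apply: eq_bigr => i _.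
  by rewrite exprMn bq; congr (_ * _); apply: exprAC.
have /uniqPn : ~~ uniq (mkseq (fun n => vres v (jota y) ^+ (q ^ n)) (size g)).
  apply: contra_neqN g0 => g_uniq; apply: roots_geq_poly_eq0 g_uniq _ => //.
    by apply/allP => _ /mapP[n _ ->].
  by rewrite size_mkseq.
case/(_ 0) => m [n [mn]]; rewrite size_mkseq => ng.
rewrite !nth_mkseq // ?(ltn_trans mn) // => E.
exists (n - m)%N; first by rewrite subn_gt0.
rewrite rmorphB rmorphXn -vres_sub ?rpredX // vresX //.
have /eqP := E; rewrite eq_sym -{1}(subnK (ltnW mn)) expnD exprM -subr_eq0.
have q_char : [pchar residue v].-nat (q ^ m)%N by rewrite pnatX pchar_nat_residue.
by rewrite -exprBq // expf_eq0 subr_eq0 => /andP[].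
Qed.

Variable (sigma : {rmorphism C -> C}).
Hypothesis (sigma_inertia : inertia v iota jota sigma).

Lemma inertia_base a : sigma (tau a) = tau a.
Proof.
have [_ _ unr] := sigma_inertia; apply: unr => g y y0.
exists g.[a]; last by rewrite /y horner_map.
by move: y0; rewrite /y horner_map fmorph_eq0.
Qed.

(** Continuity: large powers of a small element go to 0. *)
Lemma inertia_small x : x \in vsmall v -> sigma x \in vsmall v.
Proof.
move=> /vsmall_bound[r r0 xr]; have [_ cont _] := sigma_inertia.
have [M sM] := cont 0 1; have [n nM] := archi_mulrn M r0.
apply: (@vsmall_rootX _ _ _ _ n); rewrite -rmorphXn.
apply: (@bounded_vsmall _ _ _ _ 1) => //.
have := sM (x ^+ n); rewrite rmorph0 !subr0; apply.
by apply: le_trans (valuation_geX n xr); rewrite lee_fin nM.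
Qed.

(** sigma preserves smallness and fixes the uniformizer; comparing powers of x with
    powers of the uniformizer gives one inequality, and x^-1 gives the other. *)
Lemma inertia_valuation x : v (sigma x) = v x.
Proof.
have [_ vpi _ _ _] := local_F.
suff le_r (y : C) (r s : R) : v y = r%:E -> v (sigma y) = s%:E -> s <= r.
  have [->|x0] := eqVneq x 0; first by rewrite rmorph0.
  have [r rE] := valuation_fin v x0.
  have [s sE] : exists s, v (sigma x) = s%:E by apply: valuation_fin; rewrite fmorph_eq0.
  rewrite rE sE; congr _%:E; apply/eqP; rewrite eq_le (le_r _ _ _ rE sE) /=.
  have := le_r x^-1 (- r) (- s); rewrite lerN2; apply; first exact: valuationV.
  by rewrite fmorphV; apply: valuationV.
move=> rE sE; rewrite leNgt; apply/negP => rs.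
have [n /(_ n (leqnn n)) n1] : exists N, forall n, (N <= n)%N -> 1 <= (s - r) *+ n.
  by apply: archi_mulrn; rewrite subr_gt0.
pose m := Num.floor (r *+ n) + 1.
have mE : v (tau pi ^ m) = (m%:~R)%:E.
  by rewrite (valuationXz _ (r := 1)) ?mulr1.
have y0 : v (sigma y) != +oo%E by rewrite sE.
have yE (z : C) (t : R) : v z = t%:E -> v (tau pi ^ m / z ^+ n) = (m%:~R - t *+ n)%:E.
  by move=> tE; rewrite valuationM mE (valuationV (valuationX n tE)) -EFinD.
have /inertia_small : tau pi ^ m / y ^+ n \in vsmall v.
  by rewrite vsmallE (yE _ _ rE) lte_fin subr_gt0; apply: floorD1_gt.
have -> : sigma (tau pi ^ m / y ^+ n) = tau pi ^ m / sigma y ^+ n.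
  by rewrite fmorph_div (fmorphXz sigma) inertia_base rmorphXn.
rewrite vsmallE (yE _ _ sE) lte_fin.
have : (Num.floor (r *+ n))%:~R <= r *+ n by exact: floor_le.
move: n1; rewrite mulrnBl /m rmorphD /=; lra.
Qed.

(** Every residue class contains a Teichmueller representative, which is unramified
    and hence fixed by sigma. *)
Lemma inertia_residue x : x \in vring v -> sigma x - x \in vsmall v.
Proof.
have [_ dense _] := completion_C.
move=> xr; have [y xy] := dense x 1.
have {}xy : x - jota y \in vsmall v by apply: bounded_vsmall xy.
have yr : jota y \in vring v by rewrite -(subKr x (jota y)) rpredB // vsmallW.
have [N N0 yN] := residue_frobenius_periodic yr.
have qN : (1 < q ^ N)%N by rewrite -(exp1n N) ltn_exp2r.
have [||z /rootP] := @near_root _ _ _ v jota ('X^(q ^ N) - 'X) y.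
- by rewrite monicE lead_coefDl ?lead_coefXn // size_polyXn size_polyN size_polyX ltnS.
- by rewrite !hornerE.
rewrite !hornerE => /eqP; rewrite subr_eq0 => /eqP zN yz.
have [_ _ unr] := sigma_inertia.
have xz : x - jota z \in vsmall v.
  by rewrite -(subrKA (jota y)) rpredD // -rmorphB.
have sz := unr _ (teichmuller_unramified N0 zN).
rewrite (_ : _ - _ = sigma (x - jota z) - (x - jota z)).
  by rewrite rpredB // inertia_small.
by rewrite rmorphB sz; ring.
Qed.

End Inertia.

(** * The pairing mu2 *)

Section Determinant.
Variables (K : fieldType) (q : nat).
Hypothesis q_char : [pchar K].-nat q.
Implicit Types (pi u X Y : K).

(** The terms of mu2 in u X^q Y^q cancel. *)
Lemma mu2E pi u X Y : mu2 q pi u X Y = moore q X Y ^+ q - pi * moore q X Y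
  - moore (q ^ 3) X Y - u ^+ q * moore (q ^ 2) X Y - pi ^+ q * moore q X Y.
Proof.
have E z : z ^+ (q ^ 3) = (z ^+ (q ^ 2)) ^+ q by rewrite -exprM -expnSr.
rewrite /mu2 mooreXq // /pi_mult !(exprDq q_char) !exprMn /moore !E.
have E2 z : z ^+ (q ^ 2) = (z ^+ q) ^+ q by rewrite -exprM -mulnn.
by rewrite !E2; ring.
Qed.

Lemma moore_scale n a X Y : moore n (a * X) (a * Y) = a ^+ n.+1 * moore n X Y.
Proof. by rewrite /moore !exprMn exprS; ring. Qed.

(** mu2 intertwines the action of pi on the pairs of pi^2-torsion points with the
    Lubin-Tate action, like a Weil pairing; moore_LT is the same for pi-torsion. *)
Lemma mu2_LT pi u X Y :
  pi_mult q pi u (pi_mult q pi u X) = 0 -> pi_mult q pi u (pi_mult q pi u Y) = 0 ->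
  pi_mult_LT q pi (mu2 q pi u X Y) = - moore q (pi_mult q pi u X) (pi_mult q pi u Y).
Proof.
set X1 := pi_mult q pi u X; set Y1 := pi_mult q pi u Y => X0 Y0.
have E2 z : z ^+ (q ^ 2) = (z ^+ q) ^+ q by rewrite -exprM -mulnn.
have elim z z' : pi_mult q pi u z = z' -> (z ^+ q) ^+ q = z' - u * z ^+ q - pi * z.
  by rewrite -E2 => <-; rewrite /pi_mult; ring.
have [XE YE] : pi_mult q pi u X = X1 /\ pi_mult q pi u Y = Y1 by [].
rewrite /pi_mult_LT /mu2 -/X1 -/Y1; clearbody X1 Y1.
rewrite !(exprDq q_char, exprNq q_char) !exprMn.
rewrite (elim _ _ X0) (elim _ _ Y0) (elim _ _ XE) (elim _ _ YE) /moore.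
by ring.
Qed.

Lemma moore_LT pi u X1 Y1 : pi_mult q pi u X1 = 0 -> pi_mult q pi u Y1 = 0 ->
  moore q X1 Y1 ^+ q = pi * moore q X1 Y1.
Proof.
have E2 z : z ^+ (q ^ 2) = (z ^+ q) ^+ q by rewrite -exprM -mulnn.
have elim z : pi_mult q pi u z = 0 -> (z ^+ q) ^+ q = - u * z ^+ q - pi * z.
  by rewrite /pi_mult E2 -addrA => /eqP; rewrite addr_eq0 => /eqP ->; ring.
move=> X0 Y0; rewrite mooreXq // /moore (elim _ X0) (elim _ Y0); ring.
Qed.

Lemma pi_multD pi u X Y :
  pi_mult q pi u (X + Y) = pi_mult q pi u X + pi_mult q pi u Y.
Proof.
rewrite /pi_mult !(exprDn_pchar _ _ q_char) exprDn_pchar ?pnatX ?q_char //.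
by ring.
Qed.

Lemma pi_multZ pi u c X : c ^+ q = c -> pi_mult q pi u (c * X) = c * pi_mult q pi u X.
Proof.
move=> cq; rewrite /pi_mult !exprMn -mulnn exprM !cq; ring.
Qed.

(** Moving Y by a pi-torsion point moves mu2 by an arbitrary pi-torsion point of the
    Lubin-Tate module. This is used to adjust mu2 to a prescribed generator. *)
Lemma mu2_shift pi u X Y c : c ^+ q = c ->
  pi_mult q pi u (pi_mult q pi u Y) = 0 ->
  mu2 q pi u X (Y + c * pi_mult q pi u Y) =
  mu2 q pi u X Y - c * moore q (pi_mult q pi u X) (pi_mult q pi u Y).
Proof.
move=> cq Y0; rewrite /mu2 pi_multD pi_multZ // Y0 mulr0 addr0.
by rewrite exprDq // exprMn cq /moore; ring.
Qed.

End Determinant.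

(** * Scaled equations of the affinoid *)

Lemma sqr_sub1 k : (k.+1 ^ 2 - 1 = k * k.+2)%N.
Proof. by rewrite -mulnn; lia. Qed.

(* With q = k + 1, the truncated subtractions q - 1 and q ^ 2 - 1 become
   polynomials in k. *)
Ltac exponents := match goal with q1 : is_true (1 < ?q)%N |- _ =>
  clear - q1; case: q q1 => // k _;
  rewrite ?sqr_sub1 ?subn1 /= ?expnS ?expn0; ring end.

Section ScaledPoints.
Variables (R : realType) (K : fieldType) (v : valuation R K) (q : nat) (p' gamma : K).
Implicit Types U x y : K.

(** In terms of U = u / a^(q^4(q-1)), x = X_2 / a^q and y = Y_2 / a^q, where
    a^(q^2(q+1)) = pi2, and up to a power of a, the expressions [pi]_u(X_2),
    [pi]_u([pi]_u(X_2)) and mu2(X_2, Y_2) only involve U, x, y, the unit p' and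
    gamma = a^((q-1)(q^2-1)). The next definitions are the result. *)
Definition scaled_pi U x := pi_mult q (p' * gamma ^+ (q * (q + 1))) (gamma ^+ (q ^ 2) * U) x.

Definition scaled_error U x y :=
  p' * gamma ^+ (q ^ 2) * (1 + p' ^+ q.-1 * gamma ^+ (q ^ 3)) * moore q x y +
  U ^+ q * gamma ^+ (q ^ 3) * moore (q ^ 2) x y.

Definition scaled_point U x y := [/\ U \in vring v,
  pi_mult q p' U (scaled_pi U x) = 0, pi_mult q p' U (scaled_pi U y) = 0 &
  moore q x y ^+ q = 1 + gamma ^+ q * (moore (q ^ 3) x y + scaled_error U x y)].

Hypotheses (q_char : [pchar K].-nat q) (q_gt1 : (1 < q)%N).
Hypothesis (p'_res : p' - 1 \in vsmall v).
Hypotheses (gamma_small : gamma \in vsmall v) (gamma0 : gamma != 0).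

Lemma unit_vring : p' \in vring v.
Proof. by rewrite -(subrK 1 p') rpredD ?rpred1 ?vsmallW. Qed.

(** Integrality of x follows from the two equations, which are monic and integral. *)
Lemma scaled_pi_integral U x : U \in vring v -> pi_mult q p' U (scaled_pi U x) = 0 ->
  x \in vring v.
Proof.
move=> Ur x0; have gr : gamma \in vring v := vsmallW gamma_small.
have pr := unit_vring.
have x1r : scaled_pi U x \in vring v.
  by apply: (pi_mult_integral q_gt1 pr Ur); rewrite x0 valuation0 leey.
apply: (pi_mult_integral q_gt1 _ _ x1r).
  by rewrite -vringE rpredM ?rpredX.
by rewrite -vringE rpredM ?rpredX.
Qed.

Definition scaled_Z x y := (moore q x y - 1) / gamma.

Lemma scaled_Z_eq U x y : scaled_point U x y ->
  scaled_Z x y ^+ q = moore (q ^ 3) x y + scaled_error U x y.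
Proof.
case=> _ _ _ dE; apply: (mulIf (expf_neq0 q gamma0)).
rewrite -exprMn divfK // exprBq // dE expr1n; ring.
Qed.

Lemma scaled_error_small U x y : U \in vring v -> x \in vring v -> y \in vring v ->
  scaled_error U x y \in vsmall v.
Proof.
move=> Ur xr yr; have pr := unit_vring.
have gX n : (0 < n)%N -> gamma ^+ n \in vsmall v by apply: vsmallX.
have gr n : gamma ^+ n \in vring v by rewrite rpredX // vsmallW.
have mr n : moore n x y \in vring v by rewrite rpredB ?rpredM ?rpredX.
have q0 n : (0 < q ^ n)%N by rewrite expn_gt0 ltnW.
rewrite rpredD //; apply: vsmallMr => //.
  apply: vsmallMr; first by apply: vsmallMl => //; apply/gX/q0.
  by rewrite rpredD ?rpred1 // rpredM ?rpredX // vsmallW.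
by apply: vsmallMl; [rewrite rpredX|apply/gX/q0].
Qed.

Lemma scaled_point_integral U x y : scaled_point U x y ->
  [/\ U \in vring v, x \in vring v, y \in vring v & scaled_Z x y \in vring v].
Proof.
move=> nUxy; have [Ur x0 y0 _] := nUxy.
have [xr yr] := (scaled_pi_integral Ur x0, scaled_pi_integral Ur y0).
split=> //; apply: (@vring_rootX _ _ _ _ q); first exact: ltnW.
rewrite (scaled_Z_eq nUxy) rpredD //; last exact/vsmallW/scaled_error_small.
by rewrite rpredB ?rpredM ?rpredX.
Qed.

(** The term in p' cancels between the equations for x and for y. As the factor of U
    is congruent to d^(q^2) = 1, this expresses U modulo gamma. *)
Lemma scaled_U_eq U x y : scaled_point U x y ->
  U * moore q (scaled_pi U x) (scaled_pi U y) = - moore (q ^ 2) (scaled_pi U x) (scaled_pi U y).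
Proof.
have E z : pi_mult q p' U z = 0 -> z ^+ (q ^ 2) = - U * z ^+ q - p' * z.
  by rewrite /pi_mult -addrA => /eqP; rewrite addr_eq0 => /eqP ->; ring.
by case=> _ /E xE /E yE _; rewrite /moore xE yE; ring.
Qed.

End ScaledPoints.

Section AffinoidScaling.
Variables (R : realType) (C : fieldType) (v : valuation R C) (q : nat).
Variables (P pi2 a : C).
Hypotheses (q_char : [pchar C].-nat q) (q_gt1 : (1 < q)%N).
Hypothesis q_char_res : [pchar residue v].-nat q.
Hypothesis (vP : v P = 1%:E).
Hypothesis (pi2_gen : LT_generator2 q P pi2).
Hypothesis (aE : a ^+ (q ^ 2 * (q + 1)) = pi2).

Let rho := pi_mult_LT q P pi2.
Let rho0 : rho != 0.
Proof. by have [_ /eqP] := pi2_gen. Qed.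

Let rho_q : rho ^+ q = P * rho.
Proof. by have [/eqP] := pi2_gen; rewrite /pi_mult_LT subr_eq0 => /eqP <-. Qed.

Let P_E : P = rho ^+ q.-1.
Proof. by apply: (mulIf rho0); rewrite -rho_q -exprSr prednK // ltnW. Qed.

Lemma LT_generator_neq0 : pi2 != 0.
Proof.
apply: contraNneq rho0 => pi0; rewrite /rho /pi_mult_LT pi0 mulr0 sub0r.
by rewrite expr0n gtn_eqF ?oppr0 // ltnW.
Qed.

Let c := P * pi2 / pi2 ^+ q.

Let rhoE : rho = pi2 ^+ q * (c - 1).
Proof.
rewrite mulrBr mulr1 mulrC divfK //.
by rewrite expf_neq0 // LT_generator_neq0.
Qed.

(** The Newton polygon of the Lubin-Tate polynomials. Here c compares the two terms
    of [pi](pi2): that c is small means that - pi2^q is the dominant term. *)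
Lemma LT_generator_valuation : exists2 t : R, v pi2 = t%:E &
  t * (q%:R * (q%:R - 1)) = 1 /\ c \in vsmall v.
Proof.
have [t tE] := valuation_fin v LT_generator_neq0.
have [r rE] := valuation_fin v rho0.
have rq : r *+ q = 1 + r.
  by apply: EFin_inj; rewrite EFinD -(valuationX _ rE) rho_q valuationM vP rE.
have cE : v c = (1 + t - t *+ q)%:E.
  by rewrite valuationM (valuationV (valuationX q tE)) valuationM vP tE.
have q1 : 1 <= q%:R - 1 :> R by rewrite lerBrDr -[1 + 1]/(2%:R) ler_nat.
have c_small : c \in vsmall v.
  rewrite vsmallE cE lte_fin ltNge; apply/negP => le.
  have : ((1 + t)%:E <= v rho)%E.
    rewrite /rho /pi_mult_LT; apply: valuation_leD.
      by rewrite valuationM vP tE.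
    by rewrite valuationN (valuationX _ tE) lee_fin; lra.
  rewrite rE lee_fin => tr.
  have : r * (q%:R - 1) <= t * (q%:R - 1).
    by move: le rq; rewrite -(mulr_natr t) -(mulr_natr r); lra.
  by rewrite ler_pM2r; lra.
exists t => //; split=> //.
have c1 : v (c - 1) = 0%E.
  apply/eqP; rewrite eq_le -[(0 <= _)%E]/(_ \in vring v).
  rewrite rpredB ?rpred1 ?vsmallW // andbT leNgt; apply: contra (vsmall1 v) => c1.
  by rewrite -(subKr c 1) rpredB.
have : r = t *+ q.
  by apply: EFin_inj; rewrite -rE rhoE valuationM c1 adde0 (valuationX _ tE).
by move=> rt; move: rq; rewrite rt -(mulr_natr (t *+ q)) -(mulr_natr t); lra.
Qed.

Let e := (q ^ 3 * (q ^ 2 - 1))%N.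

(** The exponent is chosen so that this is a unit: v(a^e) = 1. *)
Definition unit_part := P / a ^+ e.
Local Notation p' := unit_part.

Lemma parameter_neq0 : a != 0.
Proof.
apply: contraNneq LT_generator_neq0 => a0; rewrite -aE a0 expr0n.
by rewrite muln_eq0 expn_eq0 addn1 orbF gtn_eqF // ltnW.
Qed.

Lemma unit_partE : P = p' * a ^+ e.
Proof. by rewrite divfK // expf_neq0 // parameter_neq0. Qed.

Lemma parameter_small : a \in vsmall v.
Proof.
have [t tE [t1 _]] := LT_generator_valuation.
apply: (@vsmall_rootX _ _ _ _ (q ^ 2 * (q + 1))); rewrite aE vsmallE tE lte_fin.
have q1 : 1 <= q%:R - 1 :> R by rewrite lerBrDr -[1 + 1]/(2%:R) ler_nat.
have : 0 < q%:R * (q%:R - 1) :> R by rewrite mulr_gt0 ?ltr0n 1?ltnW //; lra.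
by move=> q0; rewrite -(pmulr_lgt0 _ q0) t1.
Qed.

(** pi = rho^(q-1) with rho = [pi](pi2) = pi2^q (c - 1), and (-1)^(q-1) = 1 in
    characteristic p. *)
Lemma unit_part_res : p' - 1 \in vsmall v.
Proof.
have [t tE [t1 c_small]] := LT_generator_valuation.
have q0 : (0 < q)%N := ltnW q_gt1.
have -> : p' = (c - 1) ^+ q.-1.
  apply: (mulIf (expf_neq0 e parameter_neq0)); rewrite -unit_partE P_E rhoE exprMn mulrC.
  congr (_ * _); rewrite -aE -!exprM; congr (_ ^+ _).
  by rewrite /e -subn1 -(prednK q0); move: q.-1 => m; rewrite subn1 /=; nia.
have cr : c - 1 \in vring v by rewrite rpredB ?rpred1 ?vsmallW.
rewrite -vres_sub ?rpredX ?rpred1 // vresX // vres1.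
rewrite (_ : vres v (c - 1) = -1); last first.
  by rewrite vresD -?vringE ?rpredN ?rpred1 ?vsmallW // vres_small // add0r vresN ?rpred1 // vres1.
apply/eqP/(mulIf (_ : -1 != 0)); first by rewrite oppr_eq0 oner_eq0.
by rewrite -exprSr prednK // mul1r exprNq // expr1n.
Qed.

Definition gamma := a ^+ ((q - 1) * (q ^ 2 - 1)).
Local Notation scaled_pi := (scaled_pi q p' gamma).
Local Notation scaled_point := (scaled_point v q p' gamma).

(** These three lemmas are the comparison of exponents of a that explains the choice
    of gamma. *)
Lemma pi_mult_scale1 U x : pi_mult q P (a ^+ (q ^ 4 * (q - 1)) * U) (a ^+ q * x) =
  a ^+ (q ^ 3) * scaled_pi U x.
Proof.
rewrite /scaled_pi /pi_mult; move: (p') unit_partE => u ->; rewrite !exprMn !mulrDr /gamma -!exprM.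
rewrite (_ : q * q ^ 2 = q ^ 3)%N //.
rewrite (_ : a ^+ (q ^ 4 * (q - 1)) * U * (a ^+ (q * q) * x ^+ q) =
  a ^+ (q ^ 4 * (q - 1) + q * q) * U * x ^+ q); last by rewrite exprD; ring.
rewrite (_ : u * a ^+ e * (a ^+ q * x) = u * a ^+ (e + q) * x); last first.
  by rewrite exprD; ring.
rewrite (_ : q ^ 4 * (q - 1) + q * q =
    q ^ 3 + (q - 1) * (q ^ 2 - 1) * q ^ 2)%N; last by exponents.
rewrite (_ : e + q = q ^ 3 + (q - 1) * (q ^ 2 - 1) * (q * (q + 1)))%N; last first.
  by rewrite /e; exponents.
by rewrite !exprD; ring.
Qed.

Lemma pi_mult_scale2 U z : pi_mult q P (a ^+ (q ^ 4 * (q - 1)) * U) (a ^+ (q ^ 3) * z) =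
  a ^+ (q ^ 5) * pi_mult q p' U z.
Proof.
rewrite /pi_mult; move: (p') unit_partE => u ->; rewrite !exprMn !mulrDr -!exprM -[in LHS]expnD.
rewrite (_ : a ^+ (q ^ 4 * (q - 1)) * U * (a ^+ (q ^ 3 * q) * z ^+ q) =
  a ^+ (q ^ 4 * (q - 1) + q ^ 3 * q) * U * z ^+ q); last by rewrite exprD; ring.
rewrite (_ : u * a ^+ e * (a ^+ (q ^ 3) * z) = u * a ^+ (e + q ^ 3) * z); last first.
  by rewrite exprD; ring.
rewrite (_ : q ^ 4 * (q - 1) + q ^ 3 * q = q ^ 5)%N; last by exponents.
rewrite (_ : e + q ^ 3 = q ^ 5)%N; last by rewrite /e; exponents.
by ring.
Qed.

Lemma mu2_scale U x y :
  mu2 q P (a ^+ (q ^ 4 * (q - 1)) * U) (a ^+ q * x) (a ^+ q * y) =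
  pi2 * (moore q x y ^+ q -
    gamma ^+ q * (moore (q ^ 3) x y + scaled_error q p' gamma U x y)).
Proof.
rewrite mu2E // !moore_scale -aE /scaled_error /gamma; move: (p') unit_partE => u ->.
rewrite !exprMn -!exprM.
have -> : u ^+ q = u * u ^+ q.-1 by rewrite -exprS prednK // ltnW.
move: (moore q x y ^+ q) (moore q x y) (moore (q ^ 2) x y) (moore (q ^ 3) x y).
move: (u ^+ q.-1) (U ^+ q) => pq w dq d s t.
rewrite (_ : u * a ^+ e * (a ^+ (q * q.+1) * d) = u * d * a ^+ (e + q * q.+1)); last first.
  by rewrite exprD; ring.
rewrite (_ : a ^+ (q ^ 4 * (q - 1) * q) * w * (a ^+ (q * (q ^ 2).+1) * s) =
    w * s * a ^+ (q ^ 4 * (q - 1) * q + q * (q ^ 2).+1)); last by rewrite exprD; ring.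
rewrite (_ : u * pq * a ^+ (e * q) * (a ^+ (q * q.+1) * d) =
    u * pq * d * a ^+ (e * q + q * q.+1)); last by rewrite exprD; ring.
set n := ((q - 1) * (q ^ 2 - 1))%N.
rewrite (_ : q * q.+1 * q = q ^ 2 * (q + 1))%N; last by exponents.
rewrite (_ : e + q * q.+1 = q ^ 2 * (q + 1) + n * q + n * q ^ 2)%N; last first.
  by rewrite /e /n; exponents.
rewrite (_ : q * (q ^ 3).+1 = q ^ 2 * (q + 1) + n * q)%N; last by rewrite /n; exponents.
rewrite (_ : q ^ 4 * (q - 1) * q + q * (q ^ 2).+1 =
    q ^ 2 * (q + 1) + n * q + n * q ^ 3)%N; last by rewrite /n; exponents.
rewrite (_ : e * q + q * q.+1 =
    q ^ 2 * (q + 1) + n * q + n * q ^ 2 + n * q ^ 3)%N; last by rewrite /e /n; exponents.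
by rewrite !exprD; ring.
Qed.

(** So the condition v(u) >= q / (q + 1) says that U is integral. *)
Lemma radius_valuation : v (a ^+ (q ^ 4 * (q - 1))) = (q%:R / q.+1%:R : R)%:E.
Proof.
have [t tE [t1 _]] := LT_generator_valuation.
have [h hE] := valuation_fin v parameter_neq0.
have ht : h *+ (q ^ 2 * (q + 1)) = t.
  by apply: EFin_inj; rewrite -tE -aE (valuationX _ hE).
rewrite (valuationX _ hE); congr _%:E; move: t1; rewrite -ht.
rewrite -!(mulr_natr h) 2!natrM !natrX natrB ?(ltnW q_gt1) // -(addn1 q) !natrD => t1.
have q1 : q%:R + 1 != 0 :> R by rewrite natr1 pnatr_eq0.
apply: (mulIf q1); rewrite divfK //.
by have := congr1 ( *%R q%:R) t1; rewrite mulr1; apply: etrans; ring.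
Qed.

Lemma Y22_scaled (Q : 'I_3 -> C) :
  Y22_set v q P pi2 Q <->
  scaled_point (Q 0 / a ^+ (q ^ 4 * (q - 1))) (Q 1 / a ^+ q) (Q 2 / a ^+ q).
Proof.
have aX n : a ^+ n != 0 by rewrite expf_neq0 // parameter_neq0.
have cancelX n z : z = a ^+ n * (z / a ^+ n) by rewrite mulrC divfK.
have pi20 := LT_generator_neq0.
set U := Q 0 / _; set x := Q 1 / _; set y := Q 2 / _.
have UE : Q 0 = a ^+ (q ^ 4 * (q - 1)) * U by apply: cancelX.
have xE : Q 1 = a ^+ q * x by apply: cancelX.
have yE : Q 2 = a ^+ q * y by apply: cancelX.
have Ur : (U \in vring v) = ((q%:R / q.+1%:R)%:E <= v (Q 0%R))%E.
  rewrite vringE /U; have [->|Q0] := eqVneq (Q 0) 0.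
    by rewrite mul0r valuation0 !leey.
  have [r rE] := valuation_fin v Q0.
  by rewrite valuationM (valuationV radius_valuation) rE -EFinD !lee_fin subr_ge0.
rewrite /Y22_set /LT_curve2 UE xE yE !pi_mult_scale1 !pi_mult_scale2 mu2_scale -UE -Ur.
split.
  case=> -[_ /eqP X0 /eqP Y0 mu] Ur'; split=> //.
  - by apply/eqP; move: X0; rewrite mulf_eq0 (negPf (aX _)).
  - by apply/eqP; move: Y0; rewrite mulf_eq0 (negPf (aX _)).
  - apply/eqP; rewrite -subr_eq; apply/eqP/(mulfI pi20).
    by rewrite mu mulr1.
case=> Ur' X0 Y0 mu; rewrite X0 Y0 !mulr0 mu addrK mulr1; split=> //; split=> //.
move: Ur'; rewrite Ur; apply: lt_le_trans.
by rewrite lte_fin divr_gt0 // ltr0n // ltnW.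
Qed.

End AffinoidScaling.

(** * Lifting points of the reduced curve *)

Section Lifting.
Variables (R : realType) (L : closedFieldType) (C : fieldType).
Variables (v : valuation R C) (j : {rmorphism L -> C}) (q : nat).
Variables (PL aL : L) (pi2 : C).
Hypothesis dense : forall x (M : R), exists y, (M%:E <= v (x - j y)%R)%E.
Hypotheses (q_char : [pchar C].-nat q) (q_gt1 : (1 < q)%N).
Hypothesis q_char_res : [pchar residue v].-nat q.
Local Notation P := (j PL).
Local Notation a := (j aL).
Hypothesis (vP : v P = 1%:E).
Hypothesis (pi2_gen : LT_generator2 q P pi2).
Hypothesis (aE : a ^+ (q ^ 2 * (q + 1)) = pi2).
Local Notation p' := (unit_part q P a).
Local Notation gamma := (gamma q a).

Let a0 : a != 0 := parameter_neq0 q_gt1 pi2_gen aE.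
Let a_small : a \in vsmall v := parameter_small q_gt1 vP pi2_gen aE.
Let p'_res : p' - 1 \in vsmall v := unit_part_res q_char q_gt1 q_char_res vP pi2_gen aE.
Let pi20 : pi2 != 0 := LT_generator_neq0 q_gt1 pi2_gen.

Let gamma_small : gamma \in vsmall v.
Proof. by rewrite vsmallX // muln_gt0 -mulnn; apply/andP; split; nia. Qed.

Let q0 n : (0 < q ^ n)%N.
Proof. by rewrite expn_gt0 ltnW. Qed.

Let pi_mult_LTB t t' : pi_mult_LT q P (t - t') = pi_mult_LT q P t - pi_mult_LT q P t'.
Proof. by rewrite /pi_mult_LT exprBq //; ring. Qed.

Let rho := pi_mult_LT q P pi2.

(** [pi](m) and [pi](pi2) are two elements of LT[pi] whose difference is smaller than
    any nonzero element of LT[pi]. *)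
Lemma LT_near m : pi_mult_LT q P (pi_mult_LT q P m) = 0 ->
  (m - pi2) / pi2 \in vsmall v -> pi_mult_LT q P m = rho.
Proof.
move=> m0 m_small; apply/eqP; rewrite -subr_eq0 -pi_mult_LTB.
set e := pi_mult_LT q P _; set t := (m - pi2) / pi2 in m_small.
have [rho_q rho0] := pi2_gen.
have [_ _ [_ c_small]] := LT_generator_valuation q_gt1 vP pi2_gen.
set c := _ / _ in c_small.
have tE : m - pi2 = pi2 * t by rewrite mulrC divfK.
have pi2q : pi2 ^+ q != 0 by rewrite expf_neq0.
have eE : e / pi2 ^+ q \in vsmall v.
  rewrite /e /pi_mult_LT tE exprMn mulrBl mulrA mulrAC -/c [pi2 ^+ q * _]mulrC mulfK //.
  by apply: rpredB; [apply: vsmallMr => //; apply: vsmallW|rewrite vsmallX // ltnW].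
have rhoE : (rho / pi2 ^+ q)^-1 \in vring v.
  have rE : rho / pi2 ^+ q = c - 1 by rewrite /rho /pi_mult_LT mulrBl divff.
  rewrite rE; apply: vring_nsmall_inv; first by rewrite rpredB ?rpred1 ?vsmallW.
  by apply: contra (vsmall1 v) => c1; rewrite -(subKr c 1) rpredB.
apply: contraT => e0; have [/eqP rho0' e_rho] : rho <> 0 /\ e / rho \in vsmall v.
  split=> //; rewrite (_ : e / rho = (e / pi2 ^+ q) * (rho / pi2 ^+ q)^-1).
    exact: vsmallMr.
  by rewrite invfM invrK mulrACA mulVf // mulr1.
have eq_ : e ^+ q = P * e.
  apply/eqP; rewrite eq_sym -subr_eq0; apply/eqP.
  by rewrite -/(pi_mult_LT q P e) /e pi_mult_LTB pi_mult_LTB m0 rho_q subrr.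
have rhoq : rho ^+ q = P * rho by apply/eqP; rewrite eq_sym -subr_eq0; apply/eqP.
have : (e / rho) ^+ q = e / rho.
  have P0 : P != 0 by rewrite -(valuation_eqy v) vP.
  by rewrite expr_div_n eq_ rhoq invfM mulrACA divff // mul1r.
move=> /periodic_small/(_ e_rho)/eqP; rewrite mulf_eq0 invr_eq0 (negPf rho0').
by rewrite orbF (negPf e0) => /(_ q_gt1).
Qed.

(** Choose U above - s^(q^2), then a pi-torsion point above x^(q^2), then a pi^2-torsion
    point above x, and the same for y. Then mu2 is close to pi2 but may differ from
    it; LT_near shows that the difference is in LT[pi], and mu2_shift removes it
    without changing the reduction. *)
Lemma lift_point (x y : residue v) : moore q x y = 1 ->
  exists2 Q, Y22_set v q P pi2 Q &
    vres v (Q 1 / a ^+ q) = x /\ vres v (Q 2 / a ^+ q) = y.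
Proof.
move=> d1; pose s := moore (q ^ 2) x y.
have [UL Ur UE] := residue_lift dense (- s ^+ (q ^ 2)).
pose U := j UL; have pr := unit_vring p'_res.
have gr : gamma \in vring v := vsmallW gamma_small.
have [pL pLE] : exists pL, j pL = p'.
  by exists (PL / aL ^+ (q ^ 3 * (q ^ 2 - 1))); rewrite fmorph_div rmorphXn.
have [gL gLE] : exists gL, j gL = gamma.
  by exists (aL ^+ ((q - 1) * (q ^ 2 - 1))); rewrite rmorphXn.
have q_charX : [pchar residue v].-nat (q ^ 2)%N by rewrite pnatX q_char_res.
have lift z : z ^+ (q ^ 2) = s * z ^+ q - z -> exists zL : L,
    pi_mult q p' U (scaled_pi q p' gamma U (j zL)) = 0 /\
    j zL \in vring v /\ vres v (j zL) = z.
  move=> zE; have [||||z1 z1E [z1r z1z]] :=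
    @lift_pi_mult _ _ _ v j dense q UL pL 0 (z ^+ (q ^ 2)) q_gt1.
  - by [].
  - by rewrite pLE.
  - by rewrite rmorph0 rpred0.
  - rewrite pLE rmorph0 UE [RHS]vres_small ?rpred0 //.
    have -> : vres v p' = 1 by apply/eqP; rewrite -(vres1 v) vres_sub ?rpred1.
    rewrite mul1r mulNr [_ ^+ _ ^+ q]exprAC -exprMn -exprBq // -exprDq //.
    rewrite (_ : _ + z = 0); first by rewrite expr0n gtn_eqF.
    by rewrite zE; ring.
  have [||||z2 z2E [z2r z2z]] := @lift_pi_mult _ _ _ v j dense q (gL ^+ (q ^ 2) * UL)
      (pL * gL ^+ (q * (q + 1))) z1 z q_gt1.
  - by rewrite rmorphM rmorphXn gLE; apply: rpredM => //; apply: rpredX.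
  - by rewrite rmorphM rmorphXn gLE pLE; apply: rpredM => //; apply: rpredX.
  - by [].
  - rewrite !rmorphM !rmorphXn gLE pLE z1z.
    rewrite [vres v (gamma ^+ _ * _)]vres_small ?[vres v (_ * gamma ^+ _)]vres_small.
    + by rewrite !mul0r !addr0.
    + by rewrite vsmallMl // vsmallX // muln_gt0 addn1 ltnW.
    + by rewrite vsmallMr // vsmallX.
  exists z2; split=> //; rewrite /scaled_pi; move: z2E z1E.
  by rewrite !rmorphM !rmorphXn pLE gLE /U => -> ->; rewrite rmorph0.
have elim_x := moore_elim q_char_res x y; have elim_y := moore_elimr q_char_res x y.
rewrite d1 expr1n !mulr1 -/s in elim_x elim_y.
have [xL [x0 [xr xE]]] := lift x elim_x; have [yL [y0 [yr yE]]] := lift y elim_y.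
pose u := a ^+ (q ^ 4 * (q - 1)) * U.
pose X := a ^+ q * j xL; pose Y := a ^+ q * j yL.
set x1 := scaled_pi _ _ _ _ _ in x0; set y1 := scaled_pi _ _ _ _ _ in y0.
have X1E : pi_mult q P u X = a ^+ (q ^ 3) * x1 := pi_mult_scale1 q_gt1 pi2_gen aE U _.
have Y1E : pi_mult q P u Y = a ^+ (q ^ 3) * y1 := pi_mult_scale1 q_gt1 pi2_gen aE U _.
have X1 : pi_mult q P u (pi_mult q P u X) = 0.
  by rewrite X1E (pi_mult_scale2 q_gt1 pi2_gen aE) x0 mulr0.
have Y1 : pi_mult q P u (pi_mult q P u Y) = 0.
  by rewrite Y1E (pi_mult_scale2 q_gt1 pi2_gen aE) y0 mulr0.
pose m := mu2 q P u X Y.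
have m_near : (m - pi2) / pi2 \in vsmall v.
  rewrite /m (mu2_scale q_char q_gt1 pi2_gen aE) -[X in _ - X]mulr1 -mulrBr mulrC mulKf //.
  rewrite addrAC rpredB //.
    rewrite -vres_sub ?rpred1 ?rpredX ?rpredB ?rpredM ?rpredX //.
    rewrite vresX ?rpredB ?rpredM ?rpredX // vres_moore // xE yE d1 expr1n.
    by rewrite vres1.
  apply: vsmallMr; first by rewrite vsmallX // ltnW.
  rewrite rpredD //; last by apply/vsmallW/scaled_error_small.
  by rewrite rpredB ?rpredM ?rpredX.
set X1' := pi_mult q P u X in X1 X1E; set Y1' := pi_mult q P u Y in Y1 Y1E.
have mE : pi_mult_LT q P m = - moore q X1' Y1' by apply: mu2_LT.
have dq := moore_LT q_char X1 Y1.
have m_rho : - moore q X1' Y1' = rho.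
  rewrite -mE; apply: LT_near => //; rewrite mE /pi_mult_LT exprNq // dq.
  by ring.
pose c := (m - pi2) / moore q X1' Y1'.
have P0 : P != 0 by rewrite -(valuation_eqy v) vP.
have cq : c ^+ q = c.
  have -> : c = (m - pi2) / moore q X1' Y1' by [].
  have tq : (m - pi2) ^+ q = P * (m - pi2).
    apply/eqP; rewrite eq_sym -subr_eq0 -/(pi_mult_LT _ _ _) pi_mult_LTB.
    by rewrite mE m_rho subrr.
  by rewrite expr_div_n tq dq invfM mulrACA divff // mul1r.
have cr : c \in vring v by apply: periodic_vring cq.
have d0 : moore q X1' Y1' != 0.
  by rewrite -oppr_eq0 m_rho; have [_ /eqP] := pi2_gen.
pose Q : 'I_3 -> C := tnth [tuple u; X; Y + c * Y1'].
have Q0 : Q 0 = u by [].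
have Q1 : Q 1 = X by [].
have Q2 : Q 2 = Y + c * Y1' by [].
have aq n : a ^+ n != 0 by rewrite expf_neq0.
have vu : ((q%:R / q.+1%:R)%:E <= v u)%E.
  rewrite /u valuationM (radius_valuation q_gt1 vP pi2_gen aE).
  by rewrite -[leLHS]adde0 leeD // -vringE.
exists Q.
  split; last by rewrite Q0.
  split; rewrite ?Q0 ?Q1 ?Q2 -/X1' ?X1 //.
  - by apply: lt_le_trans vu; rewrite lte_fin divr_gt0 // ltr0n // ltnW.
  - have -> : pi_mult q P u (Y + c * Y1') = Y1'.
      by rewrite pi_multD // pi_multZ // Y1 mulr0 addr0.
    by [].
  - by rewrite mu2_shift // -/m -/X1' -/Y1' divfK // subKr.
rewrite Q1 Q2 /X mulrC mulKf //; split=> //; rewrite -yE.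
have y1r : y1 \in vring v.
  by apply: (pi_mult_integral q_gt1 pr Ur); rewrite y0 valuation0 leey.
have -> : (Y + c * Y1') / a ^+ q = j yL + c * a ^+ (q ^ 3 - q) * y1.
  have qq3 : (q <= q ^ 3)%N by rewrite -{1}(expn1 q) leq_exp2l.
  apply: (mulIf (aq q)); rewrite divfK // Y1E /Y -(subnK qq3) exprD.
  by rewrite addnK; ring.
have small : c * a ^+ (q ^ 3 - q) * y1 \in vsmall v.
  by rewrite vsmallMr // vsmallMl // vsmallX // subn_gt0 -{1}(expn1 q) ltn_exp2l.
have sr := vsmallW small; apply/eqP; rewrite vres_sub ?(rpredD yr sr) //.
by rewrite addrC addKr.
Qed.

End Lifting.

(** * Rigid functions and their reductions *)

Section AffinoidTheory.
Variables (R : realType) (K : fieldType) (v : valuation R K).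
Variables (n : nat) (r : 'I_n -> R) (Y : ('I_n -> K) -> Prop).
Local Notation pts := (affinoid_point v r Y).
Local Notation red := (reduction_ring v r Y).
Implicit Types (f g : pts -> K) (Q : pts).

Lemma rigid_const c : rigid (fun _ : pts => c).
Proof.
exists (fun m => if m == 0%MM then c else 0) => [M|Q M].
  exists 1%N => m m0; case: eqP m0 => [->|_ _]; first by rewrite mdeg0.
  by rewrite valuation0 leey.
exists 1%N => -[//|k] _.
suff -> : partial_sum (fun m => if m == 0%MM then c else 0) k.+1 = c%:MP_[n].
  by rewrite mevalC subrr valuation0 leey.
apply/mpolyP => m; rewrite mcoeff_partial_sum mcoeffC.
case: ltnP => [_|km]; first by case: eqP => _; rewrite ?mulr1 ?mulr0.
by case: eqP km => [->|_ _]; [rewrite mdeg0|rewrite mulr0].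
Qed.

Lemma rigid_coord i : rigid (fun Q : pts => Q i).
Proof.
exists (fun m => if m == U_(i)%MM then 1 else 0) => [M|Q M].
  exists 2%N => m m0; case: eqP m0 => [->|_ _]; first by rewrite mdeg1.
  by rewrite valuation0 leey.
exists 2%N => -[//|[//|k]] _.
suff -> : partial_sum (fun m => if m == U_(i)%MM then 1 else 0) k.+2 = 'X_i :> {mpoly K[n]}.
  by rewrite mevalXU subrr valuation0 leey.
apply/mpolyP => m; rewrite mcoeff_partial_sum mcoeffX [U_(i)%MM == m]eq_sym.
case: ltnP => [_|km]; first by case: eqP.
by case: eqP km => [->|//]; rewrite mdeg1.
Qed.

Lemma eq_rigid f g : f =1 g -> rigid f -> rigid g.
Proof. by move=> fg [b sb bf]; exists b => // Q; rewrite -fg. Qed.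

Lemma rigid_sub f g : rigid f -> rigid g -> rigid (fun Q => f Q - g Q).
Proof. exact: rigidB. Qed.

Lemma rigid_mul f g : rigid f -> rigid g -> rigid (fun Q => f Q * g Q).
Proof. exact: rigidM. Qed.

Lemma rigid_add f g : rigid f -> rigid g -> rigid (fun Q => f Q + g Q).
Proof.
move=> rf rg; apply: (@eq_rigid (fun Q => f Q - (0 - g Q))) => [Q|].
  by rewrite sub0r opprK.
by apply/rigid_sub/rigid_sub => //; apply: rigid_const.
Qed.

Lemma rigid_exp f k : rigid f -> rigid (fun Q => f Q ^+ k).
Proof.
move=> rf; elim: k => [|k IHk]; first exact: rigid_const.
by apply: (eq_rigid (fun Q => esym (exprS _ _))); apply: rigid_mul.
Qed.

Lemma rigid_sum (I : Type) (s : seq I) (F : I -> pts -> K) :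
  (forall i, rigid (F i)) -> rigid (fun Q => \sum_(i <- s) F i Q).
Proof.
move=> rF; elim: s => [|i s IHs].
  by apply: eq_rigid (rigid_const 0) => Q; rewrite big_nil.
by apply: eq_rigid (rigid_add (rF i) IHs) => Q; rewrite big_cons.
Qed.

Lemma rigid_prod (I : Type) (s : seq I) (F : I -> pts -> K) :
  (forall i, rigid (F i)) -> rigid (fun Q => \prod_(i <- s) F i Q).
Proof.
move=> rF; elim: s => [|i s IHs].
  by apply: eq_rigid (rigid_const 1) => Q; rewrite big_nil.
by apply: eq_rigid (rigid_mul (rF i) IHs) => Q; rewrite big_cons.
Qed.

Lemma rigid_meval d (F : 'I_d -> pts -> K) (p : {mpoly K[d]}) :
  (forall i, rigid (F i)) -> rigid (fun Q => p.@[F^~ Q]).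
Proof.
move=> rF; apply: eq_rigid (fun Q => esym (mevalE _ _)) _.
apply: rigid_sum => m; apply: rigid_mul; first exact: rigid_const.
by apply: rigid_prod => i; apply: rigid_exp.
Qed.

(** A strictly convergent series is uniformly close to its partial sums. *)
Lemma rigid_poly_approx f (M : R) : rigid f ->
  exists p : {mpoly K[n]}, forall Q, (M%:E <= v (f Q - p.@[Q])%R)%E.
Proof.
move=> [b sb bf]; have [N bN] := sb M; exists (partial_sum b N) => Q.
have [N' fN'] := bf Q M; pose N2 := maxn N N'.
rewrite -opprB valuationN -(subrKA ((partial_sum b N2).@[Q])).
apply: valuation_leD; last by apply: fN'; rewrite leq_maxr.
rewrite -mevalB; apply: meval_ge => m; rewrite mcoeffB !mcoeff_partial_sum.
case: (ltnP (mdeg m) N) => [mN|Nm].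
  by rewrite (leq_trans mN) ?leq_maxl // subrr valuation0 leey.
case: ifP => _; last by rewrite subrr valuation0 leey.
by rewrite sub0r valuationN; apply: bN.
Qed.

Lemma integralP f : rigid f -> (forall Q, f Q \in vring v) -> f \in integral_fun (Y:=Y).
Proof. by move=> rf fr; apply/asboolP; split=> //; apply/power_boundedP. Qed.

Lemma reductionE f (fI : f \in integral_fun (Y:=Y)) :
  reduction f = (\pi_red (IntegralFun fI))%qT.
Proof. by rewrite /reduction -[f in LHS]/(val (IntegralFun fI)) valKd. Qed.

Lemma integral_vring f Q : f \in integral_fun (Y:=Y) -> f Q \in vring v.
Proof. by move=> /asboolP[_ /power_boundedP]; apply. Qed.

Lemma reduction_eqP f g : f \in integral_fun (Y:=Y) -> g \in integral_fun (Y:=Y) ->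
  reduction f = reduction g <->
  exists2 e : R, 0 < e & forall Q, (e%:E <= v (f Q - g Q)%R)%E.
Proof.
move=> fI gI; rewrite !reductionE.
split=> [/reduction_piP/asboolP/topologically_nilpotentP //|fg].
by apply/reduction_piP/asboolP/topologically_nilpotentP.
Qed.

Lemma reductionD f g : f \in integral_fun (Y:=Y) -> g \in integral_fun (Y:=Y) ->
  reduction (fun Q => f Q + g Q) = reduction f + reduction g.
Proof.
move=> fI gI; have fgI : f + g \in integral_fun (Y:=Y) by rewrite rpredD.
rewrite (reductionE fI) (reductionE gI) (reductionE fgI) -raddfD.
by congr (\pi_red _)%qT; apply/val_inj.
Qed.

Lemma reductionM f g : f \in integral_fun (Y:=Y) -> g \in integral_fun (Y:=Y) ->
  reduction (fun Q => f Q * g Q) = reduction f * reduction g.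
Proof.
move=> fI gI; have fgI : f * g \in integral_fun (Y:=Y) by rewrite rpredM.
rewrite (reductionE fI) (reductionE gI) (reductionE fgI).
rewrite -[RHS]/(reduction_mul _ _) reduction_mulE.
by congr (\pi_red _)%qT; apply/val_inj.
Qed.

Lemma reduction1 : reduction (fun _ : pts => 1) = 1 :> red.
Proof.
have I1 : (1 : pts -> K) \in integral_fun (Y:=Y) by rewrite rpred1.
by rewrite (reductionE I1); congr (\pi_red _)%qT; apply/val_inj.
Qed.

Lemma reduction0 : reduction (fun _ : pts => 0) = 0 :> red.
Proof.
have I0 : (0 : pts -> K) \in integral_fun (Y:=Y) by rewrite rpred0.
rewrite (reductionE I0) -[RHS](raddf0 (\pi_red)%qT); congr (\pi_red _)%qT.
exact/val_inj.
Qed.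

Lemma reduction_surj_fun (s : red) : exists2 f, f \in integral_fun (Y:=Y) & s = reduction f.
Proof.
have [f ->] := reduction_surj s; exists (val f); first exact: valP.
by rewrite (reductionE (valP f)); congr (\pi_red _)%qT; apply/val_inj.
Qed.

Lemma reduction_evE f Q : f \in integral_fun (Y:=Y) ->
  reduction_ev Q (reduction f) = vres v (f Q).
Proof.
move=> fI; rewrite /reduction_ev; set g := repr _.
have gE : reduction (val g) = reduction f.
  rewrite (reductionE (valP g)) -[RHS]reprK -/g; congr (\pi_red _)%qT.
  exact/val_inj.
have [e e0 eQ] := (reduction_eqP (valP g) fI).1 gE.
apply/eqP; rewrite vres_sub ?integral_vring ?(valP g) //.
exact: bounded_vsmall (eQ Q).
Qed.

Lemma const_integral c : c \in vring v -> (fun _ : pts => c) \in integral_fun (Y:=Y).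
Proof. by move=> cr; apply: integralP => //; apply: rigid_const. Qed.

Lemma reduction_constE c : c \in vring v ->
  reduction_const r Y (vres v c) = reduction (fun _ => c).
Proof.
move=> cr; rewrite /reduction_const.
set d := val _; have dr : d \in vring v by apply: valP.
apply/reduction_eqP; [exact: const_integral|exact: const_integral|].
have /vsmall_bound[e e0 ed] : d - c \in vsmall v.
  rewrite -vres_sub //; apply/eqP; rewrite /d vres_valE reprK.
  by [].
by exists e.
Qed.

Lemma meval_map_mpoly (S T : comNzRingType) (f : {rmorphism S -> T}) d
    (h : 'I_d -> S) (p : {mpoly S[d]}) :
  (map_mpoly f p).@[fun i => f (h i)] = f p.@[h].
Proof.
rewrite [p.@[h]]mevalE [RHS]rmorph_sum {1}[p]mpolyE.
rewrite (raddf_sum (map_mpoly f)) (raddf_sum (meval _)); apply: eq_bigr => m _ /=.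
rewrite map_mpolyZ map_mpolyX mevalZ rmorphM mevalX rmorph_prod.
by congr (_ * _); apply: eq_bigr => i _; rewrite rmorphXn.
Qed.

Section VintFunctions.
Variables (d : nat) (g : 'I_d -> pts -> vint v).
Hypothesis g_rigid : forall i, rigid (fun Q => val (g i Q)).

Lemma meval_vint_rigid (p : {mpoly (vint v)[d]}) :
  rigid (fun Q => val (p.@[g^~ Q])).
Proof.
apply: eq_rigid (rigid_meval (map_mpoly val p) g_rigid) => Q.
exact: meval_map_mpoly.
Qed.

Lemma vint_integral (f : pts -> vint v) : rigid (fun Q => val (f Q)) ->
  (fun Q => val (f Q)) \in integral_fun (Y:=Y).
Proof. by move=> rf; apply: integralP => // Q; apply: valP. Qed.

Let I (f : pts -> vint v) : pts -> K := fun Q => val (f Q).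

Lemma reduction_sum (J : Type) (s : seq J) (F : J -> pts -> vint v) :
  (forall j, rigid (I (F j))) ->
  reduction (I (fun Q => \sum_(j <- s) F j Q)) = \sum_(j <- s) reduction (I (F j)).
Proof.
move=> rF; have rFs t : rigid (I (fun Q => \sum_(j <- t) F j Q)).
  by apply: eq_rigid (rigid_sum t rF) => Q; rewrite /I rmorph_sum.
elim: s => [|j s IHs].
  by rewrite big_nil -reduction0; congr reduction; apply/funext => Q; rewrite /I big_nil.
rewrite big_cons -IHs -reductionD.
- by congr reduction; apply/funext => Q; rewrite /I big_cons rmorphD.
- exact: vint_integral (rF j).
- exact: vint_integral (rFs s).
Qed.

Lemma reduction_prod (s : seq 'I_d) (m : 'I_d -> nat) :
  reduction (I (fun Q => \prod_(i <- s) g i Q ^+ m i)) =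
  \prod_(i <- s) reduction (I (g i)) ^+ m i.
Proof.
have rX i k : rigid (I (fun Q => g i Q ^+ k)).
  by apply: eq_rigid (rigid_exp k (g_rigid i)) => Q; rewrite /I rmorphXn.
have rP t : rigid (I (fun Q => \prod_(i <- t) g i Q ^+ m i)).
  by apply: eq_rigid (rigid_prod t (fun i => rX i (m i))) => Q; rewrite /I rmorph_prod.
have redX i k : reduction (I (fun Q => g i Q ^+ k)) = reduction (I (g i)) ^+ k.
  elim: k => [|k IHk].
    by rewrite [RHS]expr0 -reduction1; congr reduction; apply/funext => Q; rewrite /I expr0.
  rewrite exprS -IHk -reductionM.
  - by congr reduction; apply/funext => Q; rewrite /I exprS rmorphM.
  - exact: vint_integral (g_rigid i).
  - exact: vint_integral (rX i k).
elim: s => [|i s IHs].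
  by rewrite big_nil -reduction1; congr reduction; apply/funext => Q; rewrite /I big_nil.
rewrite big_cons -IHs -redX -reductionM.
- by congr reduction; apply/funext => Q; rewrite /I big_cons rmorphM.
- exact: vint_integral (rX i (m i)).
- exact: vint_integral (rP s).
Qed.

(** Reducing the coefficients of a polynomial commutes with evaluating it at integral
    rigid functions. This replaces computations in the reduction by computations
    with functions valued in the valuation ring. *)
Lemma reduction_hornerE (p : {mpoly (vint v)[d]}) :
  reduction_horner (fun i => reduction (I (g i))) (map_mpoly (@vbar _ _ v) p)
  = reduction (I (fun Q => p.@[g^~ Q])).
Proof.
pose G m := reduction_const r Y (vbar p@_m) * \prod_i reduction (I (g i)) ^+ m i.
have const0 : reduction_const r Y 0 = 0 :> red.
  by rewrite -(vres_small (rpred0 (vsmall v))) reduction_constE ?rpred0 // reduction0.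
have rT m : rigid (I (fun Q => \prod_i g i Q ^+ m i)).
  apply: eq_rigid (rigid_prod _ (fun i => rigid_exp (m i) (g_rigid i))) => Q.
  by rewrite /I rmorph_prod; apply: eq_bigr => i _; rewrite rmorphXn.
transitivity (\sum_(m <- msupp p) G m).
  rewrite /reduction_horner; set pb := map_mpoly _ _.
  have sub m : m \in msupp pb -> m \in msupp p.
    rewrite !mcoeff_msupp mcoeff_map_mpoly; apply: contraNneq => p0.
    by rewrite p0 vbar_eq0 rpred0.
  rewrite [RHS](bigID (fun m => m \in msupp pb)) /= [X in _ + X]big1 ?addr0.
    rewrite -[RHS]big_filter [RHS](perm_big (msupp pb)) /=.
      by apply: eq_bigr => m _; rewrite mcoeff_map_mpoly.
    apply: uniq_perm; rewrite ?filter_uniq ?msupp_uniq // => m.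
    by rewrite mem_filter andb_idr //; apply: sub.
  move=> m; rewrite mcoeff_msupp negbK mcoeff_map_mpoly => /eqP m0.
  by rewrite /G m0 const0 mul0r.
transitivity (reduction (I (fun Q => \sum_(m <- msupp p) p@_m * \prod_i g i Q ^+ m i))).
  rewrite reduction_sum => [|m].
    apply: eq_bigr => m _; rewrite /G /vbar reduction_constE ?(valP p@_m) //.
    rewrite -reduction_prod -reductionM; first last.
    - exact: vint_integral (rT m).
    - exact: const_integral (valP _).
    by congr reduction; apply/funext => Q; rewrite /I rmorphM.
  apply: eq_rigid (rigid_mul (rigid_const (val p@_m)) (rT m)) => Q.
  by rewrite /I rmorphM.
by congr reduction; apply/funext => Q; rewrite /I mevalE.
Qed.

End VintFunctions.
End AffinoidTheory.

(** * The action of a semilinear automorphism on the reduction *)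

Section SemilinearAction.
Variables (R : realType) (K : fieldType) (v : valuation R K).
Variables (n : nat) (r : 'I_n -> R) (Y : ('I_n -> K) -> Prop).
Local Notation pts := (affinoid_point v r Y).
Local Notation red := (reduction_ring v r Y).
Variables (sigma : {rmorphism K -> K}) (T : pts -> pts).
Hypothesis sigma_v : forall x, v (sigma x) = v x.
Hypothesis TE : forall (Q : pts) i, sigma (T Q i) = Q i.
Hypothesis sigma_res : forall x, x \in vring v -> sigma x - x \in vsmall v.
Implicit Types (f g : pts -> K) (Q : pts).

(** The composite f o sigma^-1 is not analytic; applying sigma to its values
    restores this and does not change them modulo the maximal ideal, because sigma
    acts trivially on the residue field. *)
Definition semilinear_conj f : pts -> K := fun Q => sigma (f (T Q)).

Lemma sigma_meval (p : {mpoly K[n]}) Q : sigma p.@[T Q] = (map_mpoly sigma p).@[Q].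
Proof.
apply: etrans (esym (meval_map_mpoly sigma (T Q) p)) _.
by apply: meval_eq => i; apply: TE.
Qed.

Lemma rigid_conj f : rigid f -> rigid (semilinear_conj f).
Proof.
move=> [b sb bf]; exists (fun m => sigma (b m)) => [M|Q M].
  by have [N bN] := sb M; exists N => m Nm; rewrite sigma_v; apply: bN.
have [N bN] := bf (T Q) M; exists N => k Nk.
suff -> : partial_sum (fun m => sigma (b m)) k = map_mpoly sigma (partial_sum b k).
  by rewrite -sigma_meval /semilinear_conj -rmorphB sigma_v; apply: bN.
apply/mpolyP => m; rewrite mcoeff_map_mpoly !mcoeff_partial_sum.
by case: ifP => // _; apply/esym/(rmorph0 sigma).
Qed.

Lemma sigma_vring x : (sigma x \in vring v) = (x \in vring v).
Proof. by rewrite !vringE sigma_v. Qed.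

Lemma integral_conj f : f \in integral_fun (Y:=Y) ->
  semilinear_conj f \in integral_fun (Y:=Y).
Proof.
move=> fI; apply: integralP; first by apply: rigid_conj; have /asboolP[] := fI.
by move=> Q; rewrite sigma_vring; apply: integral_vring.
Qed.

Definition conj_reduction (s : red) : red := reduction (semilinear_conj (val (repr s))).

Lemma conj_reductionE f : f \in integral_fun (Y:=Y) ->
  conj_reduction (reduction f) = reduction (semilinear_conj f).
Proof.
move=> fI; rewrite /conj_reduction; set g := repr _.
have gI : val g \in integral_fun (Y:=Y) := valP g.
have gE : reduction (val g) = reduction f.
  rewrite (reductionE gI) -[RHS]reprK -/g; congr (\pi_red _)%qT.
  exact/val_inj.
have [e e0 eQ] := (reduction_eqP gI fI).1 gE.
apply/(reduction_eqP (integral_conj gI) (integral_conj fI)).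
by exists e => // Q; rewrite -rmorphB sigma_v.
Qed.

Lemma conj_reduction_add : {morph conj_reduction : s t / s + t}.
Proof.
move=> s t; have [[f fI ->] [g gI ->]] := (reduction_surj_fun s, reduction_surj_fun t).
rewrite -reductionD // !conj_reductionE ?rpredD // -reductionD ?integral_conj //.
by congr reduction; apply/funext => Q; apply: rmorphD.
Qed.

Lemma conj_reduction_zmod_morphism : zmod_morphism conj_reduction.
Proof.
by move=> s t; apply/eqP; rewrite eq_sym subr_eq -conj_reduction_add subrK.
Qed.

Lemma conj_reduction_monoid_morphism : monoid_morphism conj_reduction.
Proof.
split=> [|s t].
  rewrite -reduction1 conj_reductionE ?rpred1 //.
  by congr reduction; apply/funext => Q; apply: rmorph1.
have [[f fI ->] [g gI ->]] := (reduction_surj_fun s, reduction_surj_fun t).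
rewrite -reductionM // !conj_reductionE ?rpredM // -reductionM ?integral_conj //.
by congr reduction; apply/funext => Q; apply: rmorphM.
Qed.

HB.instance Definition _ :=
  GRing.isZmodMorphism.Build red red conj_reduction conj_reduction_zmod_morphism.
HB.instance Definition _ :=
  GRing.isMonoidMorphism.Build red red conj_reduction conj_reduction_monoid_morphism.

Definition conj_rmorphism : {rmorphism red -> red} := conj_reduction.

Lemma conj_rmorphismE f : f \in integral_fun (Y:=Y) ->
  conj_rmorphism (reduction f) = reduction (semilinear_conj f).
Proof. exact: conj_reductionE. Qed.

Lemma conj_reduction_action : reduction_action sigma conj_rmorphism.
Proof.
split=> [c|Q].
  have [d dr ->] := vresP c; rewrite -[LHS]/(conj_reduction _).
  rewrite reduction_constE // conj_reductionE; last exact: const_integral.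
  have dI : (fun _ : pts => d) \in integral_fun (Y:=Y) by apply: const_integral.
  apply/(reduction_eqP (integral_conj dI) dI).
  by have [e e0 ed] := vsmall_bound (sigma_res dr); exists e.
exists (T Q) => // s; have [f fI ->] := reduction_surj_fun s.
rewrite -[LHS]/(reduction_ev Q (conj_reduction (reduction f))) conj_reductionE //.
rewrite !reduction_evE ?integral_conj //; apply/eqP.
have fr : f (T Q) \in vring v by apply: integral_vring.
by rewrite vres_sub ?sigma_vring // sigma_res.
Qed.

End SemilinearAction.

(** * Approximation by normal forms *)

Section NormalFormLinear.
Variables (S : comNzRingType) (q : nat).
Implicit Types c d : nf_index q -> {poly S}.

Lemma nf_evalD s x y W c d :
  nf_eval idfun s x y W (fun t => c t + d t) =
  nf_eval idfun s x y W c + nf_eval idfun s x y W d.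
Proof.
rewrite -big_split; apply: eq_bigr => t _ /=.
by rewrite rmorphD hornerD !mulrDl.
Qed.

Lemma nf_evalZ b s x y W c :
  nf_eval idfun s x y W (fun t => b *: c t) = b * nf_eval idfun s x y W c.
Proof.
rewrite mulr_sumr; apply: eq_bigr => t _.
by rewrite !map_poly_id // hornerZ !mulrA.
Qed.

End NormalFormLinear.

Section Generated.
Variables (T : Type) (S : comNzRingType) (d : nat) (g : 'I_d -> T -> S) (c0 : S).

Inductive generated : (T -> S) -> Prop :=
| generated_const c : generated (fun _ => c)
| generated_gen i : generated (g i)
| generated_add f h : generated f -> generated h -> generated (fun t => f t + h t)
| generated_mul f h : generated f -> generated h -> generated (fun t => f t * h t)
| generated_ext f h : f =1 h -> generated f -> generated h.

Lemma generated_sub f h : generated f -> generated h -> generated (fun t => f t - h t).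
Proof.
move=> fg hg; apply: (@generated_ext (fun t => f t + (-1) * h t)).
  by move=> t; rewrite mulN1r.
by apply/generated_add/generated_mul => //; apply: generated_const.
Qed.

Lemma generated_exp f k : generated f -> generated (fun t => f t ^+ k).
Proof.
move=> fg; elim: k => [|k IHk]; first exact: generated_const.
by apply: generated_ext (fun t => esym (exprS _ _)) _; apply: generated_mul.
Qed.

Lemma generated_moore k f h : generated f -> generated h ->
  generated (fun t => moore k (f t) (h t)).
Proof.
by move=> fg hg; apply: generated_sub; apply: generated_mul => //;
  apply: generated_exp.
Qed.

Lemma generated_meval k (F : 'I_k -> T -> S) (p : {mpoly S[k]}) :
  (forall i, generated (F i)) -> generated (fun t => p.@[F^~ t]).
Proof.
move=> Fg; have gsum (I : Type) (s : seq I) (G : I -> T -> S) :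
    (forall i, generated (G i)) -> generated (fun t => \sum_(i <- s) G i t).
  move=> Gg; elim: s => [|i s IHs].
    by apply: generated_ext (generated_const 0) => t; rewrite big_nil.
  by apply: generated_ext (generated_add (Gg i) IHs) => t; rewrite big_cons.
have gprod (I : Type) (s : seq I) (G : I -> T -> S) :
    (forall i, generated (G i)) -> generated (fun t => \prod_(i <- s) G i t).
  move=> Gg; elim: s => [|i s IHs].
    by apply: generated_ext (generated_const 1) => t; rewrite big_nil.
  by apply: generated_ext (generated_mul (Gg i) IHs) => t; rewrite big_cons.
apply: generated_ext (fun t => esym (mevalE _ _)) _.
apply: (gsum) => m; apply: generated_mul; first exact: generated_const.
by apply: (gprod) => i; apply: generated_exp.
Qed.

(** The quotient by c0 has to lie in the subalgebra itself, for the approximation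
    below to be iterated. *)
Definition congruent f h := exists2 e, generated e & forall t, f t = h t + c0 * e t.

Lemma congruent_refl f h : f =1 h -> congruent f h.
Proof.
move=> fh; exists (fun _ => 0) => [|t]; first exact: generated_const.
by rewrite mulr0 addr0 fh.
Qed.

Lemma congruent_sub f f' h h' : congruent f h -> congruent f' h' ->
  congruent (fun t => f t - f' t) (fun t => h t - h' t).
Proof.
move=> [e eg fE] [e' eg' fE']; exists (fun t => e t - e' t) => [|t].
  exact: generated_sub.
by rewrite fE fE'; ring.
Qed.

Lemma congruent_mul f f' h h' : generated h -> generated h' ->
  congruent f h -> congruent f' h' ->
  congruent (fun t => f t * f' t) (fun t => h t * h' t).
Proof.
move=> hg hg' [e eg fE] [e' eg' fE'].
exists (fun t => h t * e' t + (e t * h' t + c0 * (e t * e' t))) => [|t].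
  apply: generated_add; first exact: generated_mul.
  apply: generated_add; first exact: generated_mul.
  by apply: generated_mul; [apply: generated_const|apply: generated_mul].
by rewrite fE fE'; ring.
Qed.

Lemma congruent_exp f h k : generated h -> congruent f h ->
  congruent (fun t => f t ^+ k) (fun t => h t ^+ k).
Proof.
move=> hg fh; elim: k => [|k IHk]; first exact: congruent_refl.
have [e eg eE] := congruent_mul hg (generated_exp k hg) fh IHk.
by exists e => // t; rewrite !exprS eE.
Qed.

Lemma congruent_moore k f f' h h' : generated h -> generated h' ->
  congruent f h -> congruent f' h' ->
  congruent (fun t => moore k (f t) (f' t)) (fun t => moore k (h t) (h' t)).
Proof.
by move=> hg hg' fh fh'; apply: congruent_sub; apply: congruent_mul => //;
  (exact: generated_exp || exact: congruent_exp).
Qed.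

End Generated.

(** * Reduction of the affinoid *)

(** The polynomial already splits over the algebraically closed subfield. *)
Lemma closed_subfield_root (L : closedFieldType) (C : fieldType)
    (j : {rmorphism L -> C}) (f : {poly L}) z :
  f \is monic -> (map_poly j f).[z] = 0 -> exists y, j y = z.
Proof.
move=> f1; have [rs ->] := closed_field_poly_normal f.
rewrite (monicP f1) scale1r rmorph_prod horner_prod => /eqP.
rewrite prodf_seq_eq0 => /hasP[y _].
by rewrite rmorphB /= map_polyX map_polyC hornerXsubC subr_eq0 => /eqP ->; exists y.
Qed.

Section Main.
Variables (R : realType) (p q : nat).
Variables (F : fieldType) (Fbar : closedFieldType) (C : fieldType).
Variables (iota : {rmorphism F -> Fbar}) (jota : {rmorphism Fbar -> C}).
Variables (v : valuation R C) (pi : F).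
Hypothesis local_F : local_field p q (valuation_pull (jota \o iota) v) pi.
Hypothesis completion_C : completed_closure v iota jota.
Local Notation P := (jota (iota pi)).
Variable (pi2 : C).
Hypothesis pi2_gen : LT_generator2 q P pi2.
Variable (a : C).
Hypothesis aE : a ^+ (q ^ 2 * (q + 1)) = pi2.

Local Notation gamma := (gamma q a).
Local Notation p' := (unit_part q P a).
Local Notation pts := (Y22_point v q P pi2).
Local Notation red := (reduction_ring v (Y22_radius R q) (Y22_set v q P pi2)).
Local Notation k := (residue v).

Let q_gt1 : (1 < q)%N.
Proof. by have [] := local_field_residue local_F. Qed.

Let q_char : [pchar C].-nat q := pchar_nat_C local_F.
Let q_char_res : [pchar k].-nat q := pchar_nat_residue local_F.

Let q_char_vint : [pchar (vint v)].-nat q := pchar_nat_vint local_F.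

Let vP : v P = 1%:E.
Proof. by case: local_F. Qed.

Let dense := let: And3 _ dense _ := completion_C in dense.

Let a0 : a != 0 := parameter_neq0 q_gt1 pi2_gen aE.
Let a_small : a \in vsmall v := parameter_small q_gt1 vP pi2_gen aE.
Let p'_res : p' - 1 \in vsmall v := unit_part_res q_char q_gt1 q_char_res vP pi2_gen aE.

Let gamma_small : gamma \in vsmall v.
Proof. by rewrite vsmallX // muln_gt0 -mulnn; apply/andP; split; nia. Qed.

Let gamma0 : gamma != 0.
Proof. by rewrite expf_neq0. Qed.

(** [pi](pi2), then pi2, then a are roots of polynomials over Fbar, which splits them
    in Fbar. Thus all equations to be solved have coefficients in Fbar. *)
Lemma parameter_algebraic : exists aL, jota aL = a.
Proof.
have monic_trinomial (b c : Fbar) n : (1 < n)%N -> 'X^n - (b *: 'X + c%:P) \is monic.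
  move=> n1; rewrite monicE lead_coefDl ?lead_coefXn // size_polyXn size_polyN ltnS.
  apply: leq_trans (size_polyD _ _) _; rewrite geq_max; apply/andP; split.
    by apply: leq_trans (size_scale_leq _ _) _; rewrite size_polyX.
  by apply: leq_trans (size_polyC_leq1 _) _; apply: ltnW.
have root_ (b c : Fbar) n z : (1 < n)%N -> z ^+ n = jota b * z + jota c ->
    exists y, jota y = z.
  move=> n1 zE; apply: closed_subfield_root (monic_trinomial b c n n1) _.
  rewrite rmorphB rmorphD /= map_polyXn linearZ /= map_polyX map_polyC.
  by rewrite !hornerE zE subrr.
have [rho0 _] := pi2_gen.
have [rL rE] : exists y, jota y = pi_mult_LT q P pi2.
  apply: (root_ (iota pi) 0 q) => //; rewrite rmorph0 addr0.
  by apply/eqP; rewrite eq_sym -subr_eq0; apply/eqP.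
have [pL pE] : exists y, jota y = pi2.
  apply: (root_ (iota pi) (- rL) q) => //.
  by rewrite rmorphN rE /pi_mult_LT; ring.
apply: (root_ 0 pL (q ^ 2 * (q + 1))%N); first by rewrite -mulnn; nia.
by rewrite rmorph0 mul0r add0r pE.
Qed.

Let Ucoord (Q : pts) : C := Q 0 / a ^+ (q ^ 4 * (q - 1)).
Let xcoord (Q : pts) : C := Q 1 / a ^+ q.
Let ycoord (Q : pts) : C := Q 2 / a ^+ q.

Let coord_scaled (Q : pts) :
  scaled_point v q p' gamma (Ucoord Q) (xcoord Q) (ycoord Q).
Proof.
apply/(Y22_scaled q_char q_gt1 vP pi2_gen aE).
exact: affinoid_pointP.
Qed.

Let coord_integral (Q : pts) : [/\ Ucoord Q \in vring v, xcoord Q \in vring v,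
  ycoord Q \in vring v & scaled_Z q gamma (xcoord Q) (ycoord Q) \in vring v] :=
  scaled_point_integral q_char q_gt1 p'_res gamma_small gamma0 (coord_scaled Q).

Definition Uh (Q : pts) : vint v := VInt (let: And4 h _ _ _ := coord_integral Q in h).
Definition xh (Q : pts) : vint v := VInt (let: And4 _ h _ _ := coord_integral Q in h).
Definition yh (Q : pts) : vint v := VInt (let: And4 _ _ h _ := coord_integral Q in h).
Definition Zh (Q : pts) : vint v := VInt (let: And4 _ _ _ h := coord_integral Q in h).

Let gv : vint v := VInt (vsmallW gamma_small).
Let pv : vint v := VInt (unit_vring p'_res).

Lemma xh_rigid : rigid (fun Q => val (xh Q)).
Proof. by apply: rigid_mul; [apply: rigid_coord|apply: rigid_const]. Qed.

Lemma yh_rigid : rigid (fun Q => val (yh Q)).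
Proof. by apply: rigid_mul; [apply: rigid_coord|apply: rigid_const]. Qed.

Lemma Zh_rigid : rigid (fun Q => val (Zh Q)).
Proof.
apply: rigid_mul; last exact: rigid_const.
apply: rigid_sub; last exact: rigid_const.
by apply: rigid_sub; apply: rigid_mul; rewrite ?expr1;
  repeat (exact: xh_rigid || exact: yh_rigid || apply: rigid_exp).
Qed.

Lemma d_eq Q : moore q (xh Q) (yh Q) = 1 + gv * Zh Q.
Proof.
apply/val_inj; rewrite moore_morph rmorphD rmorph1 rmorphM /= /scaled_Z.
by rewrite mulrC divfK // addrC subrK.
Qed.

Definition Z_error Q : vint v :=
  pv * gv ^+ (q ^ 2).-1 * (1 + pv ^+ q.-1 * gv ^+ (q ^ 3)) * moore q (xh Q) (yh Q) +
  Uh Q ^+ q * gv ^+ (q ^ 3).-1 * moore (q ^ 2) (xh Q) (yh Q).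

Let q0 n : (0 < q ^ n)%N.
Proof. by rewrite expn_gt0 ltnW. Qed.

Lemma Z_eq Q : Zh Q ^+ q = moore (q ^ 3) (xh Q) (yh Q) + gv * Z_error Q.
Proof.
have gX n : gv ^+ (q ^ n) = gv * gv ^+ (q ^ n).-1 by rewrite -exprS prednK.
apply/val_inj; transitivity (scaled_Z q gamma (xcoord Q) (ycoord Q) ^+ q).
  by rewrite rmorphXn.
rewrite (scaled_Z_eq q_char gamma0 (coord_scaled Q)) rmorphD moore_morph.
congr (_ + _); rewrite /Z_error mulrDr.
rewrite (_ : gv * _ = pv * (gv * gv ^+ (q ^ 2).-1) * (1 + pv ^+ q.-1 * gv ^+ (q ^ 3)) *
  moore q (xh Q) (yh Q)); last by ring.
rewrite (_ : gv * (Uh Q ^+ q * _ * _) =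
   Uh Q ^+ q * (gv * gv ^+ (q ^ 3).-1) * moore (q ^ 2) (xh Q) (yh Q)); last by ring.
rewrite -!gX /scaled_error /moore.
by rewrite !(rmorphD, rmorphN, rmorphM, rmorphXn, rmorph1).
Qed.

Definition scaled_pi_fun (z : pts -> vint v) Q : vint v :=
  z Q ^+ (q ^ 2) + gv ^+ (q ^ 2) * Uh Q * z Q ^+ q + pv * gv ^+ (q * (q + 1)) * z Q.

Lemma U_eq Q : Uh Q * moore q (scaled_pi_fun xh Q) (scaled_pi_fun yh Q) =
  - moore (q ^ 2) (scaled_pi_fun xh Q) (scaled_pi_fun yh Q).
Proof.
have E z : val (scaled_pi_fun z Q) = scaled_pi q p' gamma (Ucoord Q) (val (z Q)).
  by rewrite !(rmorphD, rmorphM, rmorphXn).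
apply/val_inj.
transitivity (Ucoord Q * moore q (val (scaled_pi_fun xh Q)) (val (scaled_pi_fun yh Q))).
  by rewrite rmorphM moore_morph.
transitivity (- moore (q ^ 2) (val (scaled_pi_fun xh Q)) (val (scaled_pi_fun yh Q))).
  by rewrite !E; apply: scaled_U_eq (coord_scaled Q).
by rewrite rmorphN moore_morph.
Qed.

Lemma vbar_gv b e : vbar (b + gv * e) = vbar b.
Proof.
apply/eqP; rewrite /vbar vres_sub ?(valP b) ?(valP (b + gv * e)) //.
rewrite -rmorphB addrC addKr rmorphM; apply: vsmallMr; last exact: valP.
exact: gamma_small.
Qed.

(** z is determined by x and y, since Frobenius is injective on the residue field. *)
Lemma reduction_points_surj (x y z : k) :
  moore q x y = 1 -> z ^+ q = moore (q ^ 3) x y ->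
  exists Q, [/\ vbar (xh Q) = x, vbar (yh Q) = y & vbar (Zh Q) = z].
Proof.
move=> d1 zE; have [aL aLE] := parameter_algebraic.
have aE' : jota aL ^+ (q ^ 2 * (q + 1)) = pi2 by rewrite aLE.
have [Q0 Q0Y] := lift_point dense q_char q_gt1 q_char_res vP pi2_gen aE' d1.
rewrite aLE => -[xE yE].
have vP0 : (0 <= v P)%E by rewrite vP lee_fin.
have Q0r := Y22_polydisc q_gt1 vP0 Q0Y.
pose Q : pts := AffinoidPoint Q0Y Q0r.
have xhE : vbar (xh Q) = x by [].
have yhE : vbar (yh Q) = y by [].
exists Q; split=> //; apply: (exprq_inj q_char_res) => /=.
transitivity (vbar (Zh Q ^+ q)); first by rewrite rmorphXn.
rewrite Z_eq vbar_gv zE -xhE -yhE; exact: moore_morph.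
Qed.

Let gens : 'I_4 -> pts -> vint v := tnth [tuple Uh; xh; yh; Zh].
Local Notation gen := (generated gens).
Local Notation cong := (congruent gens gv).

Let gen_U : gen Uh.
Proof. exact: (generated_gen gens 0). Qed.
Let gen_x : gen xh.
Proof. exact: (generated_gen gens 1). Qed.
Let gen_y : gen yh.
Proof. exact: (generated_gen gens 2). Qed.
Let gen_Z : gen Zh.
Proof. exact: (generated_gen gens 3). Qed.

Let sh Q := moore (q ^ 2) (xh Q) (yh Q).

Lemma cong_scaled_pi z : gen z -> cong (scaled_pi_fun z) (fun Q => z Q ^+ (q ^ 2)).
Proof.
move=> gz; have gc := generated_const gens.
exists (fun Q => gv ^+ (q ^ 2).-1 * (Uh Q * z Q ^+ q) +
    pv * gv ^+ (q * (q + 1)).-1 * z Q) => [|Q].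
  apply: generated_add; last exact: generated_mul.
  by apply: generated_mul => //; apply: generated_mul => //; apply: generated_exp.
have gX n : (0 < n)%N -> gv ^+ n = gv * gv ^+ n.-1 by move=> n0; rewrite -exprS prednK.
rewrite /scaled_pi_fun gX // (gX (q * (q + 1))%N); last by rewrite muln_gt0 addn1 ltnW.
by ring.
Qed.

Lemma cong_d : cong (fun Q => moore q (xh Q) (yh Q)) (fun _ => 1).
Proof. by exists Zh => // Q; rewrite d_eq. Qed.

(** From scaled_U_eq, where modulo gamma the arguments of moore are x^(q^2) and
    y^(q^2). *)
Lemma cong_U : cong Uh (fun Q => - sh Q ^+ (q ^ 2)).
Proof.
have gxX := generated_exp (q ^ 2) gen_x; have gyX := generated_exp (q ^ 2) gen_y.
have q_charX : [pchar (vint v)].-nat (q ^ 2)%N by rewrite pnatX q_char_vint.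
have [f gf fE] := congruent_moore q gxX gyX (cong_scaled_pi gen_x) (cong_scaled_pi gen_y).
have [h gh hE] := congruent_moore (q ^ 2) gxX gyX (cong_scaled_pi gen_x) (cong_scaled_pi gen_y).
have [g gg gE] := congruent_exp (q ^ 2) (generated_const gens 1) cong_d.
exists (fun Q => - (h Q + Uh Q * (f Q + g Q))) => [|Q].
  apply: generated_ext (fun Q => sub0r _) _; apply: generated_sub.
    exact: generated_const.
  by apply: generated_add => //; apply: generated_mul => //; apply: generated_add.
have := U_eq Q; rewrite fE hE -!mooreXq // gE expr1n => UE.
rewrite [LHS](_ : _ =
  Uh Q * (1 + gv * g Q + gv * f Q) - Uh Q * gv * (f Q + g Q)); last by ring.
by rewrite UE /sh; ring.
Qed.

Lemma gen_Z_error : gen Z_error.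
Proof.
have gc := generated_const gens.
apply: generated_add; apply: generated_mul; try exact: generated_moore.
  by apply: generated_mul; [apply: generated_mul|apply: generated_add].
by apply: generated_mul => //; apply: generated_exp.
Qed.

Lemma gen_polynomial (G : {mpoly (vint v)[3]}) :
  gen (fun Q => G.@[point3 (xh Q) (yh Q) (Zh Q)]).
Proof.
apply: generated_meval => -[[|[|[|//]]] i3].
- exact: generated_ext gen_x.
- exact: generated_ext gen_y.
- exact: generated_ext gen_Z.
Qed.

(** By cong_U, the generator U can be traded for a polynomial in x and y. *)
Lemma approx_polynomial f : gen f -> exists G : {mpoly (vint v)[3]},
  cong f (fun Q => G.@[point3 (xh Q) (yh Q) (Zh Q)]).
Proof.
elim => [c|i|f1 f2 _ [G1 cG1] _ [G2 cG2]|f1 f2 _ [G1 cG1] _ [G2 cG2]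
       |f1 f2 f12 _ [G [e ge eE]]].
- by exists c%:MP_[3]; apply: congruent_refl => Q; rewrite mevalC.
- case: i => -[|[|[|[|//]]]] i4.
  + exists (- moore (q ^ 2) 'X_0 'X_1 ^+ (q ^ 2)); have [e ge eE] := cong_U.
    exists e => // Q; rewrite mevalN rmorphXn moore_morph /= mevalX0 mevalX1.
    exact: eE.
  + by exists 'X_0; apply: congruent_refl => Q; rewrite mevalX0.
  + by exists 'X_1; apply: congruent_refl => Q; rewrite mevalX1.
  + by exists 'X_2; apply: congruent_refl => Q; rewrite mevalX2.
- exists (G1 + G2); case: cG1 cG2 => [e1 ge1 eE1] [e2 ge2 eE2].
  exists (fun Q => e1 Q + e2 Q) => [|Q]; first exact: generated_add.
  by rewrite eE1 eE2 mevalD; ring.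
- exists (G1 * G2); have [e ge eE] := congruent_mul (gen_polynomial G1) (gen_polynomial G2) cG1 cG2.
  by exists e => // Q; rewrite eE mevalM.
- by exists G, e => // Q; rewrite -f12 eE.
Qed.

Local Notation nf c Q :=
  (nf_eval idfun (moore (q ^ 2) (xh Q) (yh Q)) (xh Q) (yh Q) (Zh Q + 1) c).

(** By approx_polynomial and mpoly_normal_form, as d = 1 and Z^q = t modulo gamma. *)
Lemma approx_normal_form f : gen f ->
  exists c : nf_index q -> {poly (vint v)}, cong f (fun Q => nf c Q).
Proof.
case/approx_polynomial => G [e ge eE].
have [c [A [B GE]]] := mpoly_normal_form q_char_vint q_gt1 G.
pose ev (H : {mpoly (vint v)[3]}) Q := H.@[point3 (xh Q) (yh Q) (Zh Q)].
exists c, (fun Q => ev A Q * Zh Q + (ev B Q * Z_error Q + e Q)) => [|Q].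
  apply: generated_add; first by apply: generated_mul => //; apply: gen_polynomial.
  apply: generated_add => //; apply: generated_mul; first exact: gen_polynomial.
  exact: gen_Z_error.
rewrite eE GE 2!mevalD (mevalM _ A) (mevalM _ B) meval_rel1 meval_rel2.
rewrite meval_normal_form d_eq Z_eq -/(ev A Q) -/(ev B Q); ring.
Qed.

Lemma approx_normal_form_iter f K : gen f ->
  exists (c : nf_index q -> {poly (vint v)}) e,
    gen e /\ forall Q, f Q = nf c Q + gv ^+ K * e Q.
Proof.
move=> gf; elim: K => [|K [c [e [ge eE]]]].
  exists (fun _ => 0), f; split=> // Q; rewrite mul1r.
  by rewrite [nf_eval _ _ _ _ _ _]big1 ?add0r // => t _; rewrite rmorph0 horner0 !mul0r.
have [c' [e' ge' eE']] := approx_normal_form ge.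
exists (fun t => c t + gv ^+ K *: c' t), e'; split=> // Q.
by rewrite nf_evalD nf_evalZ eE eE' exprS; ring.
Qed.

(** The reduction of the normal form vanishes at every point of the reduced curve. *)
Lemma normal_form_small (c : nf_index q -> {poly (vint v)}) :
  (forall Q, val (nf c Q) \in vsmall v) -> forall t, map_poly (@vbar _ _ v) (c t) = 0.
Proof.
move=> c0; have k_closed := residue_closed dense.
apply: (normal_form_eq0 k_closed q_char_res q_gt1) => x y z d1 zE.
have [Q [xE yE ZE]] := reduction_points_surj d1 zE.
have := c0 Q; rewrite -vbar_eq0 => /eqP <-.
rewrite -nf_eval_map [RHS]nf_eval_morph moore_morph rmorphD rmorph1.
rewrite -xE -yE -ZE; apply: eq_bigr => t _; congr (_.[_] * _ * _ * _).
Qed.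

(** The normal forms are an orthonormal family for the supremum norm: dividing by a
    coefficient of least valuation gives a normal form with a coefficient 1, which
    would be small everywhere if the bound failed. *)
Lemma normal_form_orthonormal (c : nf_index q -> {poly (vint v)}) (b : C) : b != 0 ->
  (forall Q, val (nf c Q) / b \in vring v) ->
  forall t i, val (c t)`_i / b \in vring v.
Proof.
move=> b0 cb t0 i0; apply: contraT => c0b.
pose s := flatten [seq polyseq (c t) | t <- enum (nf_index q)].
have mem_s t i : (i < size (c t))%N -> (c t)`_i \in s.
  move=> it; apply/flattenP; exists (polyseq (c t)); last exact: mem_nth.
  by apply/mapP; exists t; rewrite ?mem_enum.
have i0t : (i0 < size (c t0))%N.
  rewrite ltnNge; apply: contra c0b => it; rewrite nth_default //.
  by rewrite rmorph0 mul0r rpred0.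
have [m ms mP] := seq_argmin (fun z : vint v => v (val z)) (mem_s _ _ i0t).
have m0 : val m != 0.
  apply: contraNneq c0b => m0; have := mP _ (mem_s _ _ i0t).
  rewrite m0 valuation0 leye_eq valuation_eqy => /eqP ->.
  by rewrite mul0r rpred0.
have mr t i : val (c t)`_i / val m \in vring v.
  have [it|it] := ltnP i (size (c t)).
    exact/vring_div/mP/mem_s.
  by rewrite nth_default // rmorph0 mul0r rpred0.
have bm : b / val m \in vsmall v.
  rewrite -invf_div; apply: vring_or_inv; apply: contra c0b => mb.
  have -> : val (c t0)`_i0 / b = (val (c t0)`_i0 / val m) * (val m / b).
    by rewrite mulrA divfK.
  by rewrite rpredM ?mr.
pose c' t := \poly_(i < size (c t)) VInt (mr t i).
have cE t : c t = m *: c' t.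
  apply/polyP => i; rewrite coefZ coef_poly; case: ltnP => it.
    by apply/val_inj; rewrite rmorphM /= mulrC divfK.
  by rewrite nth_default // mulr0.
have c'0 : forall t, map_poly (@vbar _ _ v) (c' t) = 0.
  apply: normal_form_small => Q.
  have nfE : nf c Q = m * nf c' Q.
    rewrite -nf_evalZ; apply: eq_bigr => t _; by rewrite {1}cE.
  rewrite (_ : val _ = (val (nf c Q) / b) * (b / val m)); first exact: vsmallMl.
  by rewrite nfE rmorphM mulrA divfK // mulrC mulKf.
have /flattenP[_ /mapP[t _ ->] /nthP-/(_ 0)[i it mE]] := ms.
have := c'0 t => /polyP/(_ i); rewrite coef0 coef_map coef_poly it => /eqP.
by rewrite /= vbar_eq0 /= mE divff // (negPf (vsmall1 v)).
Qed.

Let gv_val K : val (gv ^+ K) = gamma ^+ K.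
Proof. by rewrite rmorphXn. Qed.

(** A power of gamma clears the denominators of the coefficients. *)
Lemma polynomial_generated (G : {mpoly C[3]}) :
  exists K f, gen f /\ forall Q : pts, val (f Q) = gamma ^+ K * G.@[Q].
Proof.
pose D (h : pts -> C) := exists K f, gen f /\ forall Q, val (f Q) = gamma ^+ K * h Q.
have gc := generated_const gens.
have D_ext h h' : h =1 h' -> D h -> D h'.
  by move=> hh' [K [f [gf fE]]]; exists K, f; split=> // Q; rewrite fE hh'.
have D_const c : D (fun _ => c).
  have [e e0 eg] := vsmall_bound gamma_small; have [s sE] := valuation_lb v c.
  have [K KE] := archi_mulrn (- s) e0.
  have gc_int : gamma ^+ K * c \in vring v.
    rewrite vringE valuationM; apply: le_trans (leeD (valuation_geX K eg) sE).
    by rewrite -EFinD lee_fin -lerBlDr sub0r KE.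
  by exists K, (fun _ => VInt gc_int); split.
have D_int (b : C) f h : gen f -> b \in vring v -> (forall Q, h Q = b * val (f Q)) -> D h.
  move=> gf br hE; exists 0%N, (fun Q => VInt br * f Q); split=> [|Q].
    exact: generated_mul.
  by rewrite mul1r hE.
have ar n : a ^+ n \in vring v by rewrite rpredX // vsmallW.
have an0 n : a ^+ n != 0 by rewrite expf_neq0.
have D_coord i : D (fun Q => Q i).
  case: i => -[|[|[|//]]] i3.
  - apply: (D_int _ _ _ gen_U (ar (q ^ 4 * (q - 1))%N)) => Q.
    by rewrite /= mulrC divfK //; congr (Q _); apply/val_inj.
  - apply: (D_int _ _ _ gen_x (ar q)) => Q.
    by rewrite /= mulrC divfK //; congr (Q _); apply/val_inj.
  - apply: (D_int _ _ _ gen_y (ar q)) => Q.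
    by rewrite /= mulrC divfK //; congr (Q _); apply/val_inj.
have D_mul h h' : D h -> D h' -> D (fun Q => h Q * h' Q).
  move=> [K [f [gf fE]]] [K' [f' [gf' fE']]].
  exists (K + K')%N, (fun Q => f Q * f' Q); split=> [|Q]; first exact: generated_mul.
  transitivity (val (f Q) * val (f' Q)) => //.
  by rewrite fE fE' exprD; ring.
have D_add h h' : D h -> D h' -> D (fun Q => h Q + h' Q).
  move=> [K [f [gf fE]]] [K' [f' [gf' fE']]].
  exists (K + K')%N, (fun Q => gv ^+ K' * f Q + gv ^+ K * f' Q); split=> [|Q].
    by apply: generated_add; apply: generated_mul.
  transitivity (val (gv ^+ K') * val (f Q) + val (gv ^+ K) * val (f' Q)) => //.
  by rewrite !gv_val fE fE' exprD; ring.
have D_exp h k' : D h -> D (fun Q => h Q ^+ k').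
  move=> Dh; elim: k' => [|k' IHk]; first exact: D_const.
  by apply: D_ext (D_mul _ _ Dh IHk) => Q; rewrite exprS.
have D_prod (s : seq 'I_3) (h : 'I_3 -> pts -> C) : (forall i, D (h i)) ->
    D (fun Q => \prod_(i <- s) h i Q).
  move=> Dh; elim: s => [|i s IHs].
    by apply: D_ext (D_const 1) => Q; rewrite big_nil.
  by apply: D_ext (D_mul _ _ (Dh i) IHs) => Q; rewrite big_cons.
have D_sum (s : seq 'X_{1..3}) (h : 'X_{1..3} -> pts -> C) : (forall m, D (h m)) ->
    D (fun Q => \sum_(m <- s) h m Q).
  move=> Dh; elim: s => [|i s IHs].
    by apply: D_ext (D_const 0) => Q; rewrite big_nil.
  by apply: D_ext (D_add _ _ (Dh i) IHs) => Q; rewrite big_cons.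
apply: D_ext (fun Q => esym (mevalE _ _)) _.
apply: D_sum => m; apply: D_mul => //.
by apply: D_prod => i; apply: D_exp.
Qed.

Let coords : 'I_3 -> pts -> vint v := tnth [tuple xh; yh; Zh].

Lemma coords_rigid i : rigid (fun Q => val (coords i Q)).
Proof.
by case: i => -[|[|[|//]]] i3; [apply: xh_rigid|apply: yh_rigid|apply: Zh_rigid].
Qed.

Lemma meval_coords (G : {mpoly (vint v)[3]}) Q :
  G.@[coords^~ Q] = G.@[point3 (xh Q) (yh Q) (Zh Q)].
Proof.
by apply: meval_eq => -[[|[|[|//]]] i3].
Qed.

Let gbar : 'I_3 -> red := fun i => reduction (fun Q => val (coords i Q)).

(** Approximate the function by a polynomial in u, X_2, Y_2, and gamma^K times the
    latter by an integral normal form modulo gamma^(K+1). As the function is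
    bounded by 1, all coefficients of the normal form are divisible by gamma^K, and
    the quotient is a polynomial in x, y, Z with integral coefficients. *)
Lemma reduction_generated (s : red) : exists G, s = reduction_horner gbar G.
Proof.
have [f fI ->] := reduction_surj_fun s.
have [G0 G0f] := rigid_poly_approx 1 (let: conj h _ := asboolW fI in h).
have [K [g [gg gE]]] := polynomial_generated G0.
have [c [e [ge eE]]] := approx_normal_form_iter K.+1 gg.
have gK0 : gamma ^+ K != 0 by rewrite expf_neq0.
have small1 x : (1%:E <= v x)%E -> x \in vsmall v by apply: bounded_vsmall.
have G0r (Q : pts) : G0.@[Q] \in vring v.
  rewrite -(subKr (f Q) G0.@[Q]) rpredB ?integral_vring //.
  exact/vsmallW/small1.
have nfE (Q : pts) : val (nf c Q) = gamma ^+ K * (G0.@[Q] - gamma * val (e Q)).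
  have gE' : val (g Q) = val (nf c Q) + gamma ^+ K.+1 * val (e Q).
    by rewrite eE -gv_val.
  by rewrite -[LHS](addrK (gamma ^+ K.+1 * val (e Q))) -gE' gE exprSr; ring.
have cK := normal_form_orthonormal gK0 (c := c).
have {}cK t i : val (c t)`_i / gamma ^+ K \in vring v.
  apply: cK => Q; rewrite nfE mulrC mulKf //.
  by rewrite rpredB // rpredM ?(valP (e Q)) // vsmallW.
pose c' t := \poly_(i < size (c t)) VInt (cK t i).
have cE t : c t = gv ^+ K *: c' t.
  apply/polyP => i; rewrite coefZ coef_poly; case: ltnP => it.
    apply/val_inj; transitivity (val (gv ^+ K) * (val (c t)`_i / gamma ^+ K)) => //.
    by rewrite gv_val mulrC divfK.
  by rewrite nth_default // mulr0.
have nfE' (Q : pts) : val (nf c' Q) = G0.@[Q] - gamma * val (e Q).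
  apply: (mulfI gK0); rewrite -nfE -gv_val.
  transitivity (val (gv ^+ K * nf c' Q)) => //; rewrite -nf_evalZ.
  by congr val; apply: eq_bigr => t _; rewrite {1}cE.
pose G := nf_eval (@mpolyC 3 (vint v)) (moore (q ^ 2) 'X_0 'X_1) 'X_0 'X_1 ('X_2 + 1) c'.
exists (map_mpoly (@vbar _ _ v) G); rewrite reduction_hornerE; last exact: coords_rigid.
apply/reduction_eqP => //.
  by apply: vint_integral; apply: meval_vint_rigid; apply: coords_rigid.
have [eps eps0 geps] := vsmall_bound gamma_small.
exists (Num.min 1 eps) => [|Q]; first by rewrite lt_min ltr01.
rewrite meval_coords meval_normal_form nfE' opprB addrCA.
apply: valuation_leD.
  rewrite valuationM -[X in (X%:E <= _)%E]addr0 EFinD leeD //.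
    by apply: le_trans geps; rewrite lee_fin ge_min lexx orbT.
  by rewrite -vringE; apply: valP.
by apply: le_trans (G0f Q); rewrite lee_fin ge_min lexx.
Qed.

Lemma lift_mpoly (G : {mpoly k[3]}) : exists H, map_mpoly (@vbar _ _ v) H = G.
Proof.
have /choice[l lE] := @vbar_surj _ _ v.
exists (\sum_(m <- msupp G) l G@_m *: 'X_[m]); rewrite [RHS]mpolyE.
rewrite (raddf_sum (map_mpoly _)); apply: eq_bigr => m _ /=.
by rewrite map_mpolyZ map_mpolyX; congr (_ *: _); apply: lE.
Qed.

(** A polynomial in x, y, Z that is small at all points vanishes on the reduced curve,
    every point of which lifts. *)
Lemma reduction_relations (G : {mpoly k[3]}) : reduction_horner gbar G = 0 <->
  exists A B, G = A * drinfeld_rel1 k q + B * drinfeld_rel2 k q.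
Proof.
have fI H : (fun Q : pts => val (H.@[coords^~ Q])) \in
    integral_fun (Y:=Y22_set v q P pi2).
  by apply: vint_integral; apply: meval_vint_rigid; apply: coords_rigid.
have I0 : (fun _ : pts => 0 : C) \in integral_fun (Y:=Y22_set v q P pi2).
  by apply: const_integral; apply: rpred0.
split=> [|[A [B GE]]].
  have [H <-] := lift_mpoly G; rewrite reduction_hornerE; last exact: coords_rigid.
  rewrite -reduction0 => /(reduction_eqP (fI H) I0)[eps eps0 feps].
  apply: curve_nullstellensatz => //; first exact: residue_closed dense.
  move=> x y z d1 zE; have [Q [xE yE ZE]] := reduction_points_surj d1 zE.
  have : vbar (H.@[coords^~ Q]) = 0.
    apply/eqP; rewrite vbar_eq0; apply: bounded_vsmall eps0 _.
    by have := feps Q; rewrite subr0.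
  rewrite -meval_map_mpoly => <-; apply: meval_eq => -[[|[|[|//]]] i3].
  - by rewrite -xE.
  - by rewrite -yE.
  - by rewrite -ZE.
have [A' AE] := lift_mpoly A; have [B' BE] := lift_mpoly B.
pose H := A' * drinfeld_rel1 (vint v) q + B' * drinfeld_rel2 (vint v) q.
have HE : map_mpoly (@vbar _ _ v) H = G by rewrite map_drinfeld_rels AE BE GE.
rewrite -HE reduction_hornerE; last exact: coords_rigid.
rewrite -reduction0; apply/(reduction_eqP (fI _) I0).
have [eps eps0 geps] := vsmall_bound gamma_small; exists eps => // Q.
rewrite subr0 meval_coords /H mevalD (mevalM _ A') (mevalM _ B') meval_rel1 meval_rel2.
rewrite d_eq Z_eq; set A1 := A'.@[_]; set B1 := B'.@[_].
set t := moore _ _ _; have -> : A1 * (1 + gv * Zh Q - 1) + B1 * (t + gv * Z_error Q - t) =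
  gv * (A1 * Zh Q + B1 * Z_error Q) by ring.
rewrite -[X in (X%:E <= _)%E]addr0 EFinD rmorphM valuationM leeD //.
by rewrite -vringE; apply: valP.
Qed.

Variable (sigma : {rmorphism C -> C}).
Hypothesis sigma_inertia : inertia v iota jota sigma.
Hypothesis sigma_pi2 : sigma pi2 = pi2.

Let sigma_v x : v (sigma x) = v x := inertia_valuation local_F sigma_inertia x.

(** The equations of the curve have coefficients fixed by sigma. *)
Lemma inertia_point (Q : pts) : exists Q' : pts, forall i, sigma (Q' i) = Q i.
Proof.
have [[tau sK tauK] _ _] := sigma_inertia.
have sP : sigma P = P := inertia_base sigma_inertia pi.
pose Q' i := tau (Q i); have sQ i : sigma (Q' i) = Q i by rewrite /Q' tauK.
have Q'D i : ((Y22_radius R q i)%:E <= v (Q' i))%E.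
  by rewrite -sigma_v sQ; apply: affinoid_pointD.
have s_pi_mult u X : sigma (pi_mult q P u X) = pi_mult q P (sigma u) (sigma X).
  by rewrite /pi_mult !(rmorphD, rmorphM, rmorphXn) /= sP.
have s_mu2 u X1 X2 : sigma (mu2 q P u X1 X2) = mu2 q P (sigma u) (sigma X1) (sigma X2).
  by rewrite /mu2 /pi_mult !(rmorphD, rmorphN, rmorphM, rmorphXn) /= sP.
have Q'Y : Y22_set v q P pi2 Q'.
  have [[Qu Q1 Q2 Qmu] Qr] := affinoid_pointP Q.
  split; last by rewrite -sigma_v sQ.
  split.
  - by rewrite -sigma_v sQ.
  - by apply: (fmorph_inj sigma); rewrite !s_pi_mult !sQ Q1 rmorph0.
  - by apply: (fmorph_inj sigma); rewrite !s_pi_mult !sQ Q2 rmorph0.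
  - by apply: (fmorph_inj sigma); rewrite s_mu2 !sQ sigma_pi2.
by exists (AffinoidPoint Q'Y Q'D).
Qed.

Variable zeta : C.
Hypothesis sigma_a : sigma a = zeta * a.

Lemma zeta_unity : zeta ^+ (q ^ 2 * (q + 1)) = 1.
Proof.
apply: (mulIf (expf_neq0 (q ^ 2 * (q + 1)) a0)).
by rewrite -exprMn -sigma_a -rmorphXn aE sigma_pi2 mul1r.
Qed.

Lemma zetaq_unity : zeta ^+ (q * (q + 1)) = 1.
Proof.
apply: (exprq_inj q_char); rewrite /= expr1n -exprM -zeta_unity.
by congr (_ ^+ _); rewrite -mulnn; ring.
Qed.

(** zeta^(q(q+1)) = 1 as its q-th power is 1, and the exponent in sigma(gamma) / gamma
    becomes a multiple of q(q+1) after multiplication by q. *)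
Lemma sigma_gamma : sigma gamma = gamma.
Proof.
rewrite rmorphXn sigma_a exprMn (_ : zeta ^+ _ = 1) ?mul1r //.
apply: (exprq_inj q_char); rewrite /= expr1n -exprM.
rewrite (_ : _ * q = q * (q + 1) * ((q - 1) * (q - 1)))%N.
  by rewrite exprM zetaq_unity expr1n.
by exponents.
Qed.

Let redx : red := reduction (fun Q => val (xh Q)).
Let redy : red := reduction (fun Q => val (yh Q)).
Let redZ : red := reduction (fun Q => val (Zh Q)).

Lemma reduction_presentedP : reduction_presented (tnth [tuple redx; redy; redZ])
  [:: drinfeld_rel1 k q; drinfeld_rel2 k q].
Proof.
have -> : tnth [tuple redx; redy; redZ] = gbar.
  by apply/funext => -[[|[|[|//]]] i3].
split=> [s|G]; first exact: reduction_generated.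
rewrite reduction_relations; split=> [[A [B ->]]|[c ->]].
  exists (fun i => if i == 0 then A else B).
  by rewrite !big_ord_recl big_ord0 addr0.
exists (c 0), (c 1); rewrite !big_ord_recl big_ord0 addr0.
by congr (_ + c _ * _); apply/val_inj.
Qed.

Lemma zetaq_vring : zeta ^- q \in vring v.
Proof.
have zN : zeta ^- q ^+ (q + 1) = 1 by rewrite exprVn -exprM zetaq_unity invr1.
by apply: (@vring_rootX _ _ _ _ (q + 1)); rewrite ?zN ?rpred1 // addn1.
Qed.

(** sigma(X_2 / a^q) involves sigma(a)^q = zeta^q a^q, whence the factor zeta^-q on x and
    y; in Z it occurs with the power q + 1, which is trivial. *)
Lemma reduction_action_exists : exists2 phi : {rmorphism red -> red},
  reduction_action sigma phi &
  [/\ phi redx = reduction_const _ _ (vres v (zeta ^- q)) * redx,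
      phi redy = reduction_const _ _ (vres v (zeta ^- q)) * redy & phi redZ = redZ].
Proof.
have /choice[T TE] := inertia_point.
exists (conj_rmorphism sigma_v TE).
  apply: conj_reduction_action => x.
  exact: (inertia_residue local_F completion_C sigma_inertia).
have zetaI : (fun _ : pts => zeta ^- q) \in integral_fun (Y:=Y22_set v q P pi2).
  by apply: const_integral; apply: zetaq_vring.
have aq0 : a ^+ q != 0 by rewrite expf_neq0.
have zeta0 : zeta != 0.
  apply/eqP => z0; have /eqP := zetaq_unity; rewrite z0 expr0n muln_eq0 addn1 orbF.
  by rewrite gtn_eqF ?(ltnW q_gt1) // eq_sym oner_eq0.
have sigma_div (Q : pts) i : sigma (T Q i / a ^+ q) = zeta ^- q * (Q i / a ^+ q).
  by rewrite fmorph_div TE rmorphXn sigma_a exprMn invfM mulrCA.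
split.
- rewrite conj_rmorphismE; last exact: vint_integral xh_rigid.
  rewrite reduction_constE ?zetaq_vring // -reductionM //; last exact: vint_integral xh_rigid.
  by congr reduction; apply/funext => Q; apply: sigma_div.
- rewrite conj_rmorphismE; last exact: vint_integral yh_rigid.
  rewrite reduction_constE ?zetaq_vring // -reductionM //; last exact: vint_integral yh_rigid.
  by congr reduction; apply/funext => Q; apply: sigma_div.
- rewrite conj_rmorphismE; last exact: vint_integral Zh_rigid.
  congr reduction; apply/funext => Q; rewrite /semilinear_conj /= /scaled_Z.
  rewrite fmorph_div sigma_gamma rmorphB rmorph1 moore_morph.
  rewrite (sigma_div Q 1) (sigma_div Q 2) moore_scale.
  by rewrite exprVn -exprM -addn1 zetaq_unity invr1 mul1r.
Qed.

End Main.

Theorem lemma4p11 (R : realType) (p q : nat)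
    (F : fieldType) (Fbar : closedFieldType) (C : fieldType)
    (iota : {rmorphism F -> Fbar}) (jota : {rmorphism Fbar -> C})
    (v : valuation R C) (pi : F)
    (local_F : local_field p q (valuation_pull (jota \o iota) v) pi)
    (completion_C : completed_closure v iota jota)
    (pi2 : C) (pi2_gen : LT_generator2 q (jota (iota pi)) pi2)
    (alpha alpha1 gamma1 : C)
    (alphaE : alpha ^+ (q * (q + 1)) = pi2)
    (alpha1E : alpha1 ^+ q = alpha)
    (gamma1E : gamma1 ^+ q = alpha ^+ ((q - 1) * (q ^ 2 - 1)))
    (sigma : {rmorphism C -> C})
    (sigma_inertia : inertia v iota jota sigma)
    (sigma_pi2 : sigma pi2 = pi2)
    (zeta : C) (sigma_alpha1 : sigma alpha1 = zeta * alpha1) :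
  let Y := Y22_set v q (jota (iota pi)) pi2 in
  let r := Y22_radius R q in
  let fx : Y22_point v q (jota (iota pi)) pi2 -> C := Y22_x alpha in
  let fy : Y22_point v q (jota (iota pi)) pi2 -> C := Y22_y alpha in
  let fZ : Y22_point v q (jota (iota pi)) pi2 -> C := Y22_Z alpha gamma1 in
  let x : reduction_ring v r Y := reduction fx in
  let y : reduction_ring v r Y := reduction fy in
  let Z : reduction_ring v r Y := reduction fZ in
  [/\ zeta ^+ (q ^ 2 * (q + 1)) = 1,
      [/\ rigid fx /\ power_bounded fx, rigid fy /\ power_bounded fy &
          rigid fZ /\ power_bounded fZ],
      reduction_presented (tnth [tuple x; y; Z])
        [:: 'X_0 ^+ q * 'X_1 - 'X_0 * 'X_1 ^+ q - 1;
            'X_2 ^+ q - ('X_0 ^+ (q ^ 3) * 'X_1 - 'X_0 * 'X_1 ^+ (q ^ 3))] &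
      exists2 phi : {rmorphism reduction_ring v r Y -> reduction_ring v r Y},
        reduction_action sigma phi &
        [/\ phi x = reduction_const r Y (vres v (zeta ^- q)) * x,
            phi y = reduction_const r Y (vres v (zeta ^- q)) * y &
            phi Z = Z]].
Proof.
subst alpha.
have aE : alpha1 ^+ (q ^ 2 * (q + 1)) = pi2.
  by rewrite -alphaE -exprM mulnA.
have gam1 : gamma1 = gamma q alpha1.
  apply: (exprq_inj (pchar_nat_C local_F)) => /=.
  by rewrite gamma1E /gamma -!exprM mulnC.
subst gamma1 => Y r fx fy fZ x y Z.
have xI := vint_integral (xh_rigid local_F pi2_gen aE).
have yI := vint_integral (yh_rigid local_F pi2_gen aE).
have ZI := vint_integral (Zh_rigid local_F pi2_gen aE).
split.
- exact: (zeta_unity local_F pi2_gen aE sigma_pi2 sigma_alpha1).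
- by split; [move: xI|move: yI|move: ZI] => /asboolP.
- have := reduction_presentedP local_F completion_C pi2_gen aE.
  by rewrite /drinfeld_rel1 /drinfeld_rel2.
- exact: (reduction_action_exists local_F completion_C pi2_gen aE sigma_inertia
            sigma_pi2 sigma_alpha1).
Qed.
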